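(* Let $T(a,b,c)$ be the meromorphic continuation to $\mathbb C^3$ of $\sum_{m,n\ge1}m^{-a}n^{-b}(m+n)^{-c}$. For integers $\ell,m\ge0$ put $$A_\ell=a+c-1+\ell,\qquad B_m=b+c-1+m,\qquad F=a+b+c-2.$$ At generic points of the indicated intersections, $$[A_\ell^{-1}B_m^{-1}]T=0,\qquad [A_\ell^{-1}F^{-1}]T=(-1)^\ell\frac{(c)_\ell}{\ell!},\qquad [B_m^{-1}F^{-1}]T=(-1)^m\frac{(c)_m}{m!}.$$ The three carrier families $A_\ell=0$, $B_m=0$, $F=0$ meet at $(a,b,c)=(1+m,1+\ell,-\ell-m)$. At that point the two nested mixed coefficients are $$[A_\ell^{-1}F^{-1}]T=[B_m^{-1}F^{-1}]T=\binom{\ell+m}{\ell},$$ whereas neither $A_\ell^{-1}B_m^{-1}$ nor $A_\ell^{-1}B_m^{-1}F^{-1}$ occurs. (Simple-pole terms belonging to the three individual divisors may also be present.)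
   Context: $(x)_\ell=x(x+1)\cdots(x+\ell-1)$, $(x)_0=1$. The polar hyperplanes of $T$ are $A_\ell=0$, $B_m=0$ $(\ell,m\ge0)$ and $F=0$. A generic point of an intersection of two of them is one lying on no other of these hyperplanes. For two of these forms $X,Y$, $[X^{-1}Y^{-1}]T$ denotes the coefficient of $X^{-1}Y^{-1}$ in the local Laurent expansion of $T$ when $X,Y$ are used as transverse coordinates, a function on $\{X=Y=0\}$. At the triple point, where $A_\ell,B_m,F$ are independent affine coordinates, the statement refers to the local expansion of $T$ as a sum of holomorphic coefficients times products of distinct elements of $\{A_\ell^{-1},B_m^{-1},F^{-1}\}$. *)

(* Defs.v *)
(* Stdlib reals with Coquelicot's complex numbers C. *)
From Stdlib Require Export Reals ZArith.
From Coquelicot Require Export Coquelicot.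

Open Scope C_scope.

Definition C3 : Type := (C * C * C)%type.
Definition ca (p : C3) : C := fst (fst p).
Definition cb (p : C3) : C := snd (fst p).
Definition cc (p : C3) : C := snd p.

Definition polydisc (p : C3) (r : R) (q : C3) : Prop :=
  (Cmod (ca q - ca p) < r /\ Cmod (cb q - cb p) < r /\ Cmod (cc q - cc p) < r)%R.

(* Absolutely convergent multiple series with a given sum.  Since the partial
   sums of the moduli are bounded, summing over cubes is no restriction. *)
Definition has_sum2 (u : nat -> nat -> C) (s : C) : Prop :=
  (exists M : R, forall n : nat,
      (sum_n (fun i => sum_n (fun j => Cmod (u i j)) n) n <= M)%R) /\
  filterlim (fun n : nat => sum_n (fun i => sum_n (fun j => u i j) n) n)
    eventually (locally s).

Definition has_sum3 (u : nat -> nat -> nat -> C) (s : C) : Prop :=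
  (exists M : R, forall n : nat,
      (sum_n (fun i => sum_n (fun j => sum_n (fun l =>
         Cmod (u i j l)) n) n) n <= M)%R) /\
  filterlim (fun n : nat =>
      sum_n (fun i => sum_n (fun j => sum_n (fun l => u i j l) n) n) n)
    eventually (locally s).

(* Holomorphic functions of several variables in the sense of Weierstrass:
   sums of convergent power series (as in Gunning and Rossi).  This is a
   property of the germ at p and implies holomorphy on a neighbourhood of p. *)
Definition holomorphic_at (f : C3 -> C) (p : C3) : Prop :=
  exists (k : nat -> nat -> nat -> C) (r : R), (0 < r)%R /\
    forall q : C3, polydisc p r q ->
      has_sum3 (fun i j l =>
        k i j l * (ca q - ca p) ^ i * (cb q - cb p) ^ j * (cc q - cc p) ^ l)
        (f q).

Definition holomorphic_on_disc (f : C -> C) (z0 : C) (r : R) : Prop :=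
  exists k : nat -> C, forall z : C, (Cmod (z - z0) < r)%R ->
    is_pseries (K := C_AbsRing) (V := C_NormedModule) k (z - z0) (f z).

Definition meromorphic_at (f : C3 -> C) (p : C3) : Prop :=
  exists g h : C3 -> C,
    holomorphic_at g p /\ holomorphic_at h p /\
    (forall e : R, (0 < e)%R -> exists q : C3, polydisc p e q /\ h q <> 0) /\
    (exists r : R, (0 < r)%R /\
       forall q : C3, polydisc p r q -> h q <> 0 -> f q = g q / h q).

(* HA l, HB m, HF are the hyperplanes A_l = 0, B_m = 0, F = 0. *)
Inductive hyperplane : Type :=
| HA (l : nat)
| HB (m : nat)
| HF.

Definition form (H : hyperplane) (p : C3) : C :=
  match H with
  | HA l => ca p + cc p - 1 + INR l
  | HB m => cb p + cc p - 1 + INR m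
  | HF => ca p + cb p + cc p - 2
  end.

Definition generic_point (H K : hyperplane) (p : C3) : Prop :=
  form H p = 0 /\ form K p = 0 /\
  forall L : hyperplane, form L p = 0 -> L = H \/ L = K.

Definition Cexp (z : C) : C :=
  ((exp (Re z) * cos (Im z))%R, (exp (Re z) * sin (Im z))%R).

(* n ^ s for an integer n >= 1 and a complex exponent s. *)
Definition nat_cpow (n : nat) (s : C) : C := Cexp (s * ln (INR n)).

(* The indices i, j >= 0 stand for m = i + 1 and n = j + 1. *)
Definition tornheim_term (p : C3) (i j : nat) : C :=
  nat_cpow (S i) (- ca p) * nat_cpow (S j) (- cb p) *
  nat_cpow (S i + S j) (- cc p).

(* T represents the meromorphic continuation as a total function: it is
   holomorphic off the polar hyperplanes, and its values on them are
   irrelevant (every statement about T below only involves points off them). *)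
Definition is_meromorphic_continuation (T : C3 -> C) : Prop :=
  (forall p : C3, meromorphic_at T p) /\
  (forall p : C3, (forall H : hyperplane, form H p <> 0) ->
     holomorphic_at T p) /\
  (forall (p : C3) (s : C), has_sum2 (tornheim_term p) s -> T p = s).

Fixpoint Cpochhammer (x : C) (l : nat) : C :=
  match l with
  | O => 1
  | S l' => Cpochhammer x l' * (x + INR l')
  end.

Definition Cpow_Z (z : C) (n : Z) : C :=
  match n with
  | Zneg k => / z ^ Pos.to_nat k
  | _ => z ^ Z.to_nat n
  end.

(* Local Laurent expansion T = sum_(i, j >= - N) k_ij X^i Y^j at p, where
   X = form H, Y = form K.  For H, K in two different families X, Y, c are
   affine coordinates of C^3, so functions on X = Y = 0 are functions of c. *)
Definition laurent_expansion (T : C3 -> C) (H K : hyperplane) (p : C3)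
    (k : Z -> Z -> C -> C) : Prop :=
  exists (N : nat) (r : R), (0 < r)%R /\
    (forall (i j : Z) (z : C),
       (i < - Z.of_nat N \/ j < - Z.of_nat N)%Z -> k i j z = 0) /\
    (forall i j : Z, holomorphic_on_disc (k i j) (cc p) r) /\
    (forall q : C3, polydisc p r q -> form H q <> 0 -> form K q <> 0 ->
       has_sum2 (fun i j : nat =>
         let i' := (Z.of_nat i - Z.of_nat N)%Z in
         let j' := (Z.of_nat j - Z.of_nat N)%Z in
         k i' j' (cc q) * Cpow_Z (form H q) i' * Cpow_Z (form K q) j')
         (T q)).

(* The value at p of [X^-1 Y^-1] T, where X = form H, Y = form K. *)
Definition mixed_coefficient (T : C3 -> C) (H K : hyperplane) (p : C3)
    (v : C) : Prop :=
  exists k : Z -> Z -> C -> C,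
    laurent_expansion T H K p k /\ k (-1)%Z (-1)%Z (cc p) = v.

Definition pole_factor (b : bool) (z : C) : C := if b then / z else 1.

(* Local expansion of T at a triple point as a sum of holomorphic coefficients
   h times products of distinct elements of X^-1, Y^-1, Z^-1 (for the forms
   X, Y, Z of H, K, L): h x y z is the coefficient of the product of the
   inverses whose flag is true.  Writing X^-1 Y^-1 = Z X^-1 Y^-1 Z^-1 shows that
   holomorphy alone does not determine h; as in a Laurent expansion in the
   coordinates X, Y, Z, a coefficient depends only on the coordinates that do
   not occur in its denominator, and this makes h unique near p. *)
Definition triple_expansion (T : C3 -> C) (H K L : hyperplane) (p : C3)
    (h : bool -> bool -> bool -> C3 -> C) : Prop :=
  (forall x y z : bool, holomorphic_at (h x y z) p) /\
  (exists r : R, (0 < r)%R /\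
    (forall (x y z : bool) (q q' : C3), polydisc p r q -> polydisc p r q' ->
       (x = false -> form H q = form H q') ->
       (y = false -> form K q = form K q') ->
       (z = false -> form L q = form L q') ->
       h x y z q = h x y z q') /\
    (forall q : C3, polydisc p r q ->
       form H q <> 0 -> form K q <> 0 -> form L q <> 0 ->
       let t x y z :=
         h x y z q * pole_factor x (form H q) * pole_factor y (form K q) *
         pole_factor z (form L q) in
       T q = t false false false +
             t true false false + t false true false + t false false true +
             t true true false + t true false true + t false true true +
             t true true true)).

Definition not_occurring (h : C3 -> C) (p : C3) : Prop :=
  exists r : R, (0 < r)%R /\ forall q : C3, polydisc p r q -> h q = 0.

Definition triple_point (l m : nat) : C3 :=
  (1 + RtoC (INR m), 1 + RtoC (INR l), - RtoC (INR l) - RtoC (INR m)).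

(* Main.v *)
(*
  Write T in the coordinates u = (A_0, B_0, F).  Two relations drive the proof.
  Splitting 1/(mn) = (1/m + 1/n)/(m + n) gives T(u) = T(u + e1) + T(u + e2).
  Summing over m the difference of x^-a (x + n)^-c between x = m + 1/2 and
  x = m - 1/2 telescopes; expanding the two values at m by the binomial series
  expresses the boundary term through values of T with shifted exponents, up to
  a remainder that converges on a larger domain.  Both relations hold where the
  series converges, and the identity theorem, applied along segments that avoid
  the hyperplanes on which a coordinate is an integer, extends them.

  From the second relation, F T is analytic for Re A_0, Re B_0 > 0, and A_0 T is
  analytic up to terms of larger real part; a descending induction with the first
  relation gives X Y Z T = Y g1 + X g2 with g1, g2 analytic near any point, where
  X, Y, Z are the coordinates centred at that point.  Hence 1/(XY) and 1/(XYZ) never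
  occur, and a coordinate that is not polar at the point can be divided out, since T
  is holomorphic off the polar hyperplanes.

  At b = 0 the n-sum telescopes up to a convergent error, which makes the
  F-residue at A_0 = 1 equal to 1/B_0 for Re B_0 > 0; the second relation turns it
  into [A_0^-1 F^-1] T = 1 and multiplies the coefficient by -(c + l)/(l + 1) when
  A_l is replaced by A_(l+1), and the first one removes the restriction on Re B_0.
  At the triple point g1 takes the limit value (-1)^l (c)_l / l! at c = -l - m,
  a binomial coefficient.
*)
Require Import Defs.
From Stdlib Require Import Lra Lia List Permutation Classical ClassicalEpsilon FunctionalExtensionality.

(** * Unordered sums *)

(** Half-unit steps are chosen for two reasons. The ratio of the step to [xx i] is at most 1/2 from
    the first index on, so the binomial series always converges. The zeroth-order terms at the two
    ends cancel, so the relation starts with a and c times T with a, respectively c, raised by one.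
    In the coordinates (A_0, B_0, F) every such shift is an integer translation and the polar
    families are coordinate hyperplanes. The tail gains only powers of 1/m, which enlarges the
    domain in A_0 and F but never in B_0: a descent in A_0 pays up to one unit of B_0 per step, and
    the splitting relation has to bring B_0 down again. The values of T on its polar hyperplanes are
    arbitrary, so analytic continuation is expressed by agreement at the points without integer
    coordinates, which are dense and stable under the translations. All estimates use one weighted
    l1 norm of power series coefficients: products, substitutions and infinite sums of analytic
    functions become rearrangements of absolutely summable families, without Cauchy integrals. *)

Definition eqd {I : Type} (x y : I) : {x = y} + {x <> y} :=
  excluded_middle_informative (x = y).

Fixpoint rsum {I : Type} (L : list I) (f : I -> R) : R :=
  match L with nil => 0%R | i :: L' => (f i + rsum L' f)%R end.

Fixpoint csum {I : Type} (L : list I) (f : I -> C) : C :=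
  match L with nil => 0 | i :: L' => f i + csum L' f end.

Lemma rsum_perm {I} (L L' : list I) f : Permutation L L' -> rsum L f = rsum L' f.
Proof. induction 1; simpl; try lra. Qed.

Lemma csum_perm {I} (L L' : list I) f : Permutation L L' -> csum L f = csum L' f.
Proof. induction 1; simpl; try ring; congruence. Qed.

Lemma rsum_app {I} (L L' : list I) f : rsum (L ++ L') f = (rsum L f + rsum L' f)%R.
Proof. induction L; simpl; lra. Qed.

Lemma csum_app {I} (L L' : list I) f : csum (L ++ L') f = csum L f + csum L' f.
Proof. induction L; simpl; [ring | rewrite IHL; ring]. Qed.

Lemma rsum_ext {I} (L : list I) f g :
  (forall i, In i L -> f i = g i) -> rsum L f = rsum L g.
Proof. induction L; simpl; intros H; auto. rewrite H, IHL; auto. Qed.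

Lemma csum_ext {I} (L : list I) f g :
  (forall i, In i L -> f i = g i) -> csum L f = csum L g.
Proof. induction L; simpl; intros H; auto. rewrite H, IHL; auto. Qed.

Lemma rsum_le {I} (L : list I) f g :
  (forall i, In i L -> (f i <= g i)%R) -> (rsum L f <= rsum L g)%R.
Proof.
  induction L; simpl; intros H; [lra|].
  apply Rplus_le_compat; auto.
Qed.

Lemma rsum_ge0 {I} (L : list I) f :
  (forall i, (0 <= f i)%R) -> (0 <= rsum L f)%R.
Proof. intros H; induction L; simpl; [lra|]. specialize (H a); lra. Qed.

Lemma rsum_plus {I} (L : list I) f g :
  rsum L (fun i => f i + g i)%R = (rsum L f + rsum L g)%R.
Proof. induction L; simpl; lra. Qed.

Lemma rsum_scal {I} (L : list I) c f :
  rsum L (fun i => c * f i)%R = (c * rsum L f)%R.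
Proof. induction L; simpl; [lra|]. rewrite IHL; lra. Qed.

Lemma csum_plus {I} (L : list I) f g :
  csum L (fun i => f i + g i) = csum L f + csum L g.
Proof. induction L; simpl; [ring|]. rewrite IHL; ring. Qed.

Lemma csum_scal {I} (L : list I) c f : csum L (fun i => c * f i) = c * csum L f.
Proof. induction L; simpl; [ring|]. rewrite IHL; ring. Qed.

Lemma csum_mod {I} (L : list I) f :
  (Cmod (csum L f) <= rsum L (fun i => Cmod (f i)))%R.
Proof.
  induction L; simpl; [rewrite Cmod_0; lra|].
  eapply Rle_trans; [apply Cmod_triangle|]. lra.
Qed.

Lemma csum_Re {I} (L : list I) f : Re (csum L f) = rsum L (fun i => Re (f i)).
Proof. induction L; simpl; [reflexivity|]. rewrite <- IHL. reflexivity. Qed.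

Lemma csum_Im {I} (L : list I) f : Im (csum L f) = rsum L (fun i => Im (f i)).
Proof. induction L; simpl; [reflexivity|]. rewrite <- IHL. reflexivity. Qed.

Lemma csum_RtoC {I} (L : list I) f :
  csum L (fun i => RtoC (f i)) = RtoC (rsum L f).
Proof. induction L; simpl; [reflexivity|]. rewrite IHL, RtoC_plus. reflexivity. Qed.

(** Duplicate-free lists stand for finite sets; splitting off the complement turns inclusion into a
    permutation, under which finite sums are invariant. *)
Lemma incl_split {I} (L L' : list I) :
  NoDup L -> incl L L' -> exists L'', Permutation L' (L ++ L'').
Proof.
  revert L'; induction L as [|i L IH]; intros L' HN HI.
  - exists L'; apply Permutation_refl.
  - inversion HN; subst.
    destruct (in_split i L') as [A [B HAB]]; [apply HI; left; auto|].
    subst L'.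
    destruct (IH (A ++ B)) as [L'' HL''].
    + auto.
    + intros j Hj. assert (HJ := HI j (or_intror Hj)).
      apply in_app_or in HJ; apply in_or_app. destruct HJ as [HJ|[HJ|HJ]]; auto.
      subst; contradiction.
    + exists L''. simpl.
      eapply Permutation_trans;
        [apply Permutation_sym, Permutation_middle|]. constructor; auto.
Qed.

Lemma rsum_incl {I} (L L' : list I) f : (forall i, (0 <= f i)%R) ->
  NoDup L -> incl L L' -> (rsum L f <= rsum L' f)%R.
Proof.
  intros Hf HN HI. destruct (incl_split L L' HN HI) as [K HK].
  rewrite (rsum_perm _ _ f HK), rsum_app. pose proof (rsum_ge0 K f Hf). lra.
Qed.

(** For non-negative families this is summability with an explicit bound, and the bound is what the
    later estimates propagate. *)
Definition SumLe {I : Type} (v : I -> R) (M : R) : Prop :=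
  forall L : list I, NoDup L -> (rsum L v <= M)%R.

(** Convergence along the net of finite subsets. No enumeration of I is involved, so reindexing and
    exchanging double sums need no order of summation. *)
Definition HS {I : Type} (u : I -> C) (s : C) : Prop :=
  forall eps : R, (0 < eps)%R -> exists L0 : list I, forall L : list I,
    NoDup L -> incl L0 L -> (Cmod (csum L u - s) < eps)%R.

Definition rHS {I : Type} (v : I -> R) (s : R) : Prop :=
  forall eps : R, (0 < eps)%R -> exists L0 : list I, forall L : list I,
    NoDup L -> incl L0 L -> (Rabs (rsum L v - s) < eps)%R.

Lemma SumLe_ge0 {I} (v : I -> R) M : SumLe v M -> (0 <= M)%R.
Proof. intros H. exact (H nil (NoDup_nil _)). Qed.

Lemma SumLe_1 {I} (v : I -> R) M i : SumLe v M -> (v i <= M)%R.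
Proof.
  intros H. specialize (H (i :: nil)). simpl in H.
  assert (NoDup (i :: nil)) by (constructor; [simpl; tauto | constructor]).
  specialize (H H0). lra.
Qed.

Lemma SumLe_le {I} (v w : I -> R) M N :
  (forall i, (v i <= w i)%R) -> (M <= N)%R -> SumLe w M -> SumLe v N.
Proof.
  intros H HMN HS L HL. eapply Rle_trans; [apply rsum_le; intros; apply H|].
  eapply Rle_trans; [apply HS; auto|auto].
Qed.

Lemma SumLe_scal {I} (v : I -> R) M c : (0 <= c)%R ->
  SumLe v M -> SumLe (fun i => c * v i)%R (c * M)%R.
Proof.
  intros Hc H L HL. rewrite rsum_scal. apply Rmult_le_compat_l; auto.
Qed.

Lemma SumLe_plus {I} (v w : I -> R) M N :
  SumLe v M -> SumLe w N -> SumLe (fun i => v i + w i)%R (M + N)%R.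
Proof.
  intros H H' L HL. rewrite rsum_plus. apply Rplus_le_compat; auto.
Qed.

Lemma union_list {I} (L L' : list I) : exists K, NoDup K /\ incl L K /\ incl L' K.
Proof.
  exists (nodup eqd (L ++ L')). split; [apply NoDup_nodup|].
  split; intros i Hi; apply nodup_In, in_or_app; auto.
Qed.

Lemma HS_unique {I} (u : I -> C) s t : HS u s -> HS u t -> s = t.
Proof.
  intros Hs Ht. apply Ceq_minus. apply NNPP; intros Hn.
  apply Cmod_gt_0 in Hn.
  destruct (Hs (Cmod (s - t) / 2)%R ltac:(lra)) as [L1 H1].
  destruct (Ht (Cmod (s - t) / 2)%R ltac:(lra)) as [L2 H2].
  destruct (union_list L1 L2) as [K [HK [K1 K2]]].
  specialize (H1 K HK K1). specialize (H2 K HK K2).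
  assert (Cmod (s - t) <= Cmod (csum K u - t) + Cmod (csum K u - s))%R.
  { replace (s - t) with ((csum K u - t) + - (csum K u - s)) by ring.
    eapply Rle_trans; [apply Cmod_triangle|]. rewrite Cmod_opp. lra. }
  lra.
Qed.

Lemma HS_ext {I} (u v : I -> C) s : (forall i, u i = v i) -> HS u s -> HS v s.
Proof.
  intros H Hs eps He. destruct (Hs eps He) as [L0 H0]. exists L0.
  intros L HL HI. rewrite <- (csum_ext L u v); auto.
Qed.

Lemma HS_plus {I} (u v : I -> C) s t :
  HS u s -> HS v t -> HS (fun i => u i + v i) (s + t).
Proof.
  intros Hs Ht eps He.
  destruct (Hs (eps / 2)%R ltac:(lra)) as [L1 H1].
  destruct (Ht (eps / 2)%R ltac:(lra)) as [L2 H2].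
  exists (L1 ++ L2). intros L HL HI. rewrite csum_plus.
  replace (csum L u + csum L v - (s + t)) with
    ((csum L u - s) + (csum L v - t)) by ring.
  eapply Rle_lt_trans; [apply Cmod_triangle|].
  assert (Cmod (csum L u - s) < eps / 2)%R.
  { apply H1; auto. intros i Hi; apply HI, in_or_app; auto. }
  assert (Cmod (csum L v - t) < eps / 2)%R.
  { apply H2; auto. intros i Hi; apply HI, in_or_app; auto. }
  lra.
Qed.

Lemma HS_scal {I} (u : I -> C) s c : HS u s -> HS (fun i => c * u i) (c * s).
Proof.
  intros Hs eps He.
  assert (Hc : (0 < Cmod c + 1)%R) by (pose proof (Cmod_ge_0 c); lra).
  destruct (Hs (eps / (Cmod c + 1))%R) as [L0 H0].
  { apply Rdiv_lt_0_compat; auto. }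
  exists L0. intros L HL HI. rewrite csum_scal.
  replace (c * csum L u - c * s) with (c * (csum L u - s)) by ring.
  rewrite Cmod_mult. specialize (H0 L HL HI).
  pose proof (Cmod_ge_0 c). pose proof (Cmod_ge_0 (csum L u - s)).
  apply Rle_lt_trans with ((Cmod c + 1) * Cmod (csum L u - s))%R; [nra|].
  apply Rmult_lt_compat_l with (r := (Cmod c + 1)%R) in H0; auto.
  replace ((Cmod c + 1) * (eps / (Cmod c + 1)))%R with eps in H0 by (field; lra).
  auto.
Qed.

Lemma HS_opp {I} (u : I -> C) s : HS u s -> HS (fun i => - u i) (- s).
Proof.
  intros H. apply HS_ext with (fun i => -(1) * u i); [intros; ring|].
  replace (- s) with (-(1) * s) by ring. apply HS_scal; auto.
Qed.

Lemma HS_minus {I} (u v : I -> C) s t :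
  HS u s -> HS v t -> HS (fun i => u i - v i) (s - t).
Proof. intros. apply HS_plus; auto. apply HS_opp; auto. Qed.

Lemma HS_0 {I} : HS (fun _ : I => 0) 0.
Proof.
  intros eps He. exists nil. intros L _ _.
  assert (csum L (fun _ : I => 0) = 0) by (induction L; simpl; [auto|rewrite IHL; ring]).
  rewrite H. replace (0 - 0) with (RtoC 0) by ring. rewrite Cmod_0; auto.
Qed.

Lemma HS_csum {I J} (K : list J) (u : J -> I -> C) (s : J -> C) :
  (forall j, In j K -> HS (u j) (s j)) ->
  HS (fun i => csum K (fun j => u j i)) (csum K s).
Proof.
  induction K as [|j K IH]; simpl; intros H; [apply HS_0|].
  apply HS_plus; [apply H; auto|apply IH; auto].
Qed.

(** The supremum of the finite partial sums is the limit: once a finite set comes within eps of it,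
    monotonicity keeps every larger set there. *)
Lemma rHS_nonneg {I} (v : I -> R) M :
  (forall i, (0 <= v i)%R) -> SumLe v M -> exists s, rHS v s.
Proof.
  intros Hv HM.
  destruct (completeness (fun x => exists L, NoDup L /\ x = rsum L v)) as [s [Hub Hl]].
  - exists M. intros x [L [HL ->]]. apply HM; auto.
  - exists 0%R, nil. split; [constructor|reflexivity].
  - exists s. intros eps He.
    assert (exists L, NoDup L /\ (s - eps < rsum L v)%R) as [L0 [HL0 H0]].
    { apply NNPP; intros Hn.
      assert (s <= s - eps)%R; [|lra].
      apply Hl. intros x [L [HL ->]].
      destruct (Rle_or_lt (rsum L v) (s - eps)); auto.
      exfalso; apply Hn; exists L; auto. }
    exists L0. intros L HL HI.
    assert (rsum L v <= s)%R by (apply Hub; exists L; auto).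
    pose proof (rsum_incl L0 L v Hv HL0 HI).
    apply Rabs_def1; lra.
Qed.

Lemma rHS_minus {I} (u v : I -> R) s t :
  rHS u s -> rHS v t -> rHS (fun i => u i - v i)%R (s - t)%R.
Proof.
  intros Hs Ht eps He.
  destruct (Hs (eps / 2)%R ltac:(lra)) as [L1 H1].
  destruct (Ht (eps / 2)%R ltac:(lra)) as [L2 H2].
  exists (L1 ++ L2). intros L HL HI.
  assert (Rabs (rsum L u - s) < eps / 2)%R.
  { apply H1; auto. intros i Hi; apply HI, in_or_app; auto. }
  assert (Rabs (rsum L v - t) < eps / 2)%R.
  { apply H2; auto. intros i Hi; apply HI, in_or_app; auto. }
  assert (rsum L (fun i => u i - v i)%R = (rsum L u - rsum L v)%R) as ->
    by (clear; induction L; simpl; lra).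
  apply Rabs_def2 in H, H0. apply Rabs_def1; lra.
Qed.

(** Comparison reduces to non-negative families through v = (v + w) - w. *)
Lemma rHS_dom {I} (v w : I -> R) M :
  (forall i, (Rabs (v i) <= w i)%R) -> SumLe w M -> exists s, rHS v s.
Proof.
  intros Hvw HM.
  assert (Hb : forall i, (- w i <= v i <= w i)%R)
    by (intros i; specialize (Hvw i); apply Rabs_le_between in Hvw; lra).
  destruct (rHS_nonneg (fun i => v i + w i)%R (2 * M)%R) as [s Hs].
  - intros i; specialize (Hb i); lra.
  - apply SumLe_le with (fun i => 2 * w i)%R (2 * M)%R;
      [intros i; specialize (Hb i); lra|lra|apply SumLe_scal; auto; lra].
  - destruct (rHS_nonneg w M) as [t Ht]; auto.
    + intros i; specialize (Hb i); lra.
    + exists (s - t)%R. pose proof (rHS_minus _ _ _ _ Hs Ht) as H.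
      intros eps He. destruct (H eps He) as [L0 H0]. exists L0. intros L HL HI.
      rewrite (rsum_ext L v (fun i => v i + w i - w i)%R); [auto|intros; lra].
Qed.

Lemma HS_of_parts {I} (u : I -> C) s t :
  rHS (fun i => Re (u i)) s -> rHS (fun i => Im (u i)) t -> HS u (s, t).
Proof.
  intros Hs Ht eps He.
  destruct (Hs (eps / 2)%R ltac:(lra)) as [L1 H1].
  destruct (Ht (eps / 2)%R ltac:(lra)) as [L2 H2].
  exists (L1 ++ L2). intros L HL HI.
  assert (A : (Rabs (rsum L (fun i => Re (u i)) - s) < eps / 2)%R).
  { apply H1; auto. intros i Hi; apply HI, in_or_app; auto. }
  assert (B : (Rabs (rsum L (fun i => Im (u i)) - t) < eps / 2)%R).
  { apply H2; auto. intros i Hi; apply HI, in_or_app; auto. }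
  rewrite <- csum_Re in A. rewrite <- csum_Im in B.
  replace (csum L u - (s, t)) with
    (RtoC (Re (csum L u) - s) + Ci * RtoC (Im (csum L u) - t)).
  - eapply Rle_lt_trans; [apply Cmod_triangle|].
    rewrite Cmod_mult, Cmod_Ci, !Cmod_R. lra.
  - destruct (csum L u) as [x y]. unfold Ci, RtoC, Cminus, Cplus, Copp, Cmult, Re, Im; simpl.
    f_equal; ring.
Qed.

Lemma HS_bound {I} (u : I -> C) s M :
  HS u s -> SumLe (fun i => Cmod (u i)) M -> (Cmod s <= M)%R.
Proof.
  intros Hs HM. apply Rle_plus_epsilon. intros eps He.
  destruct (Hs eps He) as [L0 H0].
  specialize (H0 (nodup eqd L0) (NoDup_nodup _ _)).
  assert (HI : incl L0 (nodup eqd L0)) by (intros i Hi; apply nodup_In; auto).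
  specialize (H0 HI).
  pose proof (csum_mod (nodup eqd L0) u).
  pose proof (HM (nodup eqd L0) (NoDup_nodup _ _)).
  replace s with (csum (nodup eqd L0) u + - (csum (nodup eqd L0) u - s)) by ring.
  eapply Rle_trans; [apply Cmod_triangle|]. rewrite Cmod_opp. lra.
Qed.

Lemma Re_le_mod z : (Rabs (Re z) <= Cmod z)%R.
Proof. eapply Rle_trans; [|apply Rmax_Cmod]. apply Rmax_l. Qed.

Lemma Im_le_mod z : (Rabs (Im z) <= Cmod z)%R.
Proof. eapply Rle_trans; [|apply Rmax_Cmod]. apply Rmax_r. Qed.

Lemma SumLe_HS {I} (u : I -> C) M :
  SumLe (fun i => Cmod (u i)) M -> exists s, HS u s.
Proof.
  intros HM.
  destruct (rHS_dom (fun i => Re (u i)) _ M (fun i => Re_le_mod (u i)) HM) as [s Hs].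
  destruct (rHS_dom (fun i => Im (u i)) _ M (fun i => Im_le_mod (u i)) HM) as [t Ht].
  exists (s, t). apply HS_of_parts; auto.
Qed.

(** Total by choice: the value is meaningful only when the family has a sum, and then [HS_unique]
    makes it that sum. *)
Definition tsum {I : Type} (u : I -> C) : C := epsilon (inhabits (RtoC 0)) (HS u).

Lemma tsum_HS {I} (u : I -> C) s : HS u s -> tsum u = s.
Proof.
  intros H. apply (HS_unique u); auto. unfold tsum.
  apply epsilon_spec. exists s; auto.
Qed.

Lemma HS_tsum {I} (u : I -> C) M :
  SumLe (fun i => Cmod (u i)) M -> HS u (tsum u).
Proof.
  intros H. destruct (SumLe_HS u M H) as [s Hs]. rewrite (tsum_HS u s Hs). auto.
Qed.

Lemma NoDup_map_inj {I J} (f : I -> J) L :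
  (forall x y, In x L -> In y L -> f x = f y -> x = y) -> NoDup L -> NoDup (map f L).
Proof.
  intros Hf. induction L as [|i L IH]; simpl; intros HN; [constructor|].
  inversion HN; subst. constructor.
  - intros Hin. apply in_map_iff in Hin as [j [Hj Hj']].
    rewrite (Hf j i) in Hj'; simpl; auto.
  - apply IH; auto. intros; apply Hf; simpl; auto.
Qed.

Lemma rsum_map {I J} (g : J -> I) L f : rsum (map g L) f = rsum L (fun j => f (g j)).
Proof. induction L; simpl; auto. rewrite IHL; auto. Qed.

Lemma csum_map {I J} (g : J -> I) L f : csum (map g L) f = csum L (fun j => f (g j)).
Proof. induction L; simpl; auto. rewrite IHL; auto. Qed.

Lemma SumLe_inj {I J} (g : J -> I) v M :
  (forall x y, g x = g y -> x = y) -> SumLe v M -> SumLe (fun j => v (g j)) M.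
Proof.
  intros Hg HM L HL. rewrite <- rsum_map. apply HM.
  apply NoDup_map_inj; auto.
Qed.

Lemma HS_reindex {I J} (g : J -> I) (h : I -> J) u s :
  (forall j, h (g j) = j) -> (forall i, g (h i) = i) ->
  HS u s -> HS (fun j => u (g j)) s.
Proof.
  intros Hg Hh Hs eps He. destruct (Hs eps He) as [L0 H0].
  exists (map h L0). intros L HL HI. rewrite <- csum_map. apply H0.
  - apply NoDup_map_inj; auto. intros x y _ _ Hxy. rewrite <- (Hg x), <- (Hg y), Hxy; auto.
  - intros i Hi. rewrite <- (Hh i). apply in_map, HI, in_map; auto.
Qed.

(** * Double sums *)

Lemma rsum_flat {I J} (K : list I) (G : I -> list J) f :
  rsum (flat_map (fun i => map (pair i) (G i)) K) f =
  rsum K (fun i => rsum (G i) (fun j => f (i, j))).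
Proof.
  induction K; simpl; auto. rewrite rsum_app, IHK, rsum_map. auto.
Qed.

Lemma csum_flat {I J} (K : list I) (G : I -> list J) f :
  csum (flat_map (fun i => map (pair i) (G i)) K) f =
  csum K (fun i => csum (G i) (fun j => f (i, j))).
Proof.
  induction K; simpl; auto. rewrite csum_app, IHK, csum_map. auto.
Qed.

Lemma NoDup_flat {I J} (K : list I) (G : I -> list J) :
  NoDup K -> (forall i, NoDup (G i)) ->
  NoDup (flat_map (fun i => map (pair i) (G i)) K).
Proof.
  intros HK HG. induction K as [|i K IH]; simpl; [constructor|].
  inversion HK; subst. apply NoDup_app; auto.
  - apply NoDup_map_inj; auto. intros x y _ _ H; congruence.
  - intros [i' j] H5 H3. apply in_map_iff in H5 as [j' [Hj _]].
    apply in_flat_map in H3 as [i'' [Hi'' H3]].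
    apply in_map_iff in H3 as [j'' [Hj'' _]]. congruence.
Qed.

Lemma In_flat {I J} (K : list I) (G : I -> list J) i j :
  In i K -> In j (G i) -> In (i, j) (flat_map (fun i => map (pair i) (G i)) K).
Proof.
  intros Hi Hj. apply in_flat_map. exists i; split; auto. apply in_map; auto.
Qed.

Lemma cover_flat {I J} (L : list (I * J)) :
  exists (K : list I) (G : list J), NoDup K /\ NoDup G /\
    forall i j, In (i, j) L -> In i K /\ In j G.
Proof.
  exists (nodup eqd (map fst L)), (nodup eqd (map snd L)).
  repeat split; try apply NoDup_nodup; apply nodup_In; apply in_map_iff;
    eexists; split; try eassumption; reflexivity.
Qed.

(** A finite set of pairs lies in a finite rectangle, which is summed row by row; non-negativity
    permits the enlargement. *)
Lemma SumLe_pair {I J} (w : I * J -> R) (N : I -> R) M :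
  (forall p, (0 <= w p)%R) ->
  (forall i, SumLe (fun j => w (i, j)) (N i)) -> SumLe N M -> SumLe w M.
Proof.
  intros Hw Hi HN L HL.
  destruct (cover_flat L) as [K [G [HK [HG Hc]]]].
  apply Rle_trans with (rsum (flat_map (fun i => map (pair i) G) K) w).
  - apply rsum_incl; auto. intros [i j] Hij. destruct (Hc i j Hij).
    apply (In_flat K (fun _ => G)); auto.
  - rewrite (rsum_flat K (fun _ => G)).
    eapply Rle_trans; [|apply (HN K HK)]. apply rsum_le. intros i _.
    apply Hi; auto.
Qed.

(* Both sides are approximated by one finite set, the union over i in K of
   {i} x G i with G i large. *)
Lemma HS_pair_fwd {I J} (u : I * J -> C) (v : I -> C) s t M :
  SumLe (fun p => Cmod (u p)) M -> (forall i, HS (fun j => u (i, j)) (v i)) ->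
  HS v s -> HS u t -> s = t.
Proof.
  intros HM Hv Hs Ht. apply Ceq_minus. apply NNPP; intros Hn.
  apply Cmod_gt_0 in Hn. set (e := (Cmod (s - t) / 3)%R).
  assert (He : (0 < e)%R) by (unfold e; lra).
  destruct (Hs e He) as [K0 HK0]. destruct (Ht e He) as [L0 HL0].
  destruct (cover_flat L0) as [K1 [G1 [HK1 [HG1 Hc]]]].
  destruct (union_list K0 K1) as [K [HK [I0 I1]]].
  set (d := (e / (INR (length K) + 1))%R).
  assert (Hlen : (0 < INR (length K) + 1)%R) by (pose proof (pos_INR (length K)); lra).
  assert (Hd : (0 < d)%R) by (apply Rdiv_lt_0_compat; auto).
  assert (HG : forall i, exists G, NoDup G /\ incl G1 G /\
     (Cmod (csum G (fun j => u (i, j)) - v i) < d)%R).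
  { intros i. destruct (Hv i d Hd) as [G0 HG0].
    destruct (union_list G0 G1) as [G [HGn [HI0 HI1]]].
    exists G. repeat split; auto. }
  set (G := fun i => proj1_sig (constructive_indefinite_description _ (HG i))).
  assert (HGs : forall i, NoDup (G i) /\ incl G1 (G i) /\
     (Cmod (csum (G i) (fun j => u (i, j)) - v i) < d)%R)
    by (intros i; unfold G; destruct (constructive_indefinite_description _ (HG i)); auto).
  set (L := flat_map (fun i => map (pair i) (G i)) K).
  assert (A : (Cmod (csum L u - t) < e)%R).
  { apply HL0.
    - apply NoDup_flat; auto. apply HGs.
    - intros [i j] Hij. destruct (Hc i j Hij). apply In_flat; auto. apply HGs; auto. }
  assert (B : (Cmod (csum K v - s) < e)%R) by (apply HK0; auto).
  assert (D : (Cmod (csum L u - csum K v) <= INR (length K) * d)%R).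
  { unfold L. rewrite csum_flat. clearbody G d. clear - HGs Hd.
    induction K as [|i K IH].
    - simpl. replace (0 - 0) with (RtoC 0) by ring. rewrite Cmod_0. lra.
    - change (length (i :: K)) with (S (length K)). rewrite S_INR. simpl csum.
      set (x := csum (G i) (fun j => u (i, j))) in *.
      match goal with |- (Cmod (x + ?y - (v i + ?z)) <= _)%R =>
        replace (x + y - (v i + z)) with ((x - v i) + (y - z)) by ring end.
      eapply Rle_trans; [apply Cmod_triangle|].
      destruct (HGs i) as [_ [_ H]]. unfold x. lra. }
  assert (INR (length K) * d < e)%R.
  { apply Rlt_le_trans with ((INR (length K) + 1) * d)%R; [lra|].
    unfold d. right. field. lra. }
  assert (Cmod (s - t) <= Cmod (csum L u - t) + Cmod (csum L u - csum K v) + Cmod (csum K v - s))%R.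
  { replace (s - t) with ((csum L u - t) + (- (csum L u - csum K v) + - (csum K v - s))) by ring.
    eapply Rle_trans; [apply Cmod_triangle|].
    pose proof (Cmod_triangle (- (csum L u - csum K v)) (- (csum K v - s))) as H'.
    rewrite !Cmod_opp in H'. lra. }
  unfold e in *. lra.
Qed.

(** Each row sum is replaced by a finite piece of its row, with the tolerance shared among the rows
    of K; the pieces form one finite set of pairs, whose sum is at most M. *)
Lemma SumLe_fst {I J} (u : I * J -> C) (v : I -> C) M :
  SumLe (fun p => Cmod (u p)) M -> (forall i, HS (fun j => u (i, j)) (v i)) ->
  SumLe (fun i => Cmod (v i)) M.
Proof.
  intros HM Hv K HK. apply Rle_plus_epsilon. intros e He.
  assert (Hlen : (0 < INR (length K) + 1)%R) by (pose proof (pos_INR (length K)); lra).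
  set (d := (e / (INR (length K) + 1))%R).
  assert (Hd : (0 < d)%R) by (apply Rdiv_lt_0_compat; auto).
  assert (HG : forall i, exists G, NoDup G /\
     (Cmod (csum G (fun j => u (i, j)) - v i) < d)%R).
  { intros i. destruct (Hv i d Hd) as [G0 HG0]. exists (nodup eqd G0).
    split; [apply NoDup_nodup|]. apply HG0; [apply NoDup_nodup|].
    intros j Hj; apply nodup_In; auto. }
  set (G := fun i => proj1_sig (constructive_indefinite_description _ (HG i))).
  assert (HGs : forall i, NoDup (G i) /\
     (Cmod (csum (G i) (fun j => u (i, j)) - v i) < d)%R)
    by (intros i; unfold G; destruct (constructive_indefinite_description _ (HG i)); auto).
  pose proof (HM (flat_map (fun i => map (pair i) (G i)) K)
    (NoDup_flat K G HK (fun i => proj1 (HGs i)))) as H.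
  rewrite rsum_flat in H.
  assert (D : (rsum K (fun i => Cmod (v i)) <=
    rsum K (fun i => rsum (G i) (fun j => Cmod (u (i, j)))) + INR (length K) * d)%R).
  { clearbody G d. clear - HGs Hd. induction K as [|i K IH].
    - simpl. lra.
    - change (length (i :: K)) with (S (length K)). rewrite S_INR. simpl rsum.
      destruct (HGs i) as [_ H].
      pose proof (csum_mod (G i) (fun j => u (i, j))).
      assert (Cmod (v i) <= Cmod (csum (G i) (fun j => u (i, j))) + d)%R.
      { set (x := csum (G i) (fun j => u (i, j))) in *.
        replace (v i) with (x + - (x - v i)) by ring.
        eapply Rle_trans; [apply Cmod_triangle|]. rewrite Cmod_opp. lra. }
      lra. }
  assert (INR (length K) * d <= e)%R.
  { apply Rle_trans with ((INR (length K) + 1) * d)%R; [lra|].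
    unfold d. right. field. lra. }
  lra.
Qed.

(** Fubini for absolutely summable families. Both sums exist and [HS_pair_fwd] makes them equal; as
    an equivalence it serves both to collect rows and to expand them. *)
Lemma HS_pair {I J} (u : I * J -> C) (v : I -> C) s M :
  SumLe (fun p => Cmod (u p)) M -> (forall i, HS (fun j => u (i, j)) (v i)) ->
  (HS v s <-> HS u s).
Proof.
  intros HM Hv.
  destruct (SumLe_HS u M HM) as [t Ht].
  destruct (SumLe_HS v M (SumLe_fst u v M HM Hv)) as [s' Hs'].
  pose proof (HS_pair_fwd u v s' t M HM Hv Hs' Ht). subst s'.
  split; intros H.
  - rewrite (HS_unique _ _ _ H Hs'); auto.
  - rewrite (HS_unique _ _ _ H Ht); auto.
Qed.

Lemma HS_swap {I J} (u : I * J -> C) s :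
  HS u s -> HS (fun p : J * I => u (snd p, fst p)) s.
Proof.
  apply (HS_reindex (fun p : J * I => (snd p, fst p)) (fun p : I * J => (snd p, fst p)));
    intros [? ?]; reflexivity.
Qed.

Lemma SumLe_swap {I J} (v : I * J -> R) M :
  SumLe v M -> SumLe (fun p : J * I => v (snd p, fst p)) M.
Proof.
  apply (SumLe_inj (fun p : J * I => (snd p, fst p))).
  intros [? ?] [? ?]; simpl; congruence.
Qed.

Lemma SumLe_prod {I J} (v : I -> R) (w : J -> R) M N :
  (forall i, (0 <= v i)%R) -> (forall j, (0 <= w j)%R) ->
  SumLe v M -> SumLe w N -> SumLe (fun p : I * J => v (fst p) * w (snd p))%R (M * N)%R.
Proof.
  intros Hv Hw HM HN.
  apply SumLe_pair with (fun i => v i * N)%R.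
  - intros p; apply Rmult_le_pos; auto.
  - intros i. simpl. apply SumLe_scal; auto.
  - apply SumLe_le with (fun i => N * v i)%R (N * M)%R; try (intros; lra).
    apply SumLe_scal; auto. apply SumLe_ge0 in HN; auto.
Qed.

Lemma HS_prod {I J} (u : I -> C) (v : J -> C) s t M N :
  SumLe (fun i => Cmod (u i)) M -> SumLe (fun j => Cmod (v j)) N ->
  HS u s -> HS v t -> HS (fun p : I * J => u (fst p) * v (snd p)) (s * t).
Proof.
  intros HM HN Hs Ht.
  apply (HS_pair (fun p : I * J => u (fst p) * v (snd p)) (fun i => u i * t) _ (M * N)).
  - apply SumLe_le with (fun p : I * J => Cmod (u (fst p)) * Cmod (v (snd p)))%R (M * N)%R;
      [intros; rewrite Cmod_mult; lra|lra|].
    apply (SumLe_prod (fun i => Cmod (u i)) (fun j => Cmod (v j))); auto;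
      intros; apply Cmod_ge_0.
  - intros i. simpl. apply HS_scal; auto.
  - apply HS_ext with (fun i => t * u i); [intros; ring|].
    rewrite Cmult_comm. apply HS_scal; auto.
Qed.

Definition ind {I : Type} (P : I -> Prop) (u : I -> C) (i : I) : C :=
  if excluded_middle_informative (P i) then u i else 0.

Lemma HS_finite {I} (L : list I) u :
  NoDup L -> HS (ind (fun i => In i L) u) (csum L u).
Proof.
  intros HL eps He. exists L. intros K HK HI.
  destruct (incl_split L K HL HI) as [K' HP].
  assert (HN : NoDup (L ++ K')) by (apply (Permutation_NoDup HP); auto).
  rewrite (csum_perm _ _ _ HP), csum_app.
  rewrite (csum_ext L _ u).
  - rewrite (csum_ext K' _ (fun _ => 0)).
    + assert (csum K' (fun _ : I => 0) = 0) as ->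
        by (clear; induction K'; simpl; [auto|rewrite IHK'; ring]).
      replace (csum L u + 0 - csum L u) with (RtoC 0) by ring. rewrite Cmod_0; auto.
    + intros i Hi. unfold ind. destruct excluded_middle_informative; auto.
      exfalso. clear - HN Hi i0. induction L as [|a L IH]; simpl in *; auto.
      inversion HN; subst. destruct i0; subst; auto.
      apply H1, in_or_app; auto.
  - intros i Hi. unfold ind. destruct excluded_middle_informative; tauto.
Qed.

Lemma HS_remove {I} (L : list I) u s :
  NoDup L -> HS u s -> HS (ind (fun i => ~ In i L) u) (s - csum L u).
Proof.
  intros HL Hs.
  eapply HS_ext; [|apply (HS_minus _ _ _ _ Hs (HS_finite L u HL))].
  intros i. unfold ind. simpl.
  destruct (excluded_middle_informative (In i L)), (excluded_middle_informative (~ In i L));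
    try tauto; ring.
Qed.

Lemma HS_single {I} (i0 : I) (c : C) : HS (ind (fun i => i = i0) (fun _ => c)) c.
Proof.
  pose proof (HS_finite (i0 :: nil) (fun _ => c)) as H.
  simpl in H. replace (c + 0) with c in H by ring.
  eapply HS_ext; [|apply H; constructor; [simpl; tauto|constructor]].
  intros i. unfold ind. destruct excluded_middle_informative as [[Hi|[]]|Hi];
  destruct excluded_middle_informative; auto; try congruence. exfalso; apply Hi; auto.
Qed.

(** * Exhaustion by cubes and the link with [has_sum2] and [has_sum3] *)

Lemma seq_sum_n_R (n : nat) (f : nat -> R) :
  sum_n f n = rsum (seq 0 (S n)) f.
Proof.
  induction n.
  - rewrite sum_O. simpl. lra.
  - rewrite sum_Sn, IHn. rewrite (seq_S (S n)), rsum_app. simpl.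
    unfold plus; simpl. lra.
Qed.

Lemma seq_sum_n_C (n : nat) (f : nat -> C) :
  sum_n f n = csum (seq 0 (S n)) f.
Proof.
  induction n.
  - rewrite sum_O. simpl. ring.
  - rewrite sum_Sn, IHn. rewrite (seq_S (S n)), csum_app.
    unfold plus; simpl. ring.
Qed.

(** An increasing and exhausting sequence is cofinal among the finite subsets ([cube_incl]), so
    unordered sums can be tested along it. *)
Definition cube {I : Type} (Q : nat -> list I) : Prop :=
  (forall n, NoDup (Q n)) /\ (forall n, incl (Q n) (Q (S n))) /\
  (forall i, exists n, In i (Q n)).

Lemma cube_incl {I} (Q : nat -> list I) L : cube Q ->
  exists n, forall m, (n <= m)%nat -> incl L (Q m).
Proof.
  intros [_ [HQ HA]].
  assert (Hmon : forall n m, (n <= m)%nat -> incl (Q n) (Q m)).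
  { intros n m H; induction H; [apply incl_refl|]. eapply incl_tran; eauto. }
  induction L as [|i L [n IH]].
  - exists O. intros m _ j [].
  - destruct (HA i) as [n' Hn']. exists (max n n'). intros m Hm j [<-|Hj].
    + apply (Hmon n'); auto. lia.
    + apply IH; auto. lia.
Qed.

Lemma HS_cube {I} (Q : nat -> list I) u s : cube Q -> HS u s ->
  filterlim (fun n => csum (Q n) u) eventually (locally s).
Proof.
  intros HQ Hs. apply filterlim_locally. intros eps.
  destruct (Hs eps (cond_pos eps)) as [L0 H0].
  destruct (cube_incl Q L0 HQ) as [n Hn].
  exists n. intros m Hm. apply C_NormedModule_mixin_compat1.
  apply H0; auto. apply HQ.
Qed.

Lemma C_lim_unique (f : nat -> C) (s t : C) :
  filterlim f eventually (locally s) -> filterlim f eventually (locally t) -> s = t.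
Proof.
  intros H1 H2. apply (filterlim_locally_unique (F := eventually) f s t); auto.
Qed.

(** Bounded moduli on the cubes bound all finite sums, so an unordered sum exists; the limit along
    the cubes can only be that sum. *)
Lemma cube_HS {I} (Q : nat -> list I) u s M : cube Q ->
  (forall n, (rsum (Q n) (fun i => Cmod (u i)) <= M)%R) ->
  filterlim (fun n => csum (Q n) u) eventually (locally s) ->
  SumLe (fun i => Cmod (u i)) M /\ HS u s.
Proof.
  intros HQ HM Hs.
  assert (HS' : SumLe (fun i => Cmod (u i)) M).
  { intros L HL. destruct (cube_incl Q L HQ) as [n Hn].
    eapply Rle_trans; [|apply (HM n)]. apply rsum_incl; auto.
    intros; apply Cmod_ge_0. }
  split; auto.
  destruct (SumLe_HS u M HS') as [t Ht].
  rewrite (C_lim_unique _ _ _ Hs (HS_cube Q u t HQ Ht)). auto.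
Qed.

Definition cube1 (n : nat) : list nat := seq 0 (S n).

Definition cube2 (n : nat) : list (nat * nat) :=
  flat_map (fun i => map (pair i) (seq 0 (S n))) (seq 0 (S n)).

Definition cube3 (n : nat) : list (nat * nat * nat) :=
  flat_map (fun p => map (pair p) (seq 0 (S n))) (cube2 n).

Lemma cube1_cube : cube cube1.
Proof.
  repeat split.
  - intros; apply seq_NoDup.
  - intros n i Hi. apply in_seq in Hi. apply in_seq. lia.
  - intros i. exists i. apply in_seq. lia.
Qed.

Lemma in_cube2 n i j : In (i, j) (cube2 n) <-> (i <= n /\ j <= n)%nat.
Proof.
  unfold cube2. rewrite in_flat_map. split.
  - intros [x [Hx Hp]]. apply in_map_iff in Hp as [y [Hy Hp]]. inversion Hy; subst.
    apply in_seq in Hx, Hp. lia.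
  - intros H. exists i. split; [apply in_seq; lia|]. apply in_map, in_seq. lia.
Qed.

Lemma in_cube3 n i j l : In (i, j, l) (cube3 n) <-> (i <= n /\ j <= n /\ l <= n)%nat.
Proof.
  unfold cube3. rewrite in_flat_map. split.
  - intros [x [Hx Hp]]. apply in_map_iff in Hp as [y [Hy Hp]]. inversion Hy; subst.
    apply in_cube2 in Hx. apply in_seq in Hp. lia.
  - intros H. exists (i, j). split; [apply in_cube2; lia|]. apply in_map, in_seq. lia.
Qed.

Lemma cube2_cube : cube cube2.
Proof.
  repeat split.
  - intros; apply NoDup_flat; intros; apply seq_NoDup.
  - intros n [i j] Hi. apply in_cube2 in Hi. apply in_cube2. lia.
  - intros [i j]. exists (max i j). apply in_cube2. lia.
Qed.

Lemma cube3_cube : cube cube3.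
Proof.
  repeat split.
  - intros; apply NoDup_flat; [apply cube2_cube|intros; apply seq_NoDup].
  - intros n [[i j] l] Hi. apply in_cube3 in Hi. apply in_cube3. lia.
  - intros [[i j] l]. exists (max i (max j l)). apply in_cube3. lia.
Qed.

Lemma sum_n_cube2_R n (f : nat -> nat -> R) :
  sum_n (fun i => sum_n (fun j => f i j) n) n = rsum (cube2 n) (fun p => f (fst p) (snd p)).
Proof.
  unfold cube2. rewrite rsum_flat, seq_sum_n_R. apply rsum_ext. intros.
  apply seq_sum_n_R.
Qed.

Lemma sum_n_cube2_C n (f : nat -> nat -> C) :
  sum_n (fun i => sum_n (fun j => f i j) n) n = csum (cube2 n) (fun p => f (fst p) (snd p)).
Proof.
  unfold cube2. rewrite csum_flat, seq_sum_n_C. apply csum_ext. intros.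
  apply seq_sum_n_C.
Qed.

Lemma sum_n_cube3_R n (f : nat -> nat -> nat -> R) :
  sum_n (fun i => sum_n (fun j => sum_n (fun l => f i j l) n) n) n =
  rsum (cube3 n) (fun p => f (fst (fst p)) (snd (fst p)) (snd p)).
Proof.
  unfold cube3. rewrite rsum_flat.
  rewrite (sum_n_cube2_R n (fun i j => sum_n (fun l => f i j l) n)).
  apply rsum_ext. intros p _. apply seq_sum_n_R.
Qed.

Lemma sum_n_cube3_C n (f : nat -> nat -> nat -> C) :
  sum_n (fun i => sum_n (fun j => sum_n (fun l => f i j l) n) n) n =
  csum (cube3 n) (fun p => f (fst (fst p)) (snd (fst p)) (snd p)).
Proof.
  unfold cube3. rewrite csum_flat.
  rewrite (sum_n_cube2_C n (fun i j => sum_n (fun l => f i j l) n)).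
  apply csum_ext. intros p _. apply seq_sum_n_C.
Qed.

Lemma filterlim_ext_C (f g : nat -> C) s : (forall n, f n = g n) ->
  filterlim f eventually (locally s) -> filterlim g eventually (locally s).
Proof. intros H. apply filterlim_ext; auto. Qed.

Lemma HS_has_sum2 (u : nat -> nat -> C) s M :
  SumLe (fun p => Cmod (u (fst p) (snd p))) M ->
  HS (fun p => u (fst p) (snd p)) s -> has_sum2 u s.
Proof.
  intros HM Hs. split.
  - exists M. intros n. rewrite (sum_n_cube2_R n (fun i j => Cmod (u i j))).
    apply HM. apply cube2_cube.
  - eapply filterlim_ext_C; [|apply (HS_cube cube2 _ _ cube2_cube Hs)].
    intros n. rewrite (sum_n_cube2_C n u). reflexivity.
Qed.

Lemma HS_has_sum3 (u : nat -> nat -> nat -> C) s M :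
  SumLe (fun p => Cmod (u (fst (fst p)) (snd (fst p)) (snd p))) M ->
  HS (fun p => u (fst (fst p)) (snd (fst p)) (snd p)) s -> has_sum3 u s.
Proof.
  intros HM Hs. split.
  - exists M. intros n. rewrite (sum_n_cube3_R n (fun i j l => Cmod (u i j l))).
    apply HM. apply cube3_cube.
  - eapply filterlim_ext_C; [|apply (HS_cube cube3 _ _ cube3_cube Hs)].
    intros n. rewrite (sum_n_cube3_C n u). reflexivity.
Qed.

Lemma has_sum3_HS (u : nat -> nat -> nat -> C) s : has_sum3 u s -> exists M,
  SumLe (fun p => Cmod (u (fst (fst p)) (snd (fst p)) (snd p))) M /\
  HS (fun p => u (fst (fst p)) (snd (fst p)) (snd p)) s.
Proof.
  intros [[M HM] Hs]. exists M. apply (cube_HS cube3).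
  - apply cube3_cube.
  - intros n. rewrite <- (sum_n_cube3_R n (fun i j l => Cmod (u i j l))). auto.
  - eapply filterlim_ext_C; [|apply Hs]. intros n. exact (sum_n_cube3_C n u).
Qed.

(** * Absolutely convergent power series in three variables *)

Definition E3 : Type := (nat * nat * nat)%type.

Definition deg (e : E3) : nat := fst (fst e) + snd (fst e) + snd e.

Definition eplus (e e' : E3) : E3 :=
  ((fst (fst e) + fst (fst e'), snd (fst e) + snd (fst e')), snd e + snd e')%nat.

Definition mon (x y z : C) (e : E3) : C := x ^ fst (fst e) * y ^ snd (fst e) * z ^ snd e.

Lemma deg_eplus e e' : deg (eplus e e') = (deg e + deg e')%nat.
Proof. unfold deg, eplus; simpl; lia. Qed.

Lemma mon_eplus x y z e e' : mon x y z (eplus e e') = mon x y z e * mon x y z e'.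
Proof. unfold mon, eplus; simpl. rewrite !Cpow_add_r. ring. Qed.

Lemma Cmod_pow z n : Cmod (z ^ n) = (Cmod z ^ n)%R.
Proof. induction n; simpl; [apply Cmod_1|]. rewrite Cmod_mult, IHn; auto. Qed.

Lemma mon_le x y z r e : (Cmod x <= r)%R -> (Cmod y <= r)%R -> (Cmod z <= r)%R ->
  (Cmod (mon x y z e) <= r ^ deg e)%R.
Proof.
  intros Hx Hy Hz. unfold mon, deg. rewrite !Cmod_mult, !Cmod_pow, !pow_add.
  pose proof (Cmod_ge_0 x); pose proof (Cmod_ge_0 y); pose proof (Cmod_ge_0 z).
  apply Rmult_le_compat; try apply Rmult_le_compat; try apply Rmult_le_pos;
    try (apply pow_le; auto); apply pow_incr; lra.
Qed.

(** The coordinates are functions on an arbitrary type Q. The same calculus then covers C^3,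
    permuted or affinely changed coordinates, and a real parameter of a segment with two coordinates
    set to 0. *)
Definition inbox {Q : Type} (x y z : Q -> C) (r : R) (q : Q) : Prop :=
  (Cmod (x q) <= r /\ Cmod (y q) <= r /\ Cmod (z q) <= r)%R.

(* [f] is a power series in the coordinate functions [x], [y], [z] whose
   weighted coefficient norm at radius [r] is at most [N]. *)
Definition W {Q : Type} (x y z : Q -> C) (r N : R) (f : Q -> C) : Prop :=
  exists k : E3 -> C, SumLe (fun e => Cmod (k e) * r ^ deg e)%R N /\
    forall q, inbox x y z r q -> HS (fun e => k e * mon (x q) (y q) (z q) e) (f q).

Lemma SumLe_single {I} (i0 : I) (c : R) : (0 <= c)%R ->
  SumLe (fun i => if eqd i i0 then c else 0%R) c.
Proof.
  intros Hc L HL. induction L as [|i L IH]; simpl; [lra|].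
  inversion HL; subst. destruct (eqd i i0).
  - subst. rewrite (rsum_ext L _ (fun _ => 0%R)).
    + clear. assert (rsum L (fun _ : I => 0%R) = 0%R) as ->
        by (induction L; simpl; lra). lra.
    + intros j Hj. destruct (eqd j i0); auto. congruence.
  - rewrite Rplus_0_l. auto.
Qed.

Lemma HS_unit (c : C) : HS (fun _ : unit => c) c.
Proof.
  eapply HS_ext; [|apply (HS_single tt c)]. intros []. unfold ind.
  destruct excluded_middle_informative; congruence.
Qed.

Lemma SumLe_unit (c : R) : (0 <= c)%R -> SumLe (fun _ : unit => c) c.
Proof.
  intros H. eapply SumLe_le; [| |apply (SumLe_single tt c H)]; [|lra].
  intros []. simpl. destruct (eqd tt tt); [lra|congruence].
Qed.

(** Meant for index shifts such as [S] and [up3]: a finite set of indices is pulled back to its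
    preimage, and everything outside the range contributes zero. *)
Lemma HS_inj_ext {I J} (g : J -> I) (u : I -> C) s :
  (forall a b, g a = g b -> a = b) -> (forall i, (forall j, g j <> i) -> u i = 0) ->
  HS (fun j => u (g j)) s -> HS u s.
Proof.
  intros Hg Hu Hs eps He. destruct (Hs eps He) as [L0 H0].
  exists (map g L0). intros L HL HI.
  assert (exists L', NoDup L' /\ (forall j, In j L' <-> In (g j) L) /\
    csum L u = csum L' (fun j => u (g j))) as [L' [H1 [H2 H3]]].
  { clear HI. induction L as [|i L IH].
    - exists nil. split; [constructor|]. split; [simpl; tauto|reflexivity].
    - inversion HL; subst. destruct IH as [L' [H5 [H4 H6]]]; auto.
      destruct (classic (exists j, g j = i)) as [[j Hj]|Hj].
      + exists (j :: L'). split; [constructor; auto; rewrite H4, Hj; auto|].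
        split; simpl.
        * intros j'. rewrite H4. split; intros [Ha|Ha]; auto; left; try congruence.
          apply Hg; congruence.
        * rewrite H6, Hj; auto.
      + exists L'. split; auto. split.
        * intros j. rewrite H4. simpl. split; auto. intros [Ha|Ha]; auto.
          exfalso; apply Hj; eauto.
        * simpl. rewrite Hu, H6; [ring|]. intros j Hj'; apply Hj; eauto. }
  rewrite H3. apply H0; auto. intros j Hj. apply H2, HI, in_map; auto.
Qed.

Lemma term_SumLe {Q} (x y z : Q -> C) r N {K} (w : K -> C) (g : K -> E3) q :
  SumLe (fun i => Cmod (w i) * r ^ deg (g i))%R N -> inbox x y z r q ->
  SumLe (fun i => Cmod (w i * mon (x q) (y q) (z q) (g i))) N.
Proof.
  intros H [Hx [Hy Hz]]. eapply SumLe_le; [| |apply H]; [|lra].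
  intros i. rewrite Cmod_mult. apply Rmult_le_compat_l; [apply Cmod_ge_0|].
  apply mon_le; auto.
Qed.

(** Several indices may give the same monomial. The family is spread over the pairs (e, i) with g i
    = e: summing over i first gives the coefficient of e, summing over e first gives back term i,
    and [HS_pair] equates the two. *)
Lemma W_intro {Q} (x y z : Q -> C) r N f {K} (w : K -> C) (g : K -> E3) :
  (0 < r)%R -> SumLe (fun i => Cmod (w i) * r ^ deg (g i))%R N ->
  (forall q, inbox x y z r q -> HS (fun i => w i * mon (x q) (y q) (z q) (g i)) (f q)) ->
  W x y z r N f.
Proof.
  intros Hr HN Hf.
  assert (Hp : forall n, (0 < r ^ n)%R) by (intros; apply pow_lt; auto).
  set (U := fun (h : E3 -> C) (p : E3 * K) =>
    if eqd (g (snd p)) (fst p) then w (snd p) * h (fst p) else 0).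
  assert (HU : forall h : E3 -> C, (forall e, (Cmod (h e) <= r ^ deg e)%R) ->
    SumLe (fun p => Cmod (U h p)) N).
  { intros h Hh.
    pose proof (SumLe_swap (fun p : K * E3 => Cmod (U h (snd p, fst p))) N) as H.
    eapply SumLe_le; [| |apply H]; [intros [? ?]; simpl; lra|lra|]. clear H.
    apply (SumLe_pair _ (fun i => Cmod (w i) * r ^ deg (g i)))%R; auto.
    - intros; apply Cmod_ge_0.
    - intros i.
      eapply SumLe_le; [| |apply (SumLe_single (g i) (Cmod (w i) * r ^ deg (g i))%R)].
      + intros e. unfold U; simpl. destruct (eqd (g i) e), (eqd e (g i)); try congruence.
        * subst. rewrite Cmod_mult. apply Rmult_le_compat_l; [apply Cmod_ge_0|auto].
        * rewrite Cmod_0; lra.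
      + lra.
      + apply Rmult_le_pos; [apply Cmod_ge_0|apply pow_le; lra]. }
  assert (Hr' : forall e, (Cmod (RtoC (r ^ deg e)) <= r ^ deg e)%R).
  { intros e. rewrite Cmod_R, Rabs_pos_eq; [lra|]. specialize (Hp (deg e)); lra. }
  (* Only the family weighted by r^(deg e) is known to be summable; dividing by this non-zero factor
     gives the sum over the fibre of e. *)
  assert (Hw : forall (e : E3), exists s, HS (fun i => if eqd (g i) e then w i else 0) s).
  { intros e.
    destruct (SumLe_HS (fun i => U (fun e => RtoC (r ^ deg e)) (e, i)) N) as [s Hs].
    - apply (SumLe_inj (fun i : K => (e, i)) (fun p => Cmod (U (fun e => RtoC (r ^ deg e)) p)));
        [congruence|apply HU; auto].
    - exists (/ RtoC (r ^ deg e) * s). eapply HS_ext; [|apply HS_scal, Hs].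
      intros i. unfold U; simpl. destruct (eqd (g i) e); [|ring]. field.
      intros H0. apply RtoC_inj in H0. specialize (Hp (deg e)). lra. }
  set (k := fun e => tsum (fun i => if eqd (g i) e then w i else 0)).
  assert (Hk : forall e, HS (fun i => if eqd (g i) e then w i else 0) (k e)).
  { intros e. destruct (Hw e) as [s Hs]. unfold k. rewrite (tsum_HS _ s Hs). auto. }
  assert (Hkh : forall h e, HS (fun i => U h (e, i)) (k e * h e)).
  { intros h e. rewrite Cmult_comm. eapply HS_ext; [|apply HS_scal, Hk].
    intros i. unfold U; simpl. destruct (eqd (g i) e); ring. }
  exists k. split.
  - eapply SumLe_le; [| |apply (SumLe_fst _ _ N (HU _ Hr') (Hkh _))]; [|lra].
    intros e. simpl. rewrite Cmod_mult, Cmod_R, Rabs_pos_eq; [lra|].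
    specialize (Hp (deg e)); lra.
  - intros q Hq.
    set (h := mon (x q) (y q) (z q)).
    assert (Hh : forall e, (Cmod (h e) <= r ^ deg e)%R)
      by (intros e; destruct Hq as [? [? ?]]; apply mon_le; auto).
    apply (HS_pair (U h) _ _ N (HU h Hh) (Hkh h)).
    assert (HV : HS (fun p : K * E3 => U h (snd p, fst p)) (f q)).
    { apply (HS_pair (fun p : K * E3 => U h (snd p, fst p))
        (fun i => w i * mon (x q) (y q) (z q) (g i)) _ N).
      - apply (SumLe_swap (fun p => Cmod (U h p))). auto.
      - intros i. simpl. eapply HS_ext; [|apply (HS_single (g i) (w i * h (g i)))].
        intros e. unfold ind, U; simpl.
        destruct excluded_middle_informative, (eqd (g i) e); subst; congruence.
      - auto. }
    apply HS_swap in HV. eapply HS_ext; [|apply HV]. intros [? ?]; reflexivity.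
Qed.

Lemma W_ge0 {Q} (x y z : Q -> C) r N f : W x y z r N f -> (0 <= N)%R.
Proof. intros [k [H _]]. apply SumLe_ge0 in H; auto. Qed.

Lemma W_le {Q} (x y z : Q -> C) r N M f : (N <= M)%R -> W x y z r N f -> W x y z r M f.
Proof.
  intros H [k [H1 H2]]. exists k; split; auto. eapply SumLe_le; [| |apply H1]; auto.
  intros; lra.
Qed.

Lemma W_ext {Q} (x y z : Q -> C) r N f g :
  (forall q, inbox x y z r q -> f q = g q) -> W x y z r N f -> W x y z r N g.
Proof.
  intros H [k [H1 H2]]. exists k; split; auto. intros q Hq. rewrite <- H; auto.
Qed.

Lemma W_shrink {Q} (x y z : Q -> C) r r' N f : (0 <= r' <= r)%R ->
  W x y z r N f -> W x y z r' N f.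
Proof.
  intros H [k [H1 H2]]. exists k; split.
  - eapply SumLe_le; [| |apply H1]; [|lra]. intros e.
    apply Rmult_le_compat_l; [apply Cmod_ge_0|]. apply pow_incr; auto.
  - intros q [? [? ?]]. apply H2. repeat split; lra.
Qed.

Lemma W_bound {Q} (x y z : Q -> C) r N f q :
  W x y z r N f -> inbox x y z r q -> (Cmod (f q) <= N)%R.
Proof.
  intros [k [H1 H2]] Hq. apply (HS_bound _ _ _ (H2 q Hq)).
  apply (term_SumLe x y z r N k (fun e => e)); auto.
Qed.

Lemma W_const {Q} (x y z : Q -> C) r c : (0 < r)%R -> W x y z r (Cmod c) (fun _ => c).
Proof.
  intros Hr. apply (W_intro _ _ _ _ _ _ (fun _ : unit => c) (fun _ => (0, 0, 0)%nat)); auto.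
  - unfold deg; simpl. rewrite Rmult_1_r. apply SumLe_unit, Cmod_ge_0.
  - intros q _. unfold mon; simpl. eapply HS_ext; [|apply HS_unit]. intros; simpl; ring.
Qed.

Lemma W_coord {Q} (x y z : Q -> C) r f e : (0 < r)%R -> deg e = 1%nat ->
  (forall q, f q = mon (x q) (y q) (z q) e) -> W x y z r r f.
Proof.
  intros Hr He Hf. apply (W_intro _ _ _ _ _ _ (fun _ : unit => RtoC 1) (fun _ => e)); auto.
  - rewrite He. rewrite Cmod_1, pow_1, Rmult_1_l. apply SumLe_unit; lra.
  - intros q _. rewrite Hf. eapply HS_ext; [|apply HS_unit]. intros; simpl; ring.
Qed.

Lemma W_x {Q} (x y z : Q -> C) r : (0 < r)%R -> W x y z r r x.
Proof.
  intros. apply W_coord with (1, 0, 0)%nat; auto. intros; unfold mon; simpl; ring.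
Qed.

Lemma W_y {Q} (x y z : Q -> C) r : (0 < r)%R -> W x y z r r y.
Proof.
  intros. apply W_coord with (0, 1, 0)%nat; auto. intros; unfold mon; simpl; ring.
Qed.

Lemma W_z {Q} (x y z : Q -> C) r : (0 < r)%R -> W x y z r r z.
Proof.
  intros. apply W_coord with (0, 0, 1)%nat; auto. intros; unfold mon; simpl; ring.
Qed.

Lemma W_plus {Q} (x y z : Q -> C) r N M f g : (0 <= r)%R ->
  W x y z r N f -> W x y z r M g -> W x y z r (N + M) (fun q => f q + g q).
Proof.
  intros Hr [k [H1 H2]] [l [H3 H4]]. exists (fun e => k e + l e). split.
  - eapply SumLe_le; [| |apply (SumLe_plus _ _ _ _ H1 H3)]; [|lra]. intros e. simpl.
    rewrite <- Rmult_plus_distr_r. apply Rmult_le_compat_r; [apply pow_le; auto|].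
    apply Cmod_triangle.
  - intros q Hq. eapply HS_ext; [|apply (HS_plus _ _ _ _ (H2 q Hq) (H4 q Hq))].
    intros; simpl; ring.
Qed.

Lemma W_mult {Q} (x y z : Q -> C) r N M f g : (0 < r)%R ->
  W x y z r N f -> W x y z r M g -> W x y z r (N * M) (fun q => f q * g q).
Proof.
  intros Hr [k [H1 H2]] [l [H3 H4]].
  apply (W_intro _ _ _ _ _ _ (fun p : E3 * E3 => k (fst p) * l (snd p))
    (fun p => eplus (fst p) (snd p))); auto.
  - eapply SumLe_le; [| |apply (SumLe_prod _ _ _ _) with (3 := H1) (4 := H3)];
      [|lra| |]; try (intros; apply Rmult_le_pos; [apply Cmod_ge_0|apply pow_le; lra]).
    intros [e e']. simpl. rewrite Cmod_mult, deg_eplus, pow_add. lra.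
  - intros q Hq.
    eapply HS_ext; [|apply (HS_prod _ _ _ _ N M) with (3 := H2 q Hq) (4 := H4 q Hq)].
    + intros [e e']. simpl. rewrite mon_eplus. ring.
    + apply (term_SumLe x y z r N k (fun e => e)); auto.
    + apply (term_SumLe x y z r M l (fun e => e)); auto.
Qed.

Lemma W_scal {Q} (x y z : Q -> C) r N c f : (0 < r)%R ->
  W x y z r N f -> W x y z r (Cmod c * N) (fun q => c * f q).
Proof. intros Hr H. apply (W_mult x y z r _ _ (fun _ => c)); auto. apply W_const; auto. Qed.

Lemma W_pow {Q} (x y z : Q -> C) r N f n : (0 < r)%R ->
  W x y z r N f -> W x y z r (N ^ n) (fun q => f q ^ n).
Proof.
  intros Hr H. induction n; simpl.
  - apply W_le with (Cmod 1); [rewrite Cmod_1; lra|]. apply W_const; auto.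
  - apply W_mult; auto.
Qed.

(** Completeness of the norm: the coefficients of all summands form one family over pairs, bounded
    by the sum of the norms, and [W_intro] collects it. *)
Lemma W_sum {Q I} (x y z : Q -> C) r (f : I -> Q -> C) (N : I -> R) M F : (0 < r)%R ->
  (forall i, W x y z r (N i) (f i)) -> SumLe N M ->
  (forall q, inbox x y z r q -> HS (fun i => f i q) (F q)) -> W x y z r M F.
Proof.
  intros Hr Hf HM HF.
  set (k := fun i => proj1_sig (constructive_indefinite_description _ (Hf i))).
  assert (Hk : forall i, SumLe (fun e => Cmod (k i e) * r ^ deg e)%R (N i) /\
    forall q, inbox x y z r q -> HS (fun e => k i e * mon (x q) (y q) (z q) e) (f i q))
    by (intros i; unfold k; destruct (constructive_indefinite_description _ (Hf i)); auto).
  assert (HS1 : SumLe (fun p : I * E3 => Cmod (k (fst p) (snd p)) * r ^ deg (snd p))%R M).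
  { apply (SumLe_pair _ N); auto.
    - intros; apply Rmult_le_pos; [apply Cmod_ge_0|apply pow_le; lra].
    - intros i. exact (proj1 (Hk i)). }
  apply (W_intro _ _ _ _ _ _ (fun p : I * E3 => k (fst p) (snd p)) snd); auto.
  intros q Hq.
  apply (HS_pair (fun p : I * E3 => k (fst p) (snd p) * mon (x q) (y q) (z q) (snd p))
    (fun i => f i q) _ M).
  - apply (term_SumLe x y z r M (fun p : I * E3 => k (fst p) (snd p)) snd); auto.
  - intros i. exact (proj2 (Hk i) q Hq).
  - apply HF; auto.
Qed.

Lemma W_inbox {Q} (x y z x' y' z' : Q -> C) r r' q : 
  W x' y' z' r' r x -> W x' y' z' r' r y -> W x' y' z' r' r z ->
  inbox x' y' z' r' q -> inbox x y z r q.
Proof.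
  intros Hx Hy Hz Hq. repeat split; eapply W_bound; eauto.
Qed.

(** If each old coordinate has norm at most r in the new ones, a monomial of degree d has norm at
    most r^d, which is exactly its weight; so N does not grow. *)
Lemma W_subst {Q} (x y z x' y' z' : Q -> C) r r' N f : (0 < r')%R ->
  W x' y' z' r' r x -> W x' y' z' r' r y -> W x' y' z' r' r z ->
  W x y z r N f -> W x' y' z' r' N f.
Proof.
  intros Hr Hx Hy Hz [k [H1 H2]].
  apply (W_sum _ _ _ _ (fun e q => k e * mon (x q) (y q) (z q) e)
    (fun e => Cmod (k e) * r ^ deg e)%R); auto.
  - intros e. apply W_scal; auto. unfold mon, deg. rewrite !pow_add.
    apply W_mult; auto; [apply W_mult; auto|]; apply W_pow; auto.
  - intros q Hq. apply H2. eapply W_inbox; eauto.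
Qed.

Lemma W_perm {Q} (x y z x' y' z' : Q -> C) r N f : (0 < r)%R ->
  (x = x' \/ x = y' \/ x = z') -> (y = x' \/ y = y' \/ y = z') ->
  (z = x' \/ z = y' \/ z = z') -> W x y z r N f -> W x' y' z' r N f.
Proof.
  intros Hr Hx Hy Hz. apply W_subst; auto.
  - destruct Hx as [->|[->| ->]]; [apply W_x|apply W_y|apply W_z]; auto.
  - destruct Hy as [->|[->| ->]]; [apply W_x|apply W_y|apply W_z]; auto.
  - destruct Hz as [->|[->| ->]]; [apply W_x|apply W_y|apply W_z]; auto.
Qed.

(** * Splitting off one coordinate and the one-variable identity theorem *)

Definition PS (k : E3 -> C) (x y z : C) : C := tsum (fun e => k e * mon x y z e).

Definition up3 (e : E3) : E3 := (fst e, S (snd e)).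

Lemma deg_up3 e : deg (up3 e) = S (deg e).
Proof. unfold deg, up3; simpl; lia. Qed.

Lemma mon_up3 x y z e : mon x y z (up3 e) = z * mon x y z e.
Proof. unfold mon, up3; simpl. ring. Qed.

Definition k_low (k : E3 -> C) (e : E3) : C := if Nat.eq_dec (snd e) 0 then k e else 0.

Definition k_high (k : E3 -> C) (e : E3) : C := k (up3 e).

Lemma k_low_SumLe k r N : (0 <= r)%R -> SumLe (fun e => Cmod (k e) * r ^ deg e)%R N ->
  SumLe (fun e => Cmod (k_low k e) * r ^ deg e)%R N.
Proof.
  intros Hr H. eapply SumLe_le; [| |apply H]; [|lra]. intros e.
  apply Rmult_le_compat_r; [apply pow_le; auto|]. unfold k_low.
  destruct Nat.eq_dec; [lra|]. rewrite Cmod_0. apply Cmod_ge_0.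
Qed.

Lemma k_high_SumLe k r N : (0 < r)%R -> SumLe (fun e => Cmod (k e) * r ^ deg e)%R N ->
  SumLe (fun e => Cmod (k_high k e) * r ^ deg e)%R (N / r).
Proof.
  intros Hr H.
  assert (H' : SumLe (fun e => Cmod (k (up3 e)) * r ^ deg (up3 e))%R N).
  { apply (SumLe_inj up3 (fun e => Cmod (k e) * r ^ deg e)%R); auto.
    unfold up3. intros [? ?] [? ?]; simpl; congruence. }
  apply (SumLe_scal _ _ (/ r)) in H'; [|left; apply Rinv_0_lt_compat; auto].
  eapply SumLe_le; [| |apply H']; [|unfold Rdiv; lra].
  intros e. cbv beta. rewrite deg_up3. unfold k_high. simpl. right. field. lra.
Qed.

Lemma HS_split_z k x y z r N : (0 < r)%R ->
  (Cmod x <= r)%R -> (Cmod y <= r)%R -> (Cmod z <= r)%R ->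
  SumLe (fun e => Cmod (k e) * r ^ deg e)%R N ->
  HS (fun e => k e * mon x y z e) (PS (k_low k) x y z + z * PS (k_high k) x y z).
Proof.
  intros Hr Hx Hy Hz H.
  assert (Hs : forall k' N', SumLe (fun e => Cmod (k' e) * r ^ deg e)%R N' ->
    HS (fun e => k' e * mon x y z e) (PS k' x y z)).
  { intros k' N' H'. apply HS_tsum with N'.
    apply (term_SumLe (Q := unit) (fun _ => x) (fun _ => y) (fun _ => z) r N' k'
      (fun e => e) tt); auto. repeat split; auto. }
  pose proof (Hs _ _ (k_low_SumLe k r N ltac:(lra) H)) as H0.
  pose proof (Hs _ _ (k_high_SumLe k r N Hr H)) as H1.
  apply (HS_scal _ _ z) in H1.
  set (v := fun e : E3 => if Nat.eq_dec (snd e) 0 then RtoC 0 else k e * mon x y z e).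
  assert (Hv : HS v (z * PS (k_high k) x y z)).
  { apply (HS_inj_ext up3 v).
    - unfold up3. intros [? ?] [? ?]; simpl; congruence.
    - intros [p n] Hn. unfold v. simpl. destruct (Nat.eq_dec n 0); auto.
      exfalso. destruct n; [lia|]. apply (Hn (p, n)). reflexivity.
    - eapply HS_ext; [|apply H1]. intros e. unfold v, k_high. simpl.
      rewrite mon_up3. ring. }
  eapply HS_ext; [|apply (HS_plus _ _ _ _ H0 Hv)].
  intros e. unfold v, k_low. simpl. destruct Nat.eq_dec; ring.
Qed.

Lemma PS_low_indep k x y z z' : PS (k_low k) x y z = PS (k_low k) x y z'.
Proof.
  unfold PS. f_equal. apply functional_extensionality. intros e. unfold k_low, mon.
  destruct Nat.eq_dec as [H|H]; [rewrite H; reflexivity|ring].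
Qed.

Lemma W_PS {Q} (x y z : Q -> C) r N k : SumLe (fun e => Cmod (k e) * r ^ deg e)%R N ->
  W x y z r N (fun q => PS k (x q) (y q) (z q)).
Proof.
  intros H. exists k; split; auto. intros q Hq. apply HS_tsum with N.
  apply (term_SumLe x y z r N k (fun e => e)); auto.
Qed.

(** The monomials are sorted by whether z occurs. The part without z is returned as a function of
    two complex numbers, so its independence of z is visible from its type; dividing the rest by z
    costs a factor 1/r. *)
Lemma W_split {Q} (x y z : Q -> C) r N f : (0 < r)%R -> W x y z r N f ->
  exists (g : C -> C -> C) (f1 : Q -> C), W x y z r N (fun q => g (x q) (y q)) /\
    W x y z r (N / r) f1 /\ forall q, inbox x y z r q -> f q = g (x q) (y q) + z q * f1 q.
Proof.
  intros Hr [k [H1 H2]].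
  exists (fun u v => PS (k_low k) u v 0), (fun q => PS (k_high k) (x q) (y q) (z q)).
  split; [|split].
  - apply W_ext with (fun q => PS (k_low k) (x q) (y q) (z q)).
    + intros; apply PS_low_indep.
    + apply W_PS, k_low_SumLe; auto; lra.
  - apply W_PS, k_high_SumLe; auto.
  - intros q Hq. rewrite (PS_low_indep k _ _ 0 (z q)).
    apply (HS_unique _ _ _ (H2 q Hq)). destruct Hq as [? [? ?]].
    apply HS_split_z with r N; auto.
Qed.

Lemma mon_small x y z r e : (0 < r)%R ->
  (Cmod x <= r)%R -> (Cmod y <= r)%R -> (Cmod z <= r)%R -> e <> (0, 0, 0)%nat ->
  (Cmod (mon x y z e) <= (Cmod x + Cmod y + Cmod z) * (r ^ deg e / r))%R.
Proof.
  intros Hr Hx Hy Hz He.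
  pose proof (Cmod_ge_0 x); pose proof (Cmod_ge_0 y); pose proof (Cmod_ge_0 z).
  assert (Ha : forall (c : C) (e' : E3), (Cmod c <= r)%R ->
     (Cmod (c * mon x y z e') <= Cmod c * (r ^ S (deg e') / r))%R).
  { intros c e' Hc. rewrite Cmod_mult. apply Rmult_le_compat_l; [apply Cmod_ge_0|].
    simpl. replace (r * r ^ deg e' / r)%R with (r ^ deg e')%R by (field; lra).
    apply mon_le; auto. }
  assert (Hp : (0 <= r ^ deg e / r)%R)
    by (apply Rmult_le_pos; [apply pow_le; lra|left; apply Rinv_0_lt_compat; auto]).
  destruct e as [[[|i] j] l].
  - destruct j as [|j].
    + destruct l as [|l]; [congruence|].
      replace (mon x y z (0, 0, S l)%nat) with (z * mon x y z (0, 0, l)%nat)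
        by (unfold mon; simpl; ring).
      eapply Rle_trans; [apply Ha; auto|].
      change (S (deg (0, 0, l)%nat)) with (deg (0, 0, S l)%nat).
      apply Rmult_le_compat_r; auto; lra.
    + replace (mon x y z (0, S j, l)%nat) with (y * mon x y z (0, j, l)%nat)
        by (unfold mon; simpl; ring).
      eapply Rle_trans; [apply Ha; auto|].
      change (S (deg (0, j, l)%nat)) with (deg (0, S j, l)%nat).
      apply Rmult_le_compat_r; auto; lra.
  - replace (mon x y z (S i, j, l)%nat) with (x * mon x y z (i, j, l)%nat)
        by (unfold mon; simpl; ring).
    eapply Rle_trans; [apply Ha; auto|].
    change (S (deg (i, j, l)%nat)) with (deg (S i, j, l)%nat).
    apply Rmult_le_compat_r; auto; lra.
Qed.

(** Every non-constant monomial contains a coordinate, and taking it out leaves at most r^(deg e -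
    1). This bound at the centre supplies continuity in the sequel. *)
Lemma W_lip {Q} (x y z : Q -> C) r N f q0 q : (0 < r)%R -> W x y z r N f ->
  x q0 = 0 -> y q0 = 0 -> z q0 = 0 -> inbox x y z r q ->
  (Cmod (f q - f q0) <= (Cmod (x q) + Cmod (y q) + Cmod (z q)) * (N / r))%R.
Proof.
  intros Hr [k [H1 H2]] Hx0 Hy0 Hz0 Hq.
  assert (Hq0 : inbox x y z r q0)
    by (unfold inbox; rewrite Hx0, Hy0, Hz0, Cmod_0; lra).
  set (t := (Cmod (x q) + Cmod (y q) + Cmod (z q))%R).
  assert (Ht : (0 <= t)%R) by (unfold t; pose proof (Cmod_ge_0 (x q));
    pose proof (Cmod_ge_0 (y q)); pose proof (Cmod_ge_0 (z q)); lra).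
  apply (HS_bound _ _ _ (HS_minus _ _ _ _ (H2 q Hq) (H2 q0 Hq0))).
  apply (SumLe_scal _ _ (t / r)) in H1.
  - eapply SumLe_le; [| |apply H1].
    + intros e. simpl. rewrite Hx0, Hy0, Hz0.
      replace (k e * mon (x q) (y q) (z q) e - k e * mon 0 0 0 e) with
        (k e * (mon (x q) (y q) (z q) e - mon 0 0 0 e)) by ring.
      rewrite Cmod_mult. pose proof (Cmod_ge_0 (k e)).
      replace (t / r * (Cmod (k e) * r ^ deg e))%R with
        (Cmod (k e) * (t * (r ^ deg e / r)))%R by (field; lra).
      apply Rmult_le_compat_l; auto.
      destruct (eqd e (0, 0, 0)%nat) as [->|He].
      * unfold mon; simpl. replace (1 * 1 * 1 - 1 * 1 * 1) with (RtoC 0) by ring.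
        rewrite Cmod_0. apply Rmult_le_pos; auto. unfold deg; simpl.
        left; apply Rdiv_lt_0_compat; lra.
      * destruct Hq as [? [? ?]].
        assert (mon 0 0 0 e = 0) as ->.
        { destruct e as [[[|i] [|j]] [|l]]; unfold mon; simpl; try ring; congruence. }
        replace (mon (x q) (y q) (z q) e - 0) with (mon (x q) (y q) (z q) e) by ring.
        apply mon_small; auto.
    + right. field. lra.
  - apply Rmult_le_pos; auto. left; apply Rinv_0_lt_compat; auto.
Qed.

Lemma small_zero (c : R) M : (0 <= c)%R ->
  (forall d, (0 < d)%R -> (c <= d * M)%R) -> c = 0%R.
Proof.
  intros Hc H. destruct (Req_dec c 0) as [|Hn]; auto. exfalso.
  assert (0 < c)%R by lra.
  destruct (Rle_or_lt M 0).
  - specialize (H 1%R). lra.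
  - specialize (H (c / (2 * M))%R). assert (0 < c / (2 * M))%R by (apply Rdiv_lt_0_compat; lra).
    specialize (H H2). replace (c / (2 * M) * M)%R with (c / 2)%R in H by (field; lra). lra.
Qed.

(* If a one-variable power series vanishes at points z <> 0 accumulating at 0,
   it can be divided by z arbitrarily often. *)
Lemma W_descent {Q} (z : Q -> C) r N f (A : Q -> Prop) : (0 < r)%R ->
  W (fun _ => 0) (fun _ => 0) z r N f ->
  (forall q, A q -> f q = 0) ->
  (forall d, (0 < d)%R -> exists q, A q /\ (0 < Cmod (z q) < d)%R) ->
  forall n, exists g, W (fun _ => 0) (fun _ => 0) z r (N / r ^ n) g /\
    forall q, (Cmod (z q) <= r)%R -> f q = z q ^ n * g q.
Proof.
  intros Hr Hf HA HAz n.
  assert (Hin : forall q, (Cmod (z q) <= r)%R -> inbox (fun _ : Q => 0) (fun _ : Q => 0) z r q)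
    by (intros q Hq; unfold inbox; rewrite Cmod_0; lra).
  induction n as [|n [g [Hg Hfg]]].
  - exists f. simpl. split; [|intros; ring]. replace (N / 1)%R with N by field; auto.
  - destruct (W_split _ _ _ _ _ _ Hr Hg) as [c [g1 [_ [Hg1 Hs]]]].
    exists g1. split.
    + replace (N / r ^ S n)%R with (N / r ^ n / r)%R; auto.
      simpl. field. split; [apply pow_nonzero; lra|lra].
    + assert (Hc : c 0 0 = 0).
      { apply Cmod_eq_0. apply small_zero with (N / r ^ n / r)%R; [apply Cmod_ge_0|].
        intros d Hd. destruct (HAz (Rmin d r)) as [q [Hq [Hz0 Hz1]]].
        { apply Rmin_pos; auto. }
        pose proof (Rmin_l d r); pose proof (Rmin_r d r).
        assert (Hzr : (Cmod (z q) <= r)%R) by lra.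
        pose proof (Hfg q Hzr) as H1. rewrite (HA q Hq) in H1.
        assert (Hgq : g q = 0).
        { apply NNPP; intros Hn. apply (Cmult_neq_0 (z q ^ n) (g q)); auto.
          apply Cpow_nz. apply Cmod_gt_0. auto. }
        rewrite (Hs q (Hin q Hzr)) in Hgq.
        assert (c 0 0 = - (z q * g1 q)) as ->.
        { replace (c 0 0) with ((c 0 0 + z q * g1 q) - z q * g1 q) by ring.
          rewrite Hgq. ring. }
        rewrite Cmod_opp, Cmod_mult.
        pose proof (W_bound _ _ _ _ _ _ q Hg1 (Hin q Hzr)).
        apply Rmult_le_compat; try apply Cmod_ge_0; lra. }
      intros q Hq. rewrite (Hfg q Hq), (Hs q (Hin q Hq)), Hc. simpl. ring.
Qed.

(** After n divisions by z the bound reads |f q| <= (|z| / r)^n N with the same N for every n, while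
    |z| < r. *)
Lemma W_identity {Q} (z : Q -> C) r N f (A : Q -> Prop) : (0 < r)%R ->
  W (fun _ => 0) (fun _ => 0) z r N f ->
  (forall q, A q -> f q = 0) ->
  (forall d, (0 < d)%R -> exists q, A q /\ (0 < Cmod (z q) < d)%R) ->
  forall q, (Cmod (z q) < r)%R -> f q = 0.
Proof.
  intros Hr Hf HA HAz q Hq. apply Cmod_eq_0.
  assert (HN := W_ge0 _ _ _ _ _ _ Hf).
  set (t := (Cmod (z q) / r)%R).
  assert (Ht : (0 <= t < 1)%R).
  { unfold t. pose proof (Cmod_ge_0 (z q)). split.
    - apply Rmult_le_pos; auto. left; apply Rinv_0_lt_compat; auto.
    - apply Rmult_lt_reg_r with r; auto. unfold Rdiv. rewrite Rmult_assoc, Rinv_l; lra. }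
  apply small_zero with N; [apply Cmod_ge_0|]. intros d Hd.
  destruct (pow_lt_1_zero t) with (y := d) as [n Hn]; auto.
  { rewrite Rabs_pos_eq; lra. }
  specialize (Hn n (le_n _)). rewrite Rabs_pos_eq in Hn by (apply pow_le; lra).
  destruct (W_descent z r N f A Hr Hf HA HAz n) as [g [Hg Hfg]].
  rewrite Hfg by lra. rewrite Cmod_mult, Cmod_pow.
  assert (Hin : inbox (fun _ : Q => 0) (fun _ : Q => 0) z r q)
    by (unfold inbox; rewrite Cmod_0; lra).
  pose proof (W_bound _ _ _ _ _ _ q Hg Hin).
  apply Rle_trans with (Cmod (z q) ^ n * (N / r ^ n))%R.
  - apply Rmult_le_compat_l; auto. apply pow_le, Cmod_ge_0.
  - replace (Cmod (z q) ^ n * (N / r ^ n))%R with (t ^ n * N)%R.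
    + apply Rmult_le_compat_r; lra.
    + unfold t. unfold Rdiv. rewrite Rpow_mult_distr, pow_inv. ring.
Qed.

(** * Weierstrass holomorphy in terms of the weighted norm *)

Definition cx (p q : C3) : C := ca q - ca p.

Definition cy (p q : C3) : C := cb q - cb p.

Definition cz (p q : C3) : C := cc q - cc p.

Lemma W_holomorphic f p r N : (0 < r)%R ->
  W (cx p) (cy p) (cz p) r N f -> holomorphic_at f p.
Proof.
  intros Hr [k [H1 H2]]. exists (fun i j l => k (i, j, l)), r. split; auto.
  intros q [Ha [Hb Hc]].
  assert (Hq : inbox (cx p) (cy p) (cz p) r q)
    by (unfold inbox, cx, cy, cz; repeat split; lra).
  assert (HE : forall e : E3, k e * mon (cx p q) (cy p q) (cz p q) e =
    k (fst (fst e), snd (fst e), snd e) * (ca q - ca p) ^ fst (fst e) *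
     (cb q - cb p) ^ snd (fst e) * (cc q - cc p) ^ snd e)
    by (intros [[i j] l]; unfold mon, cx, cy, cz; simpl; ring).
  apply HS_has_sum3 with N.
  - eapply SumLe_le; [| |apply (term_SumLe _ _ _ r N k (fun e => e) q H1 Hq)]; [|lra].
    intros e. simpl. right. f_equal. symmetry. apply HE.
  - eapply HS_ext; [|apply (H2 q Hq)]. apply HE.
Qed.

Lemma holomorphic_W f p : holomorphic_at f p ->
  exists r N, (0 < r)%R /\ W (cx p) (cy p) (cz p) r N f.
Proof.
  intros [k [r [Hr H]]].
  assert (Hr2 : (Cmod (RtoC (r / 2)) = r / 2)%R)
    by (rewrite Cmod_R; apply Rabs_pos_eq; lra).
  (* Absolute convergence at the point displaced by r / 2 in all three coordinates is exactly the
     bound on the norm of radius r / 2. *)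
  destruct (has_sum3_HS _ _ (H (ca p + RtoC (r / 2), cb p + RtoC (r / 2), cc p + RtoC (r / 2)) ltac:(
    unfold polydisc; simpl;
    unfold ca, cb, cc; simpl;
    repeat (split; [match goal with |- (Cmod (?a + ?b - ?a) < _)%R =>
      replace (a + b - a) with b by ring; rewrite Hr2; lra end|]);
    match goal with |- (Cmod (?a + ?b - ?a) < _)%R =>
      replace (a + b - a) with b by ring; rewrite Hr2; lra end))) as [M [HM _]].
  exists (r / 2)%R, M. split; [lra|].
  exists (fun e => k (fst (fst e)) (snd (fst e)) (snd e)). split.
  - eapply SumLe_le; [| |apply HM]; [|lra].
    intros [[i j] l]. unfold ca, cb, cc, deg; simpl.
    repeat match goal with |- context [?a + RtoC (r / 2) - ?a] =>
      replace (a + RtoC (r / 2) - a) with (RtoC (r / 2)) by ring end.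
    rewrite !Cmod_mult, !Cmod_pow, Hr2, !pow_add. lra.
  - intros q [Ha [Hb Hc]].
    destruct (has_sum3_HS _ _ (H q ltac:(unfold polydisc; unfold cx, cy, cz in *;
      repeat split; lra))) as [M' [_ HS']].
    eapply HS_ext; [|apply HS']. intros [[i j] l]. unfold mon, cx, cy, cz; simpl. ring.
Qed.

(** * Exponential and binomial series *)

(** Here p is [Re] or [Im]: complex power series in a real variable are differentiated through their
    two real parts. *)
Lemma HS_rsum_series (u : nat -> C) s (p : C -> R) :
  (forall L, p (csum L u) = rsum L (fun n => p (u n))) ->
  (forall z w, (Rabs (p z - p w) <= Cmod (z - w))%R) ->
  HS u s -> is_series (fun n => p (u n)) (p s).
Proof.
  intros Hp Hc Hs. apply filterlim_locally. intros eps.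
  destruct (Hs eps (cond_pos eps)) as [L0 H0].
  destruct (cube_incl cube1 L0 cube1_cube) as [n Hn].
  exists n. intros m Hm. rewrite seq_sum_n_R.
  change (Rabs (rsum (cube1 m) (fun n => p (u n)) - p s) < eps)%R.
  rewrite <- Hp. eapply Rle_lt_trans; [apply Hc|]. apply H0; auto. apply cube1_cube.
Qed.

Lemma HS_Re_series (u : nat -> C) s : HS u s -> is_series (fun n => Re (u n)) (Re s).
Proof.
  apply HS_rsum_series; [intros; apply csum_Re|]. intros z w.
  replace (Re z - Re w)%R with (Re (z - w)) by (destruct z, w; reflexivity).
  apply Re_le_mod.
Qed.

Lemma HS_Im_series (u : nat -> C) s : HS u s -> is_series (fun n => Im (u n)) (Im s).
Proof.
  apply HS_rsum_series; [intros; apply csum_Im|]. intros z w.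
  replace (Im z - Im w)%R with (Im (z - w)) by (destruct z, w; reflexivity).
  apply Im_le_mod.
Qed.

Lemma SumLe_nat (v : nat -> R) M : (forall n, (0 <= v n)%R) ->
  (forall n, (rsum (seq 0 (S n)) v <= M)%R) -> SumLe v M.
Proof.
  intros Hv HM L HL. destruct (cube_incl cube1 L cube1_cube) as [n Hn].
  eapply Rle_trans; [|apply (HM n)]. apply rsum_incl; auto. apply Hn; auto.
Qed.

Lemma SumLe_series (v : nat -> R) s : (forall n, (0 <= v n)%R) ->
  is_series v s -> SumLe v s.
Proof.
  intros Hv Hs. apply SumLe_nat; auto. intros n. rewrite <- seq_sum_n_R.
  rewrite <- (is_series_unique _ _ Hs).
  apply Rnot_lt_le. intros Hlt.
  assert (Hl : is_lim_seq (sum_n v) s) by exact Hs.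
  assert (Rbar_le (sum_n v n) s).
  { apply (is_lim_seq_le_loc (fun _ => sum_n v n) (sum_n v)).
    - exists n. intros m Hm. induction Hm; [lra|]. rewrite sum_Sn.
      specialize (Hv (S m)). unfold plus; simpl. lra.
    - apply is_lim_seq_const.
    - exact Hl. }
  rewrite (is_series_unique _ _ Hs) in Hlt. simpl in H. lra.
Qed.

Definition cpart (c : nat -> C) (r : R) : Prop :=
  exists N, SumLe (fun n => Cmod (c n) * r ^ n)%R N.

Lemma cpart_radius (c : nat -> C) r (a : nat -> R) : (0 < r)%R ->
  cpart c r -> (forall n, (Rabs (a n) <= Cmod (c n))%R) -> Rbar_le r (CV_radius a).
Proof.
  intros Hr [N HN] Ha. destruct (CV_radius_bounded a) as [Hub _]. apply Hub.
  exists N. intros n. rewrite Rabs_mult, (Rabs_pos_eq (r ^ n)) by (apply pow_le; lra).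
  eapply Rle_trans; [|apply (SumLe_1 _ _ n HN)]. apply Rmult_le_compat_r; auto.
  apply pow_le; lra.
Qed.

Definition cser (c : nat -> C) (t : R) : C := tsum (fun n => c n * RtoC (t ^ n)).

Definition cder (c : nat -> C) (n : nat) : C := RtoC (INR (S n)) * c (S n).

Lemma cpart_SumLe c r t : (0 < r)%R -> cpart c r -> (Rabs t < r)%R ->
  exists N, SumLe (fun n => Cmod (c n * RtoC (t ^ n))) N.
Proof.
  intros Hr [N HN] Ht. exists N. eapply SumLe_le; [| |apply HN]; [|lra].
  intros n. rewrite Cmod_mult, Cmod_R, <- RPow_abs.
  apply Rmult_le_compat_l; [apply Cmod_ge_0|]. apply pow_incr. split; [apply Rabs_pos|lra].
Qed.

Lemma cser_HS c r t : (0 < r)%R -> cpart c r -> (Rabs t < r)%R ->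
  HS (fun n => c n * RtoC (t ^ n)) (cser c t).
Proof.
  intros Hr H Ht. destruct (cpart_SumLe c r t Hr H Ht) as [N HN].
  apply HS_tsum with N; auto.
Qed.

(** The factor n + 1 from differentiation is absorbed by any loss of radius, hence the strict
    inequality. *)
Lemma cder_part c r r' : (0 < r' < r)%R -> cpart c r -> cpart (cder c) r'.
Proof.
  intros Hr H.
  assert (HR : Rbar_lt (Rabs r') (CV_radius (PS_derive (fun n => Cmod (c n))))).
  { rewrite CV_radius_derive. eapply Rbar_lt_le_trans;
      [|apply (cpart_radius c r); auto; try lra].
    - simpl. rewrite Rabs_pos_eq; lra.
    - intros n. rewrite Rabs_pos_eq; [lra|apply Cmod_ge_0]. }
  apply CV_disk_inside in HR. destruct HR as [s Hs]. exists s.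
  eapply SumLe_le; [| |apply (SumLe_series _ _ (fun n => Rabs_pos _) Hs)]; [|lra].
  intros n. unfold cder, PS_derive. rewrite Cmod_mult, Cmod_R, !Rabs_mult.
  rewrite (Rabs_pos_eq (Cmod _)) by apply Cmod_ge_0.
  rewrite (Rabs_pos_eq (r' ^ n)) by (apply pow_le; lra). lra.
Qed.

Lemma cser_derive c r t : (0 < r)%R -> cpart c r -> (Rabs t < r)%R ->
  is_derive (fun t => Re (cser c t)) t (Re (cser (cder c) t)) /\
  is_derive (fun t => Im (cser c t)) t (Im (cser (cder c) t)).
Proof.
  intros Hr H Ht.
  assert (Hd : cpart (cder c) ((Rabs t + r) / 2))
    by (apply (cder_part c r); auto; pose proof (Rabs_pos t); lra).
  assert (Ht' : (Rabs t < (Rabs t + r) / 2)%R) by lra.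
  assert (Hr' : (0 < (Rabs t + r) / 2)%R) by (pose proof (Rabs_pos t); lra).
  pose proof (cser_HS _ _ t Hr' Hd Ht') as HD.
  assert (Hnear : forall P : R -> Prop, (forall s, (Rabs s < r)%R -> P s) -> locally t P).
  { intros P HP. assert (Hpos : (0 < r - Rabs t)%R) by lra.
    exists (mkposreal _ Hpos). intros s Hs. apply HP.
    change (Rabs (s - t) < r - Rabs t)%R in Hs.
    replace s with (t + (s - t))%R by ring.
    eapply Rle_lt_trans; [apply Rabs_triang|]. lra. }
  split.
  - apply (is_derive_ext_loc (PSeries (fun n => Re (c n)))).
    + apply Hnear. intros s Hs. pose proof (HS_Re_series _ _ (cser_HS c r s Hr H Hs)) as HH.
      rewrite <- (is_series_unique _ _ HH). apply Series_ext. intros n.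
      rewrite re_scal_r. ring.
    + replace (Re (cser (cder c) t)) with (PSeries (PS_derive (fun n => Re (c n))) t).
      * apply is_derive_PSeries. eapply Rbar_lt_le_trans; [|apply (cpart_radius c r); auto].
        -- simpl; auto.
        -- intros; apply Re_le_mod.
      * rewrite <- (is_series_unique _ _ (HS_Re_series _ _ HD)). apply Series_ext.
        intros n. unfold PS_derive, cder. rewrite re_scal_r, re_scal_l. ring.
  - apply (is_derive_ext_loc (PSeries (fun n => Im (c n)))).
    + apply Hnear. intros s Hs. pose proof (HS_Im_series _ _ (cser_HS c r s Hr H Hs)) as HH.
      rewrite <- (is_series_unique _ _ HH). apply Series_ext. intros n.
      rewrite im_scal_r. ring.
    + replace (Im (cser (cder c) t)) with (PSeries (PS_derive (fun n => Im (c n))) t).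
      * apply is_derive_PSeries. eapply Rbar_lt_le_trans; [|apply (cpart_radius c r); auto].
        -- simpl; auto.
        -- intros; apply Im_le_mod.
      * rewrite <- (is_series_unique _ _ (HS_Im_series _ _ HD)). apply Series_ext.
        intros n. unfold PS_derive, cder. rewrite im_scal_r, im_scal_l. ring.
Qed.

Lemma Cexp_add z w : Cexp (z + w) = Cexp z * Cexp w.
Proof.
  destruct z as [x y], w as [u v].
  unfold Cexp, Cplus, Cmult, Re, Im; simpl.
  rewrite exp_plus, cos_plus, sin_plus. f_equal; ring.
Qed.

Lemma Cexp_0 : Cexp 0 = 1.
Proof. unfold Cexp; simpl. rewrite exp_0, cos_0, sin_0. unfold RtoC. f_equal; ring. Qed.

Lemma Cmod_Cexp z : Cmod (Cexp z) = exp (Re z).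
Proof.
  unfold Cmod, Cexp; simpl fst; simpl snd.
  replace ((exp (Re z) * cos (Im z)) ^ 2 + (exp (Re z) * sin (Im z)) ^ 2)%R
    with (exp (Re z) ^ 2)%R.
  - apply sqrt_pow2. left; apply exp_pos.
  - pose proof (sin2_cos2 (Im z)). unfold Rsqr in H.
    replace (exp (Re z) ^ 2)%R with
      (exp (Re z) ^ 2 * (sin (Im z) * sin (Im z) + cos (Im z) * cos (Im z)))%R
      by (rewrite H; ring). ring.
Qed.

(* The solution of g' = l' z g is Cexp (z l) g(0): the product of g and
   Cexp (- z l) has derivative zero. *)
Lemma ode_exp (P Q l k : R -> R) (z : C) (t : R) :
  (forall s, (Rabs s <= Rabs t)%R -> is_derive l s (k s) /\
    is_derive P s (k s * (Re z * P s - Im z * Q s))%R /\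
    is_derive Q s (k s * (Im z * P s + Re z * Q s))%R) ->
  l 0%R = 0%R -> (P t, Q t) = Cexp (z * RtoC (l t)) * (P 0%R, Q 0%R).
Proof.
  intros H Hl0. set (x := Re z). set (y := Im z).
  assert (HC : forall f : R -> R, (forall s, (Rabs s <= Rabs t)%R -> is_derive f s zero) ->
    f 0%R = f t).
  { intros f Hf. destruct (Rtotal_order t 0) as [Ht|[->|Ht]]; auto.
    - symmetry. apply eq_is_derive; auto. intros s Hs. apply Hf.
      rewrite !Rabs_left1; lra.
    - apply eq_is_derive; auto. intros s Hs. apply Hf. rewrite !Rabs_pos_eq; lra. }
  set (f1 := fun s => (exp (- x * l s) * (cos (y * l s) * P s + sin (y * l s) * Q s))%R).
  set (f2 := fun s => (exp (- x * l s) * (cos (y * l s) * Q s - sin (y * l s) * P s))%R).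
  assert (E1 : f1 0%R = f1 t).
  { apply HC. intros s Hs. destruct (H s Hs) as [Hl [HP HQ]].
    unfold f1. change (@zero R_NormedModule) with 0%R. auto_derive.
    - repeat split; eexists; eauto.
    - replace (Derive (fun x : R => l x) s) with (k s)
        by (symmetry; apply is_derive_unique; exact Hl).
      replace (Derive (fun x : R => P x) s) with (k s * (x * P s - y * Q s))%R
        by (symmetry; apply is_derive_unique; exact HP).
      replace (Derive (fun x : R => Q x) s) with (k s * (y * P s + x * Q s))%R
        by (symmetry; apply is_derive_unique; exact HQ). ring. }
  assert (E2 : f2 0%R = f2 t).
  { apply HC. intros s Hs. destruct (H s Hs) as [Hl [HP HQ]].
    unfold f2. change (@zero R_NormedModule) with 0%R. auto_derive.
    - repeat split; eexists; eauto.
    - replace (Derive (fun x : R => l x) s) with (k s)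
        by (symmetry; apply is_derive_unique; exact Hl).
      replace (Derive (fun x : R => P x) s) with (k s * (x * P s - y * Q s))%R
        by (symmetry; apply is_derive_unique; exact HP).
      replace (Derive (fun x : R => Q x) s) with (k s * (y * P s + x * Q s))%R
        by (symmetry; apply is_derive_unique; exact HQ). ring. }
  assert (E : Cexp (- (z * RtoC (l t))) * (P t, Q t) = (P 0%R, Q 0%R)).
  { assert (A1 : f1 0%R = P 0%R) by (unfold f1; rewrite Hl0, !Rmult_0_r, exp_0, cos_0, sin_0; ring).
    assert (A2 : f2 0%R = Q 0%R) by (unfold f2; rewrite Hl0, !Rmult_0_r, exp_0, cos_0, sin_0; ring).
    rewrite <- A1, <- A2, E1, E2. unfold f1, f2.
    replace (Re (- (z * RtoC (l t)))) with (- x * l t)%R.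
    unfold Cexp.
    replace (Re (- (z * RtoC (l t)))) with (- x * l t)%R
      by (unfold x; destruct z; unfold Re; simpl; ring).
    replace (Im (- (z * RtoC (l t)))) with (- (y * l t))%R
      by (unfold y; destruct z; unfold Im; simpl; ring).
    rewrite cos_neg, sin_neg. unfold Cmult; simpl. f_equal; ring.
    unfold x; destruct z; unfold Re; simpl; ring. }
  rewrite <- E, Cmult_assoc, <- Cexp_add.
  replace (z * RtoC (l t) + - (z * RtoC (l t))) with (RtoC 0) by ring.
  rewrite Cexp_0. symmetry. apply Cmult_1_l.
Qed.

Lemma cser_0 c r : (0 < r)%R -> cpart c r -> cser c 0 = c 0%nat.
Proof.
  intros Hr H. apply tsum_HS. eapply HS_ext; [|apply (HS_single O (c O))].
  intros n. unfold ind. destruct excluded_middle_informative as [->|Hn].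
  - simpl. ring.
  - rewrite pow_i by lia. ring.
Qed.

(** Common source of two series: k = 1 gives the exponential, k = 1 / (1 - s) with l = - ln (1 - s)
    the binomial series. On power series the differential equation is a recursion for the
    coefficients. *)
Lemma ode_cser c r z (l k : R -> R) t : (Rabs t < r)%R -> cpart c r ->
  (forall s, (Rabs s <= Rabs t)%R -> is_derive l s (k s) /\
     cser (cder c) s = RtoC (k s) * (z * cser c s)) ->
  l 0%R = 0%R -> HS (fun n => c n * RtoC (t ^ n)) (Cexp (z * RtoC (l t)) * c 0%nat).
Proof.
  intros Ht H Hs Hl.
  assert (Hr : (0 < r)%R) by (pose proof (Rabs_pos t); lra).
  assert (HE : cser c t = Cexp (z * RtoC (l t)) * c 0%nat).
  { pose proof (ode_exp (fun s => Re (cser c s)) (fun s => Im (cser c s)) l k z t) as HH.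
    rewrite <- (cser_0 c r Hr H).
    rewrite (surjective_pairing (cser c t)), (surjective_pairing (cser c 0)).
    apply HH; auto. intros s Hs'. destruct (Hs s Hs') as [H1 H2].
    assert (Hsr : (Rabs s < r)%R) by lra.
    destruct (cser_derive c r s Hr H Hsr) as [D1 D2].
    split; auto. rewrite H2 in D1, D2. rewrite re_scal_l, re_mult in D1.
    rewrite im_scal_l, im_mult in D2. split; auto.
    replace (Im z * Re (cser c s) + Re z * Im (cser c s))%R with
      (Re z * Im (cser c s) + Im z * Re (cser c s))%R by ring. auto. }
  rewrite <- HE. apply cser_HS with r; auto.
Qed.

Lemma exp_SumLe x : (0 <= x)%R -> SumLe (fun n => x ^ n / INR (fact n))%R (exp x).
Proof.
  intros Hx. apply SumLe_series.
  - intros n. apply Rmult_le_pos; [apply pow_le; auto|].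
    left. apply Rinv_0_lt_compat, INR_fact_lt_0.
  - pose proof (is_exp_Reals x) as H. unfold is_pseries in H.
    eapply is_series_ext; [|apply H]. intros n. simpl.
    rewrite pow_n_pow. unfold scal; simpl. unfold mult; simpl. reflexivity.
Qed.

Lemma Cmod_fact_div z n : Cmod (z / RtoC (INR (fact n))) = (Cmod z / INR (fact n))%R.
Proof.
  rewrite Cmod_div, Cmod_R, Rabs_pos_eq; auto.
  - apply pos_INR.
  - intros H. apply RtoC_inj in H. apply (INR_fact_neq_0 n); auto.
Qed.

Lemma fact_nz n : RtoC (INR (fact n)) <> 0.
Proof. intros H. apply RtoC_inj in H. apply (INR_fact_neq_0 n); auto. Qed.

Lemma INR_S_nz n : RtoC (INR (S n)) <> 0.
Proof. intros H. apply RtoC_inj in H. revert H. apply not_0_INR. lia. Qed.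

Lemma exp_HS z : HS (fun n => z ^ n / RtoC (INR (fact n))) (Cexp z).
Proof.
  set (c := fun n => z ^ n / RtoC (INR (fact n))).
  (* Any radius above 1 serves, since the series is evaluated at t = 1. *)
  assert (Hc : cpart c 2).
  { exists (exp (Cmod z * 2)).
    eapply SumLe_le; [| |apply (exp_SumLe (Cmod z * 2))]; [|lra|].
    - intros n. unfold c. rewrite Cmod_fact_div, Cmod_pow, Rpow_mult_distr. lra.
    - pose proof (Cmod_ge_0 z); lra. }
  pose proof (ode_cser c 2 z (fun s => s) (fun _ => 1%R) 1) as H.
  rewrite Rabs_R1 in H. specialize (H ltac:(lra) Hc).
  assert (HS' : HS (fun n => c n * RtoC (1 ^ n)) (Cexp (z * RtoC 1) * c 0%nat)).
  { apply H; auto. intros s Hs. split; [auto_derive; auto|].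
    unfold cser at 1. apply tsum_HS.
    assert (Hsr : (Rabs s < 2)%R) by lra.
    eapply HS_ext; [|apply HS_scal, HS_scal, (cser_HS c 2 s); auto; lra].
    intros n. unfold cder, c. simpl Cpow. rewrite fact_simpl, mult_INR, RtoC_mult.
    pose proof (fact_nz n). pose proof (INR_S_nz n). field. split; auto. }
  replace (Cexp z) with (Cexp (z * RtoC 1) * c 0%nat).
  - eapply HS_ext; [|apply HS']. intros n. simpl. rewrite pow1. ring.
  - unfold c; simpl. rewrite Cmult_1_r. field.
Qed.

(** The n-th Taylor coefficient of (1 - t)^(-a). *)
Definition bc (a : C) (n : nat) : C := Cpochhammer a n / RtoC (INR (fact n)).

Fixpoint rpoch (x : R) (n : nat) : R :=
  match n with O => 1 | S n' => rpoch x n' * (x + INR n') end%R.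

(** The same coefficient at a real argument; for |a| <= A it majorises [bc a n] ([Cmod_bc]). *)
Definition rb (A : R) (n : nat) : R := (rpoch A n / INR (fact n))%R.

Lemma rpoch_pos A n : (0 < A)%R -> (0 < rpoch A n)%R.
Proof.
  intros HA; induction n; simpl; [lra|]. apply Rmult_lt_0_compat; auto.
  pose proof (pos_INR n); lra.
Qed.

Lemma rb_pos A n : (0 < A)%R -> (0 < rb A n)%R.
Proof.
  intros HA. apply Rdiv_lt_0_compat; [apply rpoch_pos; auto|apply INR_fact_lt_0].
Qed.

Lemma Cmod_bc a A n : (Cmod a <= A)%R -> (Cmod (bc a n) <= rb A n)%R.
Proof.
  intros HA. unfold bc, rb. rewrite Cmod_fact_div.
  apply Rmult_le_compat_r; [left; apply Rinv_0_lt_compat, INR_fact_lt_0|].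
  induction n; simpl; [rewrite Cmod_1; lra|].
  rewrite Cmod_mult. apply Rmult_le_compat; try apply Cmod_ge_0; auto.
  eapply Rle_trans; [apply Cmod_triangle|]. rewrite Cmod_R, Rabs_pos_eq by apply pos_INR. lra.
Qed.

Lemma rb_SumLe A r : (0 < A)%R -> (0 < r < 1)%R ->
  exists N, SumLe (fun n => rb A n * r ^ n)%R N.
Proof.
  intros HA Hr.
  assert (Hp : forall n, (0 < rb A n * r ^ n)%R)
    by (intros n; apply Rmult_lt_0_compat; [apply rb_pos; auto|apply pow_lt; lra]).
  destruct (ex_series_DAlembert (fun n => rb A n * r ^ n)%R r ltac:(lra)) as [s Hs].
  - intros n. specialize (Hp n). lra.
  (* The ratio of consecutive terms is r (A + n) / (n + 1), written so that its limit r is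
     visible. *)
  - apply is_lim_seq_ext with (fun n => r + r * (A - 1) * / INR (S n))%R.
    + intros n. rewrite Rabs_pos_eq by (apply Rlt_le, Rdiv_lt_0_compat; auto).
      unfold rb. simpl rpoch. rewrite fact_simpl, mult_INR. simpl pow.
      pose proof (rpoch_pos A n HA). pose proof (INR_fact_lt_0 n).
      assert (0 < INR (S n))%R by (apply lt_0_INR; lia).
      assert (0 < r ^ n)%R by (apply pow_lt; lra).
      rewrite S_INR in *. field. repeat split; lra.
    + replace (Finite r) with (Finite (r + r * (A - 1) * 0))%R by (f_equal; ring).
      apply is_lim_seq_plus'; [apply is_lim_seq_const|].
      apply is_lim_seq_mult'; [apply is_lim_seq_const|].
      apply (is_lim_seq_incr_1 (fun n => / INR n)%R).
      apply (is_lim_seq_inv INR p_infty is_lim_seq_INR). discriminate.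
  - exists s. eapply SumLe_le; [| |apply (SumLe_series _ _ (fun n => Rabs_pos _) Hs)]; [|lra].
    intros n. apply Rle_abs.
Qed.

Lemma bc_cpart a r : (0 < r < 1)%R -> cpart (bc a) r.
Proof.
  intros Hr. destruct (rb_SumLe (Cmod a + 1) r) as [N HN]; auto.
  { pose proof (Cmod_ge_0 a); lra. }
  exists N. eapply SumLe_le; [| |apply HN]; [|lra]. intros n.
  apply Rmult_le_compat_r; [apply pow_le; lra|]. apply Cmod_bc. lra.
Qed.

Lemma bc_S a n : RtoC (INR (S n)) * bc a (S n) = (a + RtoC (INR n)) * bc a n.
Proof.
  unfold bc. simpl Cpochhammer. rewrite fact_simpl, mult_INR, RtoC_mult.
  pose proof (fact_nz n). pose proof (INR_S_nz n). field. auto.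
Qed.

(** The differential equation (1 - s) g' = a g of (1 - s)^(-a), read off the recursion [bc_S]. *)
Lemma bc_cder a s : (Rabs s < 1)%R ->
  cser (cder (bc a)) s = RtoC (/ (1 - s)) * (a * cser (bc a) s).
Proof.
  (* Two nested radii above |s|: r for the series, the smaller r' for its derivative. *)
  intros Hs. set (r := ((Rabs s + 1) / 2)%R). set (r' := ((Rabs s + r) / 2)%R).
  pose proof (Rabs_pos s).
  assert (Hr : (0 < r < 1)%R) by (unfold r; lra).
  assert (Hr' : (0 < r' < r)%R) by (unfold r', r in *; lra).
  assert (Hb : cpart (bc a) r) by (apply bc_cpart; auto).
  pose proof (cder_part _ _ _ Hr' Hb) as Hd.
  assert (A1 : (Rabs s < r)%R) by (unfold r; lra).
  assert (A2 : (Rabs s < r')%R) by (unfold r', r; lra).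
  pose proof (cser_HS _ _ _ (proj1 Hr) Hb A1) as H1.
  pose proof (cser_HS _ _ _ (proj1 Hr') Hd A2) as H2.
  set (D := cser (cder (bc a)) s) in *. set (G := cser (bc a) s) in *.
  (* s D is the sum of n c_n s^n, so D - s D = a G termwise *)
  assert (H3 : HS (fun n => RtoC (INR n) * bc a n * RtoC (s ^ n)) (RtoC s * D)).
  { apply (HS_inj_ext S).
    - intros; lia.
    - intros [|n] Hn; [simpl; ring|]. exfalso. apply (Hn n); auto.
    - eapply HS_ext; [|apply HS_scal, H2]. intros n. unfold cder.
      rewrite <- tech_pow_Rmult, RtoC_mult. ring. }
  assert (H4 : D - RtoC s * D = a * G).
  { apply (HS_unique _ _ _ (HS_minus _ _ _ _ H2 H3)).
    eapply HS_ext; [|apply HS_scal, H1]. intros n. simpl. unfold cder.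
    rewrite bc_S. ring. }
  assert (Hs1 : (s < 1)%R) by (apply Rabs_def2 in Hs; lra).
  rewrite <- H4. assert (RtoC 1 - RtoC s <> 0).
  { rewrite <- RtoC_minus. intros H0. apply RtoC_inj in H0. lra. }
  rewrite RtoC_inv by lra. rewrite RtoC_minus. field. auto.
Qed.

Lemma bin_HS a t : (Rabs t < 1)%R ->
  HS (fun n => bc a n * RtoC (t ^ n)) (Cexp (- a * RtoC (ln (1 - t)))).
Proof.
  intros Ht.
  pose proof (ode_cser (bc a) ((Rabs t + 1) / 2) a (fun s => - ln (1 - s))%R
    (fun s => / (1 - s))%R t ltac:(lra)
    (bc_cpart a ((Rabs t + 1) / 2) ltac:(pose proof (Rabs_pos t); lra))) as H.
  replace (Cexp (- a * RtoC (ln (1 - t)))) with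
    (Cexp (a * RtoC (- ln (1 - t))) * bc a 0).
  - apply H.
    + intros s Hs. assert (s < 1)%R by (pose proof (Rle_abs s); lra). split.
      * auto_derive; [lra|]. field. lra.
      * apply bc_cder. lra.
    + rewrite Rminus_0_r, ln_1. ring.
  - unfold bc; simpl. rewrite RtoC_opp. replace (1 / 1) with (RtoC 1) by field.
    rewrite Cmult_1_r. f_equal. ring.
Qed.

(** * Complex powers and convergence of the double series *)

(** Powers with a real base, since half-integers occur; at natural numbers this unfolds to
    [nat_cpow]. *)
Definition rc (x : R) (s : C) : C := Cexp (s * RtoC (ln x)).

Lemma Cmod_rc x s : Cmod (rc x s) = Rpower x (Re s).
Proof.
  unfold rc. rewrite Cmod_Cexp, re_scal_r. reflexivity.
Qed.

Lemma rc_plus x s t : rc x (s + t) = rc x s * rc x t.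
Proof. unfold rc. rewrite <- Cexp_add. f_equal. ring. Qed.

Lemma rc_mult x y s : (0 < x)%R -> (0 < y)%R -> rc (x * y) s = rc x s * rc y s.
Proof.
  intros Hx Hy. unfold rc. rewrite ln_mult, RtoC_plus by auto.
  rewrite <- Cexp_add. f_equal. ring.
Qed.

Lemma rc_0 x : rc x 0 = 1.
Proof. unfold rc. rewrite Cmult_0_l. apply Cexp_0. Qed.

Lemma rc_real x (s : R) : rc x (RtoC s) = RtoC (Rpower x s).
Proof.
  unfold rc, Rpower, Cexp. rewrite <- RtoC_mult. rewrite re_RtoC, im_RtoC, cos_0, sin_0.
  unfold RtoC. f_equal; ring.
Qed.

Lemma rc_m1 x : (0 < x)%R -> rc x (- (1)) = / RtoC x.
Proof.
  intros Hx. rewrite <- RtoC_opp, rc_real, Rpower_Ropp, Rpower_1 by auto.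
  apply RtoC_inv. lra.
Qed.

Lemma rc_opp_nat x n : (0 < x)%R -> rc x (- RtoC (INR n)) = RtoC ((/ x) ^ n).
Proof.
  intros Hx. rewrite <- RtoC_opp, rc_real, Rpower_Ropp, Rpower_pow by auto.
  rewrite <- pow_inv. reflexivity.
Qed.

(** The exponential series expands the power of x in powers of d, which enters only through its norm
    D. *)
Lemma W_rc {Q} (X Y Z : Q -> C) r D x s0 (d : Q -> C) : (0 < r)%R ->
  W X Y Z r D d ->
  W X Y Z r (Rpower x (Re s0) * exp (D * Rabs (ln x))) (fun q => rc x (s0 + d q)).
Proof.
  intros Hr Hd. assert (HD := W_ge0 _ _ _ _ _ _ Hd).
  apply W_ext with (fun q => rc x s0 * rc x (d q)); [intros; rewrite rc_plus; auto|].
  rewrite <- Cmod_rc. apply W_scal; auto.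
  assert (HL : (0 <= D * Rabs (ln x))%R) by (apply Rmult_le_pos; [auto|apply Rabs_pos]).
  apply (W_sum _ _ _ _ (fun n q => (RtoC (ln x) ^ n / RtoC (INR (fact n))) * d q ^ n)
    (fun n => (D * Rabs (ln x)) ^ n / INR (fact n))%R); auto.
  - intros n. eapply W_le; [|apply W_scal, W_pow; eauto].
    rewrite Cmod_fact_div, Cmod_pow, Cmod_R, Rpow_mult_distr. right. unfold Rdiv; ring.
  - apply exp_SumLe; auto.
  - intros q _. eapply HS_ext; [|apply exp_HS]. intros n. simpl.
    rewrite Cpow_mult_l. unfold Cdiv. ring.
Qed.

Lemma Rpower_pos x s : (0 < Rpower x s)%R.
Proof. apply exp_pos. Qed.

Lemma exp_ge_lin x : (1 + x <= exp x)%R.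
Proof. apply exp_ineq1_le. Qed.

Lemma ln_le_lin v : (-1 < v)%R -> (ln (1 + v) <= v)%R.
Proof.
  intros H. rewrite <- (ln_exp v) at 2. apply ln_le; [lra|apply exp_ge_lin].
Qed.

Lemma Rpower_INR_split n d : (1 <= n)%nat ->
  Rpower (INR (S n)) (- d) = (Rpower (INR n) (- d) * exp (- d * ln (1 + / INR n)))%R.
Proof.
  intros Hn. assert (0 < INR n)%R by (apply lt_0_INR; lia).
  unfold Rpower. rewrite <- exp_plus. f_equal.
  replace (INR (S n)) with (INR n * (1 + / INR n))%R by (rewrite S_INR; field; lra).
  rewrite ln_mult; [ring|auto|].
  assert (0 < / INR n)%R by (apply Rinv_0_lt_compat; auto). lra.
Qed.

(** The integral test for n^(-(1+d)) in elementary form, from 1 / (n + 1) <= ln (1 + 1/n) <= 1/n. *)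
Lemma zeta_telescope n d : (0 < d)%R -> (1 <= n)%nat ->
  (d * Rpower (INR (S n)) (- (1 + d)) <= Rpower (INR n) (- d) - Rpower (INR (S n)) (- d)
   <= d * Rpower (INR n) (- (1 + d)))%R.
Proof.
  intros Hd Hn. assert (H0 : (0 < INR n)%R) by (apply lt_0_INR; lia).
  assert (H1 : (0 < INR (S n))%R) by (apply lt_0_INR; lia).
  assert (E : forall m, (0 < INR m)%R -> Rpower (INR m) (- (1 + d)) = (/ INR m * Rpower (INR m) (- d))%R).
  { intros m Hm. replace (- (1 + d))%R with (- (1) + - d)%R by ring.
    rewrite Rpower_plus, Rpower_Ropp, Rpower_1 by auto. auto. }
  rewrite !E by auto.
  pose proof (Rpower_pos (INR n) (- d)). pose proof (Rpower_pos (INR (S n)) (- d)).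
  set (P := Rpower (INR n) (- d)) in *. set (P' := Rpower (INR (S n)) (- d)) in *.
  assert (HP : P' = (P * exp (- d * ln (1 + / INR n)))%R) by (apply Rpower_INR_split; auto).
  assert (Hi : (0 < / INR n)%R) by (apply Rinv_0_lt_compat; auto).
  assert (Hi' : (0 < / INR (S n))%R) by (apply Rinv_0_lt_compat; auto).
  split.
  - assert (HP2 : P = (P' * exp (d * ln (1 + / INR n)))%R).
    { rewrite HP, Rmult_assoc, <- exp_plus.
      replace (- d * ln (1 + / INR n) + d * ln (1 + / INR n))%R with 0%R by ring.
      rewrite exp_0; ring. }
    assert (HL : (/ INR (S n) <= ln (1 + / INR n))%R).
    { replace (1 + / INR n)%R with (/ (1 + - / INR (S n)))%R.
      - rewrite ln_Rinv.
        + pose proof (ln_le_lin (- / INR (S n))) as HH.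
          assert (-1 < - / INR (S n))%R; [|specialize (HH ltac:(auto)); lra].
          assert (/ INR (S n) < 1)%R; [|lra].
          rewrite <- Rinv_1. apply Rinv_lt_contravar; rewrite S_INR; nra.
        + assert (/ INR (S n) < 1)%R; [|lra].
          rewrite <- Rinv_1. apply Rinv_lt_contravar; rewrite S_INR; nra.
      - rewrite S_INR in *. field. repeat split; lra. }
    pose proof (exp_ge_lin (d * ln (1 + / INR n))).
    assert (d * / INR (S n) <= d * ln (1 + / INR n))%R by (apply Rmult_le_compat_l; lra).
    assert (P' * (1 + d * / INR (S n)) <= P)%R; [|nra].
    rewrite HP2. apply Rmult_le_compat_l; lra.
  - pose proof (exp_ge_lin (- d * ln (1 + / INR n))).
    pose proof (ln_le_lin (/ INR n) ltac:(lra)).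
    assert (d * ln (1 + / INR n) <= d * / INR n)%R by (apply Rmult_le_compat_l; lra).
    assert (P * (1 - d * / INR n) <= P')%R; [|nra].
    rewrite HP. apply Rmult_le_compat_l; lra.
Qed.

(** The upper inequality gives convergence, the two together the residue 1 of the zeta series. The
    case distinction discards the meaningless power of 0 when N = 0. *)
Lemma zeta_bounds d N : (0 < d)%R ->
  (1 - Rpower (INR (S N)) (- d) <= d * rsum (seq 0 N) (fun n => Rpower (INR (S n)) (- (1 + d)))
   <= d + 1 - Rpower (INR N) (- d) * (if Nat.eq_dec N 0 then 0 else 1))%R.
Proof.
  intros Hd. induction N as [|N IH].
  - simpl. assert (Rpower 1 (- d) = 1%R) as ->
      by (unfold Rpower; rewrite ln_1, Rmult_0_r; apply exp_0). lra.
  - rewrite seq_S, rsum_app, Rmult_plus_distr_l. rewrite Nat.add_0_l.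
    assert (H1 : forall f : nat -> R, rsum (N :: nil) f = f N) by (intros; simpl; ring).
    rewrite H1. clear H1.
    destruct (Nat.eq_dec (S N) 0) as [|_]; [lia|].
    pose proof (zeta_telescope (S N) d Hd ltac:(lia)) as [_ HT].
    destruct (Nat.eq_dec N 0) as [->|Hn].
    + assert (H1 : forall a, Rpower (INR 1) a = 1%R)
        by (intros; simpl; unfold Rpower; rewrite ln_1, Rmult_0_r; apply exp_0).
      simpl rsum in *. rewrite !H1 in *. lra.
    + pose proof (zeta_telescope N d Hd ltac:(lia)) as [HT' _]. lra.
Qed.

Lemma zeta_SumLe d : (0 < d)%R ->
  SumLe (fun n => Rpower (INR (S n)) (- (1 + d))) (1 + / d).
Proof.
  intros Hd. apply SumLe_nat.
  - intros; left; apply Rpower_pos.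
  - intros n. pose proof (zeta_bounds d (S n) Hd) as [_ H].
    destruct Nat.eq_dec as [|_]; [lia|].
    pose proof (Rpower_pos (INR (S n)) (- d)).
    apply Rmult_le_reg_l with d; auto.
    replace (d * (1 + / d))%R with (d + 1)%R by (field; lra). lra.
Qed.

(** The modulus of a term of the double series whose exponents have real parts x, y, z. *)
Definition rt (x y z : R) (p : nat * nat) : R :=
  (Rpower (INR (S (fst p))) (- x) * Rpower (INR (S (snd p))) (- y) *
   Rpower (INR (S (fst p) + S (snd p))) (- z))%R.

Lemma INR_S_ge1 n : (1 <= INR (S n))%R.
Proof. rewrite S_INR. pose proof (pos_INR n); lra. Qed.

Lemma ln_ge0 x : (1 <= x)%R -> (0 <= ln x)%R.
Proof. intros H. rewrite <- ln_1. apply ln_le; lra. Qed.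

Lemma ln_sum_bounds u v : (1 <= v <= u)%R -> (ln u <= ln (u + v) <= ln u + ln 2)%R.
Proof.
  intros H. split; [apply ln_le; lra|].
  rewrite <- ln_mult by lra. apply ln_le; lra.
Qed.

(* In logarithms u >= v of the two variables the exponent is linear in v, so it
   is enough to bound it at v = 0 and v = u. *)
Lemma rt_bound_aux x y z d u v : (0 < d)%R -> (2 * d <= x + z - 1)%R ->
  (2 * d <= x + y + z - 2)%R -> (1 <= v <= u)%R ->
  (- x * ln u + - y * ln v + - z * ln (u + v) <=
   Rabs z * ln 2 + (- (1 + d) * ln u + - (1 + d) * ln v))%R.
Proof.
  intros Hd H1 H2 H.
  pose proof (ln_sum_bounds u v H) as HS.
  assert (Hv : (0 <= ln v)%R) by (apply ln_ge0; lra).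
  assert (Huv : (ln v <= ln u)%R) by (apply ln_le; lra).
  assert (Hl2 : (0 <= ln 2)%R) by (apply ln_ge0; lra).
  assert (Hz : (- z * ln (u + v) <= Rabs z * ln 2 - z * ln u)%R).
  { assert (- z * (ln (u + v) - ln u) <= Rabs z * ln 2)%R; [|lra].
    pose proof (Rle_abs (- z)). rewrite Rabs_Ropp in H0.
    apply Rle_trans with (Rabs z * (ln (u + v) - ln u))%R.
    - apply Rmult_le_compat_r; lra.
    - apply Rmult_le_compat_l; [apply Rabs_pos|lra]. }
  assert (0 <= (x + z - 1 - d) * ln u + (y - 1 - d) * ln v)%R; [|nra].
  destruct (Rle_or_lt 0 (y - 1 - d)).
  - apply Rplus_le_le_0_compat; apply Rmult_le_pos; lra.
  - assert ((y - 1 - d) * ln u <= (y - 1 - d) * ln v)%R by nra.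
    assert (0 <= (x + z - 1 - d + (y - 1 - d)) * ln u)%R by (apply Rmult_le_pos; lra). lra.
Qed.

Lemma rt_bound x y z d p : (0 < d)%R -> (2 * d <= x + z - 1)%R ->
  (2 * d <= y + z - 1)%R -> (2 * d <= x + y + z - 2)%R ->
  (rt x y z p <= exp (Rabs z * ln 2) *
     (Rpower (INR (S (fst p))) (- (1 + d)) * Rpower (INR (S (snd p))) (- (1 + d))))%R.
Proof.
  intros Hd H1 H2 H3. destruct p as [i j]. unfold rt, Rpower; simpl fst; simpl snd.
  rewrite <- !exp_plus. rewrite plus_INR.
  pose proof (INR_S_ge1 i). pose proof (INR_S_ge1 j).
  assert (forall a b, (a <= b -> exp a <= exp b)%R) as He.
  { intros a b [Hab| ->]; [left; apply exp_increasing; auto|lra]. }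
  apply He.
  destruct (Rle_or_lt (INR (S j)) (INR (S i))).
  - apply rt_bound_aux; auto; lra.
  - pose proof (rt_bound_aux y x z d (INR (S j)) (INR (S i)) Hd H2 ltac:(lra) ltac:(lra)).
    rewrite (Rplus_comm (INR (S i)) (INR (S j))). lra.
Qed.

(** The three conditions say that A_0, B_0 and F have positive real part. With d half of the least
    slack, each term is dominated by a product of two convergent zeta terms. *)
Lemma rt_SumLe x y z : (1 < x + z)%R -> (1 < y + z)%R -> (2 < x + y + z)%R ->
  exists M, SumLe (rt x y z) M.
Proof.
  intros H1 H2 H3.
  set (d := (Rmin (x + z - 1) (Rmin (y + z - 1) (x + y + z - 2)) / 2)%R).
  assert (Hm : (0 < Rmin (x + z - 1) (Rmin (y + z - 1) (x + y + z - 2)))%R)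
    by (repeat apply Rmin_pos; lra).
  pose proof (Rmin_l (x + z - 1) (Rmin (y + z - 1) (x + y + z - 2))).
  pose proof (Rmin_r (x + z - 1) (Rmin (y + z - 1) (x + y + z - 2))).
  pose proof (Rmin_l (y + z - 1) (x + y + z - 2)).
  pose proof (Rmin_r (y + z - 1) (x + y + z - 2)).
  assert (Hd : (0 < d)%R) by (unfold d; lra).
  pose proof (SumLe_prod _ _ _ _ (fun i => Rlt_le _ _ (Rpower_pos (INR (S i)) (- (1 + d))))
    (fun i => Rlt_le _ _ (Rpower_pos (INR (S i)) (- (1 + d)))) (zeta_SumLe d Hd) (zeta_SumLe d Hd)) as HP.
  apply (SumLe_scal _ _ (exp (Rabs z * ln 2))) in HP; [|left; apply exp_pos].
  eexists. eapply SumLe_le; [| |apply HP]; [|apply Rle_refl].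
  intros p. apply rt_bound; auto; unfold d in *; lra.
Qed.

(** * Analytic functions off the integer hyperplanes *)

Lemma radius2 a b : (0 < a)%R -> (0 < b)%R -> exists r, (0 < r /\ r <= a /\ r <= b)%R.
Proof.
  intros Ha Hb. exists (Rmin a b).
  split; [apply Rmin_pos; auto|split; [apply Rmin_l|apply Rmin_r]].
Qed.

Lemma radius3 a b c : (0 < a)%R -> (0 < b)%R -> (0 < c)%R ->
  exists r, (0 < r /\ r <= a /\ r <= b /\ r <= c)%R.
Proof.
  intros Ha Hb Hc. destruct (radius2 a b Ha Hb) as [r [Hr [H1 H2]]].
  destruct (radius2 r c Hr Hc) as [t [Ht [H3 H4]]]. exists t. repeat split; lra.
Qed.

Definition Wat (p : C3) (r N : R) (f : C3 -> C) : Prop := W (cx p) (cy p) (cz p) r N f.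

Definition box (p : C3) (r : R) (q : C3) : Prop := inbox (cx p) (cy p) (cz p) r q.

Definition analytic (p : C3) (f : C3 -> C) : Prop :=
  exists r N, (0 < r)%R /\ Wat p r N f.

(* T and its integer translates are analytic at the good points, which are dense. *)
Definition good (u : C3) : Prop :=
  forall n : Z, ca u <> RtoC (IZR n) /\ cb u <> RtoC (IZR n) /\ cc u <> RtoC (IZR n).

(* [f] agrees at the good points near [p] with an analytic function of value [v] at [p]. *)
Definition holv (p : C3) (f : C3 -> C) (v : C) : Prop :=
  exists r N S, (0 < r)%R /\ Wat p r N S /\ S p = v /\
    forall q, box p r q -> good q -> f q = S q.

Definition hol (p : C3) (f : C3 -> C) : Prop := exists v, holv p f v.

Definition add3 (u v : C3) : C3 := (ca u + ca v, cb u + cb v, cc u + cc v).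

Definition vec (x y z : R) : C3 := (RtoC x, RtoC y, RtoC z).

Definition ivec (x y z : Z) : C3 := vec (IZR x) (IZR y) (IZR z).

Lemma C3_eq (u v : C3) : ca u = ca v -> cb u = cb v -> cc u = cc v -> u = v.
Proof. destruct u as [[? ?] ?], v as [[? ?] ?]. unfold ca, cb, cc; simpl. congruence. Qed.

Lemma ca_add3 u v : ca (add3 u v) = ca u + ca v. Proof. reflexivity. Qed.

Lemma cb_add3 u v : cb (add3 u v) = cb u + cb v. Proof. reflexivity. Qed.

Lemma cc_add3 u v : cc (add3 u v) = cc u + cc v. Proof. reflexivity. Qed.

Lemma ca_vec x y z : ca (vec x y z) = RtoC x. Proof. reflexivity. Qed.

Lemma cb_vec x y z : cb (vec x y z) = RtoC y. Proof. reflexivity. Qed.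

Lemma cc_vec x y z : cc (vec x y z) = RtoC z. Proof. reflexivity. Qed.

(** For real z the next integer above z limits the admissible e; otherwise the imaginary part
    already excludes integers. *)
Lemma C_not_int (z : C) : exists d, (0 < d)%R /\
  forall e, (0 < e < d)%R -> forall n : Z, z + RtoC e <> RtoC (IZR n).
Proof.
  destruct (Req_dec (Im z) 0) as [H|H].
  - exists (IZR (up (Re z)) - Re z)%R. pose proof (archimed (Re z)) as [H1 H2].
    split; [lra|]. intros e He n Hn.
    assert (Hr : (Re z + e)%R = IZR n).
    { apply (f_equal Re) in Hn. destruct z; simpl in *. auto. }
    assert (n < up (Re z))%Z by (apply lt_IZR; lra).
    assert (up (Re z) - 1 < n)%Z by (apply lt_IZR; rewrite minus_IZR; lra).
    lia.
  - exists 1%R. split; [lra|]. intros e He n Hn.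
    apply (f_equal Im) in Hn. destruct z; simpl in *. lra.
Qed.

Lemma good_near p : exists d, (0 < d)%R /\
  forall e, (0 < e < d)%R -> good (add3 p (vec e e e)).
Proof.
  destruct (C_not_int (ca p)) as [d1 [H1 G1]].
  destruct (C_not_int (cb p)) as [d2 [H2 G2]].
  destruct (C_not_int (cc p)) as [d3 [H3 G3]].
  destruct (radius3 d1 d2 d3) as [d [Hd [D1 [D2 D3]]]]; auto.
  exists d. split; auto. intros e He n.
  repeat split; [apply G1|apply G2|apply G3]; lra.
Qed.

Lemma box_refl p r : (0 <= r)%R -> box p r p.
Proof.
  intros Hr. unfold box, inbox, cx, cy, cz.
  repeat split; match goal with |- (Cmod (?a - ?a) <= _)%R =>
    replace (a - a) with (RtoC 0) by ring end; rewrite Cmod_0; auto.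
Qed.

Lemma box_vec p r x y z : (Rabs x <= r)%R -> (Rabs y <= r)%R -> (Rabs z <= r)%R ->
  box p r (add3 p (vec x y z)).
Proof.
  intros. unfold box, inbox, cx, cy, cz. rewrite ca_add3, cb_add3, cc_add3, ca_vec, cb_vec, cc_vec.
  repeat split; match goal with |- (Cmod (?a + ?b - ?a) <= _)%R =>
    replace (a + b - a) with b by ring end; rewrite Cmod_R; auto.
Qed.

Lemma box_le p r r' q : (r' <= r)%R -> box p r' q -> box p r q.
Proof. unfold box, inbox. intros H [? [? ?]]. repeat split; lra. Qed.

Lemma Wat_lip p r N f q : (0 < r)%R -> Wat p r N f -> box p r q ->
  (Cmod (f q - f p) <= (Cmod (cx p q) + Cmod (cy p q) + Cmod (cz p q)) * (N / r))%R.
Proof.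
  intros Hr Hf Hq. apply (W_lip (cx p) (cy p) (cz p)); auto; unfold cx, cy, cz; ring.
Qed.

Lemma Wat_shrink p r r' N f : (0 <= r' <= r)%R -> Wat p r N f -> Wat p r' N f.
Proof. apply W_shrink. Qed.

Lemma Wat_minus p r N M f g : (0 < r)%R -> Wat p r N f -> Wat p r M g ->
  exists N', Wat p r N' (fun q => f q - g q).
Proof.
  intros Hr Hf Hg. eexists.
  apply W_ext with (fun q => f q + -(1) * g q); [intros; ring|].
  apply W_plus; [lra|apply Hf|]. apply W_scal; eauto.
Qed.

(** Continuity at p along a ray. The direction is free because the exceptional sets differ: (1,1,1)
    leaves all integer hyperplanes at once, a coordinate direction stays on chosen ones. *)
Lemma analytic_eq_dir p x y z f g : analytic p f -> analytic p g ->
  (exists d, (0 < d)%R /\ forall e, (0 < e < d)%R ->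
     f (add3 p (vec (e * x) (e * y) (e * z))) = g (add3 p (vec (e * x) (e * y) (e * z)))) ->
  f p = g p.
Proof.
  intros [r1 [N1 [Hr1 H1]]] [r2 [N2 [Hr2 H2]]] [d [Hd Hg]].
  destruct (radius2 r1 r2 Hr1 Hr2) as [r [Hr [Hra Hrb]]].
  apply (Wat_shrink p r1 r) in H1; [|lra]. apply (Wat_shrink p r2 r) in H2; [|lra].
  destruct (Wat_minus p r N1 N2 f g Hr H1 H2) as [N HN].
  set (m := (Rabs x + Rabs y + Rabs z + 1)%R).
  pose proof (Rabs_pos x) as Px. pose proof (Rabs_pos y) as Py. pose proof (Rabs_pos z) as Pz.
  assert (Hm : (0 < m)%R) by (unfold m; lra).
  apply Ceq_minus, Cmod_eq_0. apply small_zero with (m * (N / r))%R; [apply Cmod_ge_0|].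
  intros e He.
  destruct (radius3 e (d / 2) (r / m)) as [t [Ht [Ht1 [Ht2 Ht3]]]]; try lra.
  { apply Rdiv_lt_0_compat; auto. }
  assert (Htm : (t * m <= r)%R).
  { apply Rle_trans with (r / m * m)%R; [apply Rmult_le_compat_r; lra|].
    right; field; lra. }
  assert (Ha : forall w, Rabs (t * w) = (t * Rabs w)%R)
    by (intros; rewrite Rabs_mult, (Rabs_pos_eq t); lra).
  set (q := add3 p (vec (t * x) (t * y) (t * z))).
  assert (Hb : box p r q).
  { apply box_vec; rewrite Ha; eapply Rle_trans; try apply Htm;
      apply Rmult_le_compat_l; unfold m; lra. }
  pose proof (Wat_lip p r N _ q Hr HN Hb) as HL. simpl in HL.
  assert (Hgq : f q = g q) by (apply Hg; lra). rewrite Hgq in HL.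
  replace (g q - g q - (f p - g p)) with (- (f p - g p)) in HL by ring.
  rewrite Cmod_opp in HL. eapply Rle_trans; [apply HL|].
  unfold cx, cy, cz, q. rewrite ca_add3, cb_add3, cc_add3, ca_vec, cb_vec, cc_vec.
  repeat match goal with |- context [?a + ?b - ?a] => replace (a + b - a) with b by ring end.
  rewrite !Cmod_R, !Ha.
  assert (0 <= N / r)%R.
  { apply Rmult_le_pos; [apply W_ge0 in HN; auto|left; apply Rinv_0_lt_compat; auto]. }
  replace (e * (m * (N / r)))%R with (e * m * (N / r))%R by ring.
  apply Rmult_le_compat_r; auto. unfold m. nra.
Qed.

(* The good points are dense along the direction (1,1,1). *)
Lemma analytic_eq_at p f g : analytic p f -> analytic p g ->
  (exists r, (0 < r)%R /\ forall q, box p r q -> good q -> f q = g q) -> f p = g p.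
Proof.
  intros Hf Hg [r [Hr H]]. apply (analytic_eq_dir p 1 1 1); auto.
  destruct (good_near p) as [d [Hd Hgd]].
  destruct (radius2 d r Hd Hr) as [t [Ht [T1 T2]]].
  exists t. split; auto. intros e He. rewrite Rmult_1_r.
  apply H; [|apply Hgd; lra]. apply box_vec; rewrite Rabs_pos_eq; lra.
Qed.

(** An old coordinate is a new one plus a constant of modulus at most m, so on radius r - m its norm
    is at most r and [W_subst] applies. *)
Lemma Wat_recenter p r N f q : Wat p r N f ->
  (Cmod (cx p q) < r)%R -> (Cmod (cy p q) < r)%R -> (Cmod (cz p q) < r)%R ->
  exists r', (0 < r')%R /\ Wat q r' N f /\ forall q', box q r' q' -> box p r q'.
Proof.
  intros Hf Hx Hy Hz.
  set (m := Rmax (Cmod (cx p q)) (Rmax (Cmod (cy p q)) (Cmod (cz p q)))).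
  pose proof (Rmax_l (Cmod (cx p q)) (Rmax (Cmod (cy p q)) (Cmod (cz p q)))) as M1.
  pose proof (Rmax_r (Cmod (cx p q)) (Rmax (Cmod (cy p q)) (Cmod (cz p q)))) as M2.
  pose proof (Rmax_l (Cmod (cy p q)) (Cmod (cz p q))) as M3.
  pose proof (Rmax_r (Cmod (cy p q)) (Cmod (cz p q))) as M4.
  fold m in M1, M2.
  assert (Hm : (m < r)%R) by (unfold m; repeat apply Rmax_lub_lt; auto).
  assert (Hr' : (0 < r - m)%R) by lra.
  assert (A : W (cx q) (cy q) (cz q) (r - m) r (cx p) /\
    W (cx q) (cy q) (cz q) (r - m) r (cy p) /\ W (cx q) (cy q) (cz q) (r - m) r (cz p)).
  { repeat split.
    - apply W_ext with (fun q' => cx q q' + cx p q); [intros; unfold cx; ring|].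
      eapply W_le; [|apply W_plus; [lra|apply W_x; lra|apply W_const; lra]]. lra.
    - apply W_ext with (fun q' => cy q q' + cy p q); [intros; unfold cy; ring|].
      eapply W_le; [|apply W_plus; [lra|apply W_y; lra|apply W_const; lra]]. lra.
    - apply W_ext with (fun q' => cz q q' + cz p q); [intros; unfold cz; ring|].
      eapply W_le; [|apply W_plus; [lra|apply W_z; lra|apply W_const; lra]]. lra. }
  destruct A as [A1 [A2 A3]].
  exists (r - m)%R. split; auto. split.
  - apply (W_subst (cx p) (cy p) (cz p) _ _ _ r); auto.
  - intros q' Hq'. apply (W_inbox _ _ _ (cx q) (cy q) (cz q) r (r - m)); auto.
Qed.

(** Good points accumulate at p, so the extended value does not depend on the value of f at p
    itself. *)
Lemma holv_unique p f v w : holv p f v -> holv p f w -> v = w.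
Proof.
  intros [r [N [S [Hr [HS [Hv H]]]]]] [r' [N' [S' [Hr' [HS' [Hv' H']]]]]].
  rewrite <- Hv, <- Hv'. apply analytic_eq_at; [exists r, N; auto|exists r', N'; auto|].
  destruct (radius2 r r' Hr Hr') as [t [Ht [T1 T2]]].
  exists t. split; auto. intros q Hq Hg.
  rewrite <- H, <- H'; auto; eapply box_le; eauto.
Qed.

(** A single S gives the extended value at every nearby point, so identities between extensions can
    be checked point by point. *)
Lemma holv_germ p f v : holv p f v -> exists r S, (0 < r)%R /\ analytic p S /\ S p = v /\
  forall q, box p r q -> analytic q S /\ holv q f (S q).
Proof.
  intros [r [N [S [Hr [HS [Hv H]]]]]]. exists (r / 2)%R, S.
  split; [lra|]. split; [exists r, N; auto|]. split; auto.
  intros q [B1 [B2 B3]].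
  destruct (Wat_recenter p r N S q HS) as [r' [Hr' [HS' HB]]]; try lra.
  split; [exists r', N; auto|]. exists r', N, S. repeat split; auto.
Qed.

Lemma holv_ext p f g v : holv p f v ->
  (exists r, (0 < r)%R /\ forall q, box p r q -> good q -> f q = g q) -> holv p g v.
Proof.
  intros [r [N [S [Hr [HS [Hv H]]]]]] [r' [Hr' H']].
  destruct (radius2 r r' Hr Hr') as [t [Ht [T1 T2]]].
  exists t, N, S. split; auto. split; [apply (Wat_shrink p r); auto; lra|].
  split; auto. intros q Hq Hg.
  rewrite <- H' by (auto; eapply box_le; eauto). apply H; auto. eapply box_le; eauto.
Qed.

Lemma holv_ext_good p f g v : (forall q, good q -> f q = g q) -> holv p f v -> holv p g v.
Proof. intros H Hf. apply (holv_ext p f); auto. exists 1%R. split; [lra|auto]. Qed.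

Lemma analytic_holv p f : analytic p f -> holv p f (f p).
Proof. intros [r [N [Hr H]]]. exists r, N, f. auto. Qed.

Lemma holv_plus p f g v w : holv p f v -> holv p g w -> holv p (fun q => f q + g q) (v + w).
Proof.
  intros [r [N [S [Hr [HS [Hv H]]]]]] [r' [N' [S' [Hr' [HS' [Hv' H']]]]]].
  destruct (radius2 r r' Hr Hr') as [t [Ht [T1 T2]]].
  exists t, (N + N')%R, (fun q => S q + S' q). split; auto.
  split; [apply W_plus; [lra| |]; eapply W_shrink; eauto; lra|].
  split; [congruence|]. intros q Hq Hg.
  rewrite H, H'; auto; eapply box_le; eauto.
Qed.

Lemma holv_mult p f g v w : holv p f v -> holv p g w -> holv p (fun q => f q * g q) (v * w).
Proof.
  intros [r [N [S [Hr [HS [Hv H]]]]]] [r' [N' [S' [Hr' [HS' [Hv' H']]]]]].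
  destruct (radius2 r r' Hr Hr') as [t [Ht [T1 T2]]].
  exists t, (N * N')%R, (fun q => S q * S' q). split; auto.
  split; [apply W_mult; [lra| |]; eapply W_shrink; eauto; lra|].
  split; [congruence|]. intros q Hq Hg.
  rewrite H, H'; auto; eapply box_le; eauto.
Qed.

Lemma analytic_const p c : analytic p (fun _ => c).
Proof. exists 1%R, (Cmod c). split; [lra|]. apply W_const; lra. Qed.

Lemma analytic_plus p f g : analytic p f -> analytic p g -> analytic p (fun q => f q + g q).
Proof.
  intros [r [N [Hr H]]] [r' [N' [Hr' H']]].
  destruct (radius2 r r' Hr Hr') as [t [Ht [T1 T2]]].
  exists t, (N + N')%R. split; auto. apply W_plus; [lra| |]; eapply W_shrink; eauto; lra.
Qed.

Lemma analytic_mult p f g : analytic p f -> analytic p g -> analytic p (fun q => f q * g q).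
Proof.
  intros [r [N [Hr H]]] [r' [N' [Hr' H']]].
  destruct (radius2 r r' Hr Hr') as [t [Ht [T1 T2]]].
  exists t, (N * N')%R. split; auto. apply W_mult; [lra| |]; eapply W_shrink; eauto; lra.
Qed.

Lemma analytic_ext p f g : (forall q, f q = g q) -> analytic p f -> analytic p g.
Proof.
  intros H [r [N [Hr Hf]]]. exists r, N. split; auto. apply W_ext with f; auto.
Qed.

Lemma analytic_opp p f : analytic p f -> analytic p (fun q => - f q).
Proof.
  intros H. apply analytic_ext with (fun q => -(1) * f q); [intros; ring|].
  apply analytic_mult; auto. apply analytic_const.
Qed.

Lemma analytic_minus p f g : analytic p f -> analytic p g -> analytic p (fun q => f q - g q).
Proof. intros. apply analytic_plus; auto. apply analytic_opp; auto. Qed.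

Lemma analytic_ca p : analytic p ca.
Proof.
  apply analytic_ext with (fun q => cx p q + ca p); [intros; unfold cx; ring|].
  apply analytic_plus; [|apply analytic_const]. exists 1%R, 1%R. split; [lra|apply W_x; lra].
Qed.

Lemma analytic_cb p : analytic p cb.
Proof.
  apply analytic_ext with (fun q => cy p q + cb p); [intros; unfold cy; ring|].
  apply analytic_plus; [|apply analytic_const]. exists 1%R, 1%R. split; [lra|apply W_y; lra].
Qed.

Lemma analytic_cc p : analytic p cc.
Proof.
  apply analytic_ext with (fun q => cz p q + cc p); [intros; unfold cz; ring|].
  apply analytic_plus; [|apply analytic_const]. exists 1%R, 1%R. split; [lra|apply W_z; lra].
Qed.

Lemma holv_csum {I} p (L : list I) (f : I -> C3 -> C) (v : I -> C) :
  (forall i, In i L -> holv p (f i) (v i)) -> holv p (fun q => csum L (fun i => f i q)) (csum L v).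
Proof.
  induction L as [|i L IH]; simpl; intros H; [apply (analytic_holv p (fun _ => 0)), analytic_const|].
  apply holv_plus; auto.
Qed.

Lemma hol_csum {I} p (L : list I) (f : I -> C3 -> C) :
  (forall i, In i L -> hol p (f i)) -> hol p (fun q => csum L (fun i => f i q)).
Proof.
  induction L as [|i L IH]; simpl; intros H.
  - eexists; apply (analytic_holv p (fun _ => 0)), analytic_const.
  - destruct (H i) as [v Hv]; auto. destruct IH as [w Hw]; auto.
    eexists; apply holv_plus; eauto.
Qed.

Lemma hol_mult p f g : hol p f -> hol p g -> hol p (fun q => f q * g q).
Proof. intros [v Hv] [w Hw]. eexists; apply holv_mult; eauto. Qed.

Lemma hol_plus p f g : hol p f -> hol p g -> hol p (fun q => f q + g q).
Proof. intros [v Hv] [w Hw]. eexists; apply holv_plus; eauto. Qed.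

Lemma hol_ext_good p f g : (forall q, good q -> f q = g q) -> hol p f -> hol p g.
Proof. intros H [v Hv]. exists v. eapply holv_ext_good; eauto. Qed.

Lemma analytic_hol p f : analytic p f -> hol p f.
Proof. intros H. eexists. apply analytic_holv; eauto. Qed.

Lemma half_SumLe : SumLe (fun n => (/ 2) ^ n)%R 2.
Proof.
  apply SumLe_series; [intros n; apply pow_le; lra|].
  pose proof (is_series_geom (/ 2) ltac:(rewrite Rabs_pos_eq; lra)) as H.
  replace (/ (1 - / 2))%R with 2%R in H by field. exact H.
Qed.

Lemma geom_HS g : (Cmod g <= / 2)%R -> HS (fun n => g ^ n) (/ (1 - g)).
Proof.
  intros Hg.
  assert (H : SumLe (fun n => Cmod (g ^ n)) 2).
  { eapply SumLe_le; [| |apply half_SumLe]; [|lra].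
    intros n. rewrite Cmod_pow. apply pow_incr. split; [apply Cmod_ge_0|auto]. }
  destruct (SumLe_HS _ _ H) as [s Hs].
  assert (Hs1 : HS (fun n => g ^ n - ind (fun n => n = O) (fun _ => 1) n) (g * s)).
  { apply (HS_inj_ext S); [intros; lia| |].
    - intros [|n] Hn; [|exfalso; apply (Hn n); auto].
      unfold ind. destruct excluded_middle_informative; [simpl; ring|congruence].
    - eapply HS_ext; [|apply HS_scal, Hs]. intros n. unfold ind.
      destruct excluded_middle_informative; [congruence|]. simpl. ring. }
  assert (E : s - 1 = g * s).
  { apply (HS_unique _ _ _ (HS_minus _ _ _ _ Hs (HS_single O 1)) Hs1). }
  assert (Hn : 1 - g <> 0).
  { intros H0. assert (g = 1) by (replace g with (1 - (1 - g)) by ring; rewrite H0; ring).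
    subst. rewrite Cmod_1 in Hg. lra. }
  replace (/ (1 - g)) with s; auto.
  assert (s * (1 - g) = 1) by (replace (s * (1 - g)) with (s - g * s) by ring; rewrite <- E; ring).
  replace s with (s * (1 - g) * / (1 - g)) by (field; auto). rewrite H0. ring.
Qed.

(** Here g is a coordinate centred at p, whose norm on radius r is r. On radius |c| / 2 the quotient
    g / c has norm 1/2, and the inverse is a geometric series. *)
Lemma analytic_inv p (c : C) (g : C3 -> C) : c <> 0 -> (forall r, (0 < r)%R -> Wat p r r g) ->
  analytic p (fun q => / (c + g q)).
Proof.
  intros Hc Hg. assert (Hc' : (0 < Cmod c)%R) by (apply Cmod_gt_0; auto).
  set (r := (Cmod c / 2)%R). assert (Hr : (0 < r)%R) by (unfold r; lra).
  assert (Hh : Wat p r (/ 2) (fun q => - (/ c) * g q)).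
  { eapply W_le; [|apply W_scal; auto; apply Hg; auto].
    rewrite Cmod_opp, Cmod_inv by auto. unfold r. right. field. lra. }
  exists r, (Cmod (/ c) * 2)%R. split; auto.
  apply W_ext with (fun q => / c * / (1 - - (/ c) * g q)).
  { intros q Hq. assert (Hn : c + g q <> 0).
    { intros H. pose proof (W_bound _ _ _ _ _ _ q Hh Hq) as Hb. cbv beta in Hb.
      replace (g q) with (c + g q - c) in Hb by ring. rewrite H in Hb.
      replace (- / c * (0 - c)) with (RtoC 1) in Hb by (field; auto).
      rewrite Cmod_1 in Hb. lra. }
    field. split; auto. }
  apply W_scal; auto.
  apply (W_sum _ _ _ _ (fun n q => (- (/ c) * g q) ^ n) (fun n => (/ 2) ^ n)%R); auto.
  - intros n. apply (W_pow _ _ _ _ _ _ n Hr Hh).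
  - apply half_SumLe.
  - intros q Hq. apply geom_HS. apply (W_bound _ _ _ _ _ _ q Hh Hq).
Qed.

Lemma analytic_inv_ca p : ca p <> 0 -> analytic p (fun q => / ca q).
Proof.
  intros H. apply analytic_ext with (fun q => / (ca p + cx p q)).
  - intros q. f_equal. unfold cx. ring.
  - apply analytic_inv; auto. intros; apply W_x; auto.
Qed.

Lemma analytic_inv_cy u p : cy u p <> 0 -> analytic p (fun q => / cy u q).
Proof.
  intros H. apply analytic_ext with (fun q => / (cy u p + cy p q)).
  - intros q. f_equal. unfold cy. ring.
  - apply analytic_inv; auto. intros; apply W_y; auto.
Qed.

Lemma W_comp {Q Q'} (pi : Q' -> Q) (x y z : Q -> C) (x' y' z' : Q' -> C) r N f :
  (forall q, x (pi q) = x' q) -> (forall q, y (pi q) = y' q) -> (forall q, z (pi q) = z' q) ->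
  W x y z r N f -> W x' y' z' r N (fun q => f (pi q)).
Proof.
  intros Hx Hy Hz [k [H1 H2]]. exists k. split; auto. intros q Hq.
  rewrite <- Hx, <- Hy, <- Hz. apply H2. unfold inbox in *. rewrite Hx, Hy, Hz. auto.
Qed.

(** * Integer translations and transpositions of the coordinates *)

Lemma int_shift_ne (z : C) (m : Z) :
  (forall n : Z, z <> RtoC (IZR n)) -> forall n : Z, z + RtoC (IZR m) <> RtoC (IZR n).
Proof.
  intros H n Hn. apply (H (n - m)%Z). rewrite minus_IZR, RtoC_minus, <- Hn. ring.
Qed.

Lemma good_shift u x y z : good u -> good (add3 u (ivec x y z)).
Proof.
  intros H n. unfold ivec. rewrite ca_add3, cb_add3, cc_add3, ca_vec, cb_vec, cc_vec.
  repeat split; apply int_shift_ne; intros m; apply (H m).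
Qed.

Lemma analytic_shift p f v : analytic (add3 p v) f -> analytic p (fun u => f (add3 u v)).
Proof.
  intros [r [N [Hr Hf]]]. exists r, N. split; auto.
  apply (W_comp (fun u => add3 u v) (cx (add3 p v)) (cy (add3 p v)) (cz (add3 p v))); auto;
    intros; unfold cx, cy, cz; rewrite ?ca_add3, ?cb_add3, ?cc_add3; ring.
Qed.

Lemma holv_shift p f x y z w : holv (add3 p (ivec x y z)) f w ->
  holv p (fun u => f (add3 u (ivec x y z))) w.
Proof.
  intros [r [N [S [Hr [HS [Hv H]]]]]].
  exists r, N, (fun u => S (add3 u (ivec x y z))). split; auto. split.
  - set (v := ivec x y z) in *.
    apply (W_comp (fun u => add3 u v) (cx (add3 p v)) (cy (add3 p v)) (cz (add3 p v))); auto;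
    intros; unfold cx, cy, cz; rewrite ?ca_add3, ?cb_add3, ?cc_add3; ring.
  - split; auto. intros q Hq Hg. apply H; [|apply good_shift; auto].
    unfold box, inbox, cx, cy, cz in *. rewrite ?ca_add3, ?cb_add3, ?cc_add3.
    destruct Hq as [? [? ?]]. repeat split;
    match goal with |- (Cmod (?a + ?b - (?c + ?b)) <= _)%R =>
      replace (a + b - (c + b)) with (a - c) by ring end; auto.
Qed.

Lemma hol_shift p f x y z : hol (add3 p (ivec x y z)) f ->
  hol p (fun u => f (add3 u (ivec x y z))).
Proof. intros [w H]. exists w. apply holv_shift; auto. Qed.

Definition swap (u : C3) : C3 := (cb u, ca u, cc u).

(** Unlike [swap], this and [sw13] do not express the symmetry of T in m and n; they transport
    [div_z] to the other two coordinates. *)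
Definition sw23 (u : C3) : C3 := (ca u, cc u, cb u).

Definition sw13 (u : C3) : C3 := (cc u, cb u, ca u).

Definition transposition (s : C3 -> C3) : Prop := s = swap \/ s = sw23 \/ s = sw13.

Lemma transposition_inv s q : transposition s -> s (s q) = q.
Proof. intros [->|[->| ->]]; destruct q as [[? ?] ?]; reflexivity. Qed.

Lemma good_perm s u : transposition s -> good u -> good (s u).
Proof. intros [->|[->| ->]] H n; destruct (H n) as [? [? ?]]; repeat split; auto. Qed.

Lemma good_swap u : good u -> good (swap u).
Proof. apply good_perm. left; auto. Qed.

Lemma box_perm s p r q : transposition s -> box p r q -> box (s p) r (s q).
Proof. intros [->|[->| ->]]; unfold box, inbox; tauto. Qed.

Lemma Wat_perm s p r N f : transposition s -> (0 < r)%R -> Wat (s p) r N f ->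
  Wat p r N (fun u => f (s u)).
Proof.
  intros Hs Hr H.
  apply (W_perm (fun q => cx (s p) (s q)) (fun q => cy (s p) (s q)) (fun q => cz (s p) (s q)));
    auto; [| | |apply (W_comp s (cx (s p)) (cy (s p)) (cz (s p))); auto];
    destruct Hs as [->|[->| ->]]; auto.
Qed.

Lemma analytic_perm s p f : transposition s -> analytic (s p) f -> analytic p (fun u => f (s u)).
Proof. intros Hs [r [N [Hr H]]]. exists r, N. split; auto. apply Wat_perm; auto. Qed.

Lemma holv_perm s p f w : transposition s -> holv (s p) f w -> holv p (fun u => f (s u)) w.
Proof.
  intros Hs [r [N [S [Hr [HS [Hv H]]]]]].
  exists r, N, (fun u => S (s u)). split; auto. split; [apply Wat_perm; auto|split; auto].
  intros q Hq Hg. apply H; [apply box_perm|apply good_perm]; auto.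
Qed.

Lemma hol_perm s p f : transposition s -> hol (s p) f -> hol p (fun u => f (s u)).
Proof. intros Hs [w H]. exists w. apply holv_perm; auto. Qed.

Lemma hol_swap p f : hol (swap p) f -> hol p (fun u => f (swap u)).
Proof. apply hol_perm. left; auto. Qed.

(** * The identity theorem along segments *)

Lemma line_identity (g : R -> C) d : (0 < d <= 1)%R ->
  (forall t, (0 <= t <= d)%R -> g t = 0) ->
  (forall t, (0 <= t <= 1)%R -> exists r N S, (0 < r)%R /\
     W (fun _ => 0) (fun _ => 0) (fun s => RtoC (s - t)) r N S /\
     forall s, (0 <= s <= 1)%R -> (Rabs (s - t) <= r)%R -> g s = S s) ->
  g 1%R = 0.
Proof.
  intros Hd Hg HW.
  set (E := fun t => (0 <= t <= 1)%R /\ forall s, (0 <= s <= t)%R -> g s = 0).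
  destruct (completeness E) as [t [Hub Hl]].
  { exists 1%R. intros x [Hx _]. lra. }
  { exists 0%R. split; [lra|]. intros s Hs. apply Hg. lra. }
  assert (Hdt : (d <= t)%R) by (apply Hub; split; [lra|auto]).
  assert (Ht1 : (t <= 1)%R) by (apply Hl; intros x [Hx _]; lra).
  assert (Hlt : forall s, (0 <= s < t)%R -> g s = 0).
  { intros s Hs. apply NNPP; intros Hn.
    assert (t <= s)%R; [|lra]. apply Hl. intros x [Hx Hx'].
    apply Rnot_lt_le. intros Hsx. apply Hn, Hx'. lra. }
  (* At the supremum t of the vanishing initial segments, g is a power series in s - t whose zeros
     accumulate at t from the left; it therefore vanishes beyond t as well. *)
  destruct (HW t ltac:(lra)) as [r [N [S [Hr [HS HgS]]]]].
  assert (HS0 : forall s, (Rabs (s - t) < r)%R -> S s = 0).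
  { intros s Hs.
    apply (W_identity (fun s => RtoC (s - t)) r N S
      (fun s => (0 <= s < t)%R /\ (Rabs (s - t) <= r)%R)); auto.
    - intros q [Hq Hq']. rewrite <- HgS; auto; lra.
    - intros e He. set (h := (Rmin (e / 2) (Rmin (t / 2) r))%R).
      assert (Hh : (0 < h)%R) by (unfold h; repeat apply Rmin_pos; lra).
      assert (H1 : (h <= e / 2)%R) by (unfold h; apply Rmin_l).
      assert (H2 : (h <= t / 2)%R) by (unfold h; eapply Rle_trans; [apply Rmin_r|apply Rmin_l]).
      assert (H3 : (h <= r)%R) by (unfold h; eapply Rle_trans; [apply Rmin_r|apply Rmin_r]).
      exists (t - h)%R. rewrite Cmod_R. replace (t - h - t)%R with (- h)%R by ring.
      rewrite Rabs_Ropp, Rabs_pos_eq by lra. repeat split; lra.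
    - rewrite Cmod_R; auto. }
  assert (Hz : forall s, (0 <= s <= 1)%R -> (s < t + r)%R -> g s = 0).
  { intros s Hs Hs'. destruct (Rlt_or_le s t) as [H|H]; [apply Hlt; lra|].
    rewrite HgS; auto; [apply HS0|]; rewrite Rabs_pos_eq; lra. }
  destruct (Rle_or_lt 1 t) as [H|H]; [apply Hz; lra|].
  assert (Hm : E (Rmin 1 (t + r / 2))).
  { pose proof (Rmin_l 1 (t + r / 2)). pose proof (Rmin_r 1 (t + r / 2)).
    split; [split; [apply Rmin_glb; lra|lra]|]. intros s Hs. apply Hz; lra. }
  apply Hub in Hm.
  assert (t < Rmin 1 (t + r / 2))%R by (apply Rmin_glb_lt; lra). lra.
Qed.

Definition lerp (z w : C) (t : R) : C := z + RtoC t * (w - z).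

Lemma lerp_lerp z w t s : lerp z w s - lerp z w t = (w - z) * RtoC (s - t).
Proof. unfold lerp. rewrite RtoC_minus. ring. Qed.

Lemma Re_lerp z w t : Re (lerp z w t) = ((1 - t) * Re z + t * Re w)%R.
Proof. unfold lerp. destruct z, w. unfold Re; simpl. ring. Qed.

Lemma Im_lerp z w t : Im (lerp z w t) = ((1 - t) * Im z + t * Im w)%R.
Proof. unfold lerp. destruct z, w. unfold Im; simpl. ring. Qed.

(** Start of the segment to w: the imaginary part has modulus 1 and lies on the side of w, so along
    the segment it can vanish only at the end. *)
Definition base (L : R) (w : C) : C := (L, if Rle_dec 0 (Im w) then 1%R else (-1)%R).

Lemma lerp_not_int L w t : (0 <= t <= 1)%R -> (forall n : Z, w <> RtoC (IZR n)) ->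
  forall n : Z, lerp (base L w) w t <> RtoC (IZR n).
Proof.
  intros Ht Hw n Hn.
  destruct (Req_dec t 1) as [->|Ht1].
  - apply (Hw n). rewrite <- Hn. unfold lerp. ring.
  - apply (f_equal Im) in Hn. rewrite Im_lerp, im_RtoC in Hn.
    unfold base in Hn. simpl in Hn. destruct (Rle_dec 0 (Im w)); nra.
Qed.

(* Along the segment from [base] the imaginary parts do not change sign, so it
   avoids all the hyperplanes on which a coordinate is an integer. *)
Lemma identity (f : C3 -> C) (x y z M : R) :
  (forall q, (x < Re (ca q))%R -> (y < Re (cb q))%R -> (z < Re (cc q))%R -> good q -> hol q f) ->
  (forall q, (M < Re (ca q))%R -> (M < Re (cb q))%R -> (M < Re (cc q))%R -> good q -> f q = 0) ->
  forall q, (x < Re (ca q))%R -> (y < Re (cb q))%R -> (z < Re (cc q))%R -> good q -> f q = 0.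
Proof.
  intros Hhol HM q Hx Hy Hz Hq.
  set (L := (Rmax (Rmax x y) (Rmax z M) + 1)%R).
  assert (HL : (x < L /\ y < L /\ z < L /\ M + 1 <= L)%R).
  { pose proof (Rmax_l (Rmax x y) (Rmax z M)). pose proof (Rmax_r (Rmax x y) (Rmax z M)).
    pose proof (Rmax_l x y). pose proof (Rmax_r x y).
    pose proof (Rmax_l z M). pose proof (Rmax_r z M). unfold L. repeat split; lra. }
  destruct HL as [HLx [HLy [HLz HLM]]].
  set (ga := fun t => (lerp (base L (ca q)) (ca q) t, lerp (base L (cb q)) (cb q) t,
                       lerp (base L (cc q)) (cc q) t) : C3).
  assert (Hga : forall t, (0 <= t <= 1)%R -> good (ga t)).
  { intros t Ht n. repeat split; apply lerp_not_int; auto; intros m; apply (Hq m). }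
  assert (Hconv : forall (w : C) (b t : R), (0 <= t <= 1)%R -> (b < L)%R -> (b < Re w)%R ->
    (b < Re (lerp (base L w) w t))%R).
  { intros w b t Ht Hb Hw. rewrite Re_lerp. change (Re (base L w)) with L.
    destruct (Rle_or_lt t (/ 2)).
    - pose proof (Rmult_lt_0_compat (1 - t) (L - b) ltac:(lra) ltac:(lra)).
      pose proof (Rmult_le_pos t (Re w - b) ltac:(lra) ltac:(lra)). lra.
    - pose proof (Rmult_le_pos (1 - t) (L - b) ltac:(lra) ltac:(lra)).
      pose proof (Rmult_lt_0_compat t (Re w - b) ltac:(lra) ltac:(lra)). lra. }
  replace (f q) with (f (ga 1%R)).
  2:{ f_equal. apply C3_eq; unfold ga, ca, cb, cc, lerp; simpl; ring. }
  (* For t <= 1 / m each real part moves by less than 1 from L >= M + 1, so this first piece lies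
     where f is known to vanish. *)
  set (m := (Rabs (Re (ca q) - L) + Rabs (Re (cb q) - L) + Rabs (Re (cc q) - L) + 2)%R).
  assert (Hm : (2 <= m)%R) by (unfold m; pose proof (Rabs_pos (Re (ca q) - L));
    pose proof (Rabs_pos (Re (cb q) - L)); pose proof (Rabs_pos (Re (cc q) - L)); lra).
  assert (Him : (0 < / m <= 1)%R).
  { split; [apply Rinv_0_lt_compat; lra|]. rewrite <- Rinv_1. apply Rinv_le_contravar; lra. }
  apply (line_identity (fun t => f (ga t)) (/ m)); auto.
  - intros t Ht.
    assert (Hb : forall w, (Rabs (Re w - L) + 2 <= m)%R -> (M < Re (lerp (base L w) w t))%R).
    { intros w Hw. rewrite Re_lerp. change (Re (base L w)) with L.
      assert (Rabs (t * (Re w - L)) < 1)%R.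
      { rewrite Rabs_mult, (Rabs_pos_eq t) by lra. pose proof (Rabs_pos (Re w - L)).
        apply Rle_lt_trans with (/ m * Rabs (Re w - L))%R; [apply Rmult_le_compat_r; lra|].
        apply Rmult_lt_reg_l with m; [lra|]. rewrite <- Rmult_assoc, Rinv_r; lra. }
      apply Rabs_def2 in H. lra. }
    pose proof (Rabs_pos (Re (ca q) - L)); pose proof (Rabs_pos (Re (cb q) - L));
      pose proof (Rabs_pos (Re (cc q) - L)).
    apply HM; try (apply Hb; unfold m; lra). apply Hga; lra.
  - intros t Ht.
    destruct (Hhol (ga t)) as [v [r [N [S [Hr [HS [_ HfS]]]]]]];
      try (apply Hconv; auto); auto.
    (* D bounds the speed of the segment, so a parameter distance r / D stays in the box of radius
       r; the added 1 keeps D positive. *)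
    set (D := (Cmod (ca q - base L (ca q)) + Cmod (cb q - base L (cb q)) +
      Cmod (cc q - base L (cc q)) + 1)%R).
    pose proof (Cmod_ge_0 (ca q - base L (ca q))) as D1.
    pose proof (Cmod_ge_0 (cb q - base L (cb q))) as D2.
    pose proof (Cmod_ge_0 (cc q - base L (cc q))) as D3.
    assert (HD : (0 < D)%R) by (unfold D; lra).
    assert (Hr' : (0 < r / D)%R) by (apply Rdiv_lt_0_compat; auto).
    assert (Hco : forall w, (Cmod (w - base L w) <= D)%R ->
      W (fun _ : R => 0) (fun _ => 0) (fun s => RtoC (s - t)) (r / D) r
        (fun s => lerp (base L w) w s - lerp (base L w) w t)).
    { intros w Hd.
      apply W_ext with (fun s => (w - base L w) * RtoC (s - t));
        [intros; rewrite lerp_lerp; auto|].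
      eapply W_le; [|apply W_scal; auto; apply W_z; auto].
      replace r with (D * (r / D))%R at 2 by (field; lra).
      apply Rmult_le_compat_r; lra. }
    exists (r / D)%R, N, (fun s => S (ga s)). split; auto.
    assert (C1 := Hco (ca q) ltac:(unfold D; lra)).
    assert (C2 := Hco (cb q) ltac:(unfold D; lra)).
    assert (C3' := Hco (cc q) ltac:(unfold D; lra)).
    split.
    + apply (W_subst (fun s => cx (ga t) (ga s)) (fun s => cy (ga t) (ga s))
        (fun s => cz (ga t) (ga s)) _ _ _ r); auto.
      apply (W_comp ga (cx (ga t)) (cy (ga t)) (cz (ga t))); auto.
    + intros s Hs Hst. apply HfS; [|apply Hga; auto].
      apply (W_inbox (fun s => cx (ga t) (ga s)) (fun s => cy (ga t) (ga s))
        (fun s => cz (ga t) (ga s)) (fun _ : R => 0) (fun _ => 0) (fun s => RtoC (s - t)) r (r / D)); auto.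
      unfold inbox. rewrite Cmod_0, Cmod_R. lra.
Qed.

(** * Telescoping between half-integers *)

(* Coordinates u = (A_0, B_0, F) on C^3. *)
Definition toABC (u : C3) : C3 := (cc u - cb u + 1, cc u - ca u + 1, ca u + cb u - cc u).

Definition ua (u : C3) : C := cc u - cb u + 1.

Definition ub (u : C3) : C := cc u - ca u + 1.

Definition uc (u : C3) : C := ca u + cb u - cc u.

Definition xx (i : nat) : R := INR (S i).

Definition uterm (i j : nat) (u : C3) : C :=
  rc (xx i) (- ua u) * rc (xx j) (- ub u) * rc (xx i + xx j) (- uc u).

Lemma uterm_tornheim i j u : tornheim_term (toABC u) i j = uterm i j u.
Proof. unfold uterm, xx. rewrite <- plus_INR. reflexivity. Qed.

Lemma xx_ge1 i : (1 <= xx i)%R.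
Proof. apply INR_S_ge1. Qed.

(** The translation of (A_0, B_0, F) that raises a by [fst e] and c by [snd e]. *)
Definition sh (e : nat * nat) : C3 :=
  ivec (Z.of_nat (fst e + snd e)) (Z.of_nat (snd e)) (Z.of_nat (fst e + snd e)).

Lemma sh_ca e : ca (sh e) = RtoC (INR (fst e + snd e)).
Proof. unfold sh, ivec. rewrite ca_vec, <- INR_IZR_INZ. auto. Qed.

Lemma sh_cb e : cb (sh e) = RtoC (INR (snd e)).
Proof. unfold sh, ivec. rewrite cb_vec, <- INR_IZR_INZ. auto. Qed.

Lemma sh_cc e : cc (sh e) = RtoC (INR (fst e + snd e)).
Proof. unfold sh, ivec. rewrite cc_vec, <- INR_IZR_INZ. auto. Qed.

Lemma ua_sh u e : ua (add3 u (sh e)) = ua u + RtoC (INR (fst e)).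
Proof.
  unfold ua. rewrite cc_add3, cb_add3, sh_cc, sh_cb, plus_INR, RtoC_plus. ring.
Qed.

Lemma ub_sh u e : ub (add3 u (sh e)) = ub u.
Proof. unfold ub. rewrite cc_add3, ca_add3, sh_cc, sh_ca. ring. Qed.

Lemma uc_sh u e : uc (add3 u (sh e)) = uc u + RtoC (INR (snd e)).
Proof.
  unfold uc. rewrite cc_add3, ca_add3, cb_add3, sh_cc, sh_ca, sh_cb. ring.
Qed.

Lemma uterm_sh i j u e : uterm i j (add3 u (sh e)) =
  RtoC ((/ xx i) ^ fst e * (/ (xx i + xx j)) ^ snd e) * uterm i j u.
Proof.
  pose proof (xx_ge1 i). pose proof (xx_ge1 j).
  unfold uterm. rewrite ua_sh, ub_sh, uc_sh.
  replace (- (ua u + RtoC (INR (fst e)))) with (- ua u + - RtoC (INR (fst e))) by ring.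
  replace (- (uc u + RtoC (INR (snd e)))) with (- uc u + - RtoC (INR (snd e))) by ring.
  rewrite !rc_plus, !rc_opp_nat by lra. rewrite RtoC_mult. ring.
Qed.

(** The expansion in a step t carries (- t)^s at order s; this is the difference between t = 1/2 and
    t = - 1/2. It vanishes at s = 0 and is -1 at s = 1. *)
Definition dsig (s : nat) : C := RtoC ((- / 2) ^ s - (/ 2) ^ s).

Definition cf (u : C3) (e : nat * nat) : C := bc (ua u) (fst e) * bc (uc u) (snd e).

Definition half (i j : nat) (u : C3) (s : R) : C :=
  rc (xx i + s) (- ua u) * rc (xx i + xx j + s) (- uc u).

(* The i-sum of [gd] telescopes to a boundary term, while its expansion in 1/x_i and
   1/(x_i + x_j) is a combination of Tornheim terms with shifted exponents. *)
Definition gd (i j : nat) (u : C3) : C :=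
  rc (xx j) (- ub u) * (half i j u (/ 2) - half i j u (- / 2)).

Lemma bin_SumLe a t : (Rabs t < 1)%R -> exists N, SumLe (fun n => Cmod (bc a n * RtoC (t ^ n))) N.
Proof.
  intros Ht. pose proof (Rabs_pos t).
  apply (cpart_SumLe _ ((Rabs t + 1) / 2)); [lra|apply bc_cpart; lra|lra].
Qed.

Lemma rc_binom a x s : (0 < x)%R -> (Rabs (- s / x) < 1)%R ->
  HS (fun n => bc a n * RtoC ((- s / x) ^ n)) (rc (x + s) (- a) * rc x a).
Proof.
  intros Hx Hs.
  assert (E : rc (x + s) (- a) * rc x a = Cexp (- a * RtoC (ln (1 - - s / x)))).
  { assert (Hp : (0 < 1 - - s / x)%R) by (apply Rabs_def2 in Hs; lra).
    replace (x + s)%R with (x * (1 - - s / x))%R by (field; lra).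
    rewrite rc_mult by auto. rewrite <- (Cmult_comm (rc x a)), Cmult_assoc, <- rc_plus.
    replace (a + - a) with (RtoC 0) by ring. rewrite rc_0. unfold rc. ring. }
  rewrite E. apply bin_HS; auto.
Qed.

(** Since |s| <= 1/2 and [xx i] >= 1, both binomial series have an argument of modulus at most 1/2;
    their product is a sum over pairs of orders. *)
Lemma half_HS i j u s : (Rabs s <= / 2)%R ->
  HS (fun e => RtoC ((- s) ^ (fst e + snd e)) * cf u e * uterm i j (add3 u (sh e)))
    (rc (xx j) (- ub u) * half i j u s).
Proof.
  intros Hs. pose proof (xx_ge1 i) as Hi. pose proof (xx_ge1 j) as Hj.
  assert (Hab : forall x, (1 <= x)%R -> (Rabs (- s / x) < 1)%R).
  { intros x Hx. unfold Rdiv. rewrite Rabs_mult, Rabs_Ropp, (Rabs_pos_eq (/ x)).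
    - apply Rle_lt_trans with (/ 2 * 1)%R; [|lra].
      apply Rmult_le_compat; auto; [apply Rabs_pos|left; apply Rinv_0_lt_compat; lra|].
      rewrite <- Rinv_1. apply Rinv_le_contravar; lra.
    - left; apply Rinv_0_lt_compat; lra. }
  destruct (bin_SumLe (ua u) _ (Hab (xx i) Hi)) as [N1 HN1].
  destruct (bin_SumLe (uc u) _ (Hab (xx i + xx j)%R ltac:(lra))) as [N2 HN2].
  pose proof (HS_prod _ _ _ _ _ _ HN1 HN2 (rc_binom (ua u) (xx i) s ltac:(lra) (Hab _ Hi))
    (rc_binom (uc u) (xx i + xx j) s ltac:(lra) (Hab (xx i + xx j)%R ltac:(lra)))) as HH.
  apply (HS_scal _ _ (uterm i j u)) in HH.
  replace (rc (xx j) (- ub u) * half i j u s) with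
    (uterm i j u * (rc (xx i + s) (- ua u) * rc (xx i) (ua u) *
      (rc (xx i + xx j + s) (- uc u) * rc (xx i + xx j) (uc u)))).
  - eapply HS_ext; [|apply HH]. intros [n m]. simpl. rewrite uterm_sh; simpl.
    unfold cf; simpl. unfold Rdiv. rewrite !Rpow_mult_distr, pow_add, !RtoC_mult. ring.
  - unfold uterm, half.
    assert (E : forall x z, rc x (- z) * rc x z = 1).
    { intros. rewrite <- rc_plus. replace (- z + z) with (RtoC 0) by ring. apply rc_0. }
    transitivity (rc (xx j) (- ub u) * (rc (xx i + s) (- ua u) * rc (xx i + xx j + s) (- uc u)) *
      (rc (xx i) (- ua u) * rc (xx i) (ua u)) *
      (rc (xx i + xx j) (- uc u) * rc (xx i + xx j) (uc u))); [ring|].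
    rewrite !E. ring.
Qed.

Definition gterm (i j : nat) (e : nat * nat) (u : C3) : C :=
  dsig (fst e + snd e) * cf u e * uterm i j (add3 u (sh e)).

Lemma gd_HS i j u : HS (fun e => gterm i j e u) (gd i j u).
Proof.
  assert (A : (Rabs (/ 2) <= / 2)%R) by (rewrite Rabs_pos_eq; lra).
  assert (B : (Rabs (- / 2) <= / 2)%R) by (rewrite Rabs_Ropp, Rabs_pos_eq; lra).
  unfold gd. replace (rc (xx j) (- ub u) * (half i j u (/ 2) - half i j u (- / 2))) with
    (rc (xx j) (- ub u) * half i j u (/ 2) - rc (xx j) (- ub u) * half i j u (- / 2)) by ring.
  eapply HS_ext; [|apply (HS_minus _ _ _ _ (half_HS i j u _ A) (half_HS i j u _ B))].
  intros e. cbv beta. unfold gterm, dsig. rewrite Ropp_involutive, RtoC_minus. ring.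
Qed.

(** For x >= 1 the norm of a power is a power with real exponent raised by D. Bounding Dirichlet
    terms near a point thus amounts to moving the real parts of their exponents. *)
Lemma W_rc1 {Q} (X Y Z : Q -> C) r D x s0 (d : Q -> C) : (0 < r)%R -> (1 <= x)%R ->
  W X Y Z r D d -> W X Y Z r (Rpower x (Re s0 + D)) (fun q => rc x (s0 + d q)).
Proof.
  intros Hr Hx Hd. eapply W_le; [|apply W_rc; eauto].
  rewrite Rpower_plus, Rabs_pos_eq by (apply ln_ge0; auto). right. reflexivity.
Qed.

Lemma W_ua p r : (0 < r)%R -> Wat p r (2 * r) (fun q => - (cz p q - cy p q)).
Proof.
  intros Hr. apply W_ext with (fun q => cy p q + -(1) * cz p q); [intros; ring|].
  eapply W_le; [|apply W_plus; [lra|apply W_y; auto|apply W_scal; [auto|apply W_z; auto]]].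
  rewrite Cmod_opp, Cmod_1. lra.
Qed.

Lemma W_ub p r : (0 < r)%R -> Wat p r (2 * r) (fun q => - (cz p q - cx p q)).
Proof.
  intros Hr. apply W_ext with (fun q => cx p q + -(1) * cz p q); [intros; ring|].
  eapply W_le; [|apply W_plus; [lra|apply W_x; auto|apply W_scal; [auto|apply W_z; auto]]].
  rewrite Cmod_opp, Cmod_1. lra.
Qed.

Lemma W_uc p r : (0 < r)%R -> Wat p r (3 * r) (fun q => - (cx p q + cy p q - cz p q)).
Proof.
  intros Hr. apply W_ext with (fun q => -(1) * cx p q + (-(1) * cy p q + cz p q)); [intros; ring|].
  eapply W_le; [|apply W_plus; [lra|apply W_scal; [auto|apply W_x; auto]|
    apply W_plus; [lra|apply W_scal; [auto|apply W_y; auto]|apply W_z; auto]]].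
  rewrite Cmod_opp, Cmod_1. lra.
Qed.

Lemma W_rc_ua p r x : (0 < r)%R -> (1 <= x)%R ->
  Wat p r (Rpower x (- (Re (ua p) - 2 * r))) (fun q => rc x (- ua q)).
Proof.
  intros Hr Hx. apply W_ext with (fun q => rc x (- ua p + - (cz p q - cy p q))).
  { intros q _. f_equal. unfold ua, cz, cy. ring. }
  replace (- (Re (ua p) - 2 * r))%R with (Re (- ua p) + 2 * r)%R
    by (destruct (ua p); unfold Re; simpl; ring).
  apply W_rc1; auto. apply W_ua; auto.
Qed.

Lemma W_rc_ub p r x : (0 < r)%R -> (1 <= x)%R ->
  Wat p r (Rpower x (- (Re (ub p) - 2 * r))) (fun q => rc x (- ub q)).
Proof.
  intros Hr Hx. apply W_ext with (fun q => rc x (- ub p + - (cz p q - cx p q))).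
  { intros q _. f_equal. unfold ub, cz, cx. ring. }
  replace (- (Re (ub p) - 2 * r))%R with (Re (- ub p) + 2 * r)%R
    by (destruct (ub p); unfold Re; simpl; ring).
  apply W_rc1; auto. apply W_ub; auto.
Qed.

Lemma W_rc_uc p r x : (0 < r)%R -> (1 <= x)%R ->
  Wat p r (Rpower x (- (Re (uc p) - 3 * r))) (fun q => rc x (- uc q)).
Proof.
  intros Hr Hx. apply W_ext with (fun q => rc x (- uc p + - (cx p q + cy p q - cz p q))).
  { intros q _. f_equal. unfold uc, cz, cx, cy. ring. }
  replace (- (Re (uc p) - 3 * r))%R with (Re (- uc p) + 3 * r)%R
    by (destruct (uc p); unfold Re; simpl; ring).
  apply W_rc1; auto. apply W_uc; auto.
Qed.

Lemma rt_xx x y z i j : rt x y z (i, j) =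
  (Rpower (xx i) (- x) * Rpower (xx j) (- y) * Rpower (xx i + xx j) (- z))%R.
Proof. unfold rt, xx. simpl fst; simpl snd. rewrite <- plus_INR. reflexivity. Qed.

(** The losses 2 r, 2 r, 3 r bound the norms of a, b, c as linear forms in the centred
    coordinates. *)
Lemma W_tt p r i j : (0 < r)%R ->
  Wat p r (rt (Re (ua p) - 2 * r) (Re (ub p) - 2 * r) (Re (uc p) - 3 * r) (i, j)) (uterm i j).
Proof.
  intros Hr. rewrite rt_xx. pose proof (xx_ge1 i). pose proof (xx_ge1 j).
  apply W_mult; auto; [apply W_mult; auto|].
  - apply W_rc_ua; auto.
  - apply W_rc_ub; auto.
  - apply W_rc_uc; auto; lra.
Qed.

Lemma W_bc {Q} (X Y Z : Q -> C) r A (f : Q -> C) n : (0 < r)%R -> W X Y Z r A f ->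
  W X Y Z r (rb A n) (fun q => bc (f q) n).
Proof.
  intros Hr Hf. assert (HA := W_ge0 _ _ _ _ _ _ Hf).
  assert (HP : W X Y Z r (rpoch A n) (fun q => Cpochhammer (f q) n)).
  { induction n as [|n IH]; simpl.
    - apply W_le with (Cmod 1); [rewrite Cmod_1; lra|]. apply W_const; auto.
    - apply W_mult; auto. apply W_plus; [lra|auto|].
      eapply W_le; [|apply W_const; auto]. rewrite Cmod_R, Rabs_pos_eq; [lra|apply pos_INR]. }
  unfold bc, rb.
  apply W_ext with (fun q => / RtoC (INR (fact n)) * Cpochhammer (f q) n).
  { intros. unfold Cdiv. ring. }
  eapply W_le; [|apply W_scal; eauto].
  rewrite Cmod_inv, Cmod_R, Rabs_pos_eq; [unfold Rdiv; lra|apply pos_INR|apply fact_nz].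
Qed.

Lemma dsig_le s : (Cmod (dsig s) <= 2 * (/ 2) ^ s)%R.
Proof.
  unfold dsig. rewrite Cmod_R. unfold Rminus.
  eapply Rle_trans; [apply Rabs_triang|].
  rewrite Rabs_Ropp, <- !RPow_abs, Rabs_Ropp, Rabs_pos_eq by lra. lra.
Qed.

(** * Remainder and boundary term of the telescoping sum *)

Definition Rem (L : list (nat * nat)) (i j : nat) (u : C3) : C :=
  gd i j u - csum L (fun e => gterm i j e u).

Lemma rt_shift x y z K i j : rt (x + INR K) y z (i, j) = ((/ xx i) ^ K * rt x y z (i, j))%R.
Proof.
  pose proof (xx_ge1 i).
  rewrite !rt_xx. replace (- (x + INR K))%R with (- x + - INR K)%R by ring.
  rewrite Rpower_plus, (Rpower_Ropp (xx i) (INR K)), Rpower_pow, pow_inv by lra. ring.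
Qed.

Lemma rt_pos x y z q : (0 < rt x y z q)%R.
Proof. unfold rt. repeat apply Rmult_lt_0_compat; apply Rpower_pos. Qed.

Lemma W_ua' p r : (0 < r)%R -> Wat p r (2 * r + Cmod (ua p)) ua.
Proof.
  intros Hr. apply W_ext with (fun q => -(1) * (- (cz p q - cy p q)) + ua p);
    [intros; unfold ua, cz, cy; ring|].
  apply W_plus; [lra| |apply W_const; auto].
  eapply W_le; [|apply W_scal; [auto|apply W_ua; auto]]. rewrite Cmod_opp, Cmod_1. lra.
Qed.

Lemma W_uc' p r : (0 < r)%R -> Wat p r (3 * r + Cmod (uc p)) uc.
Proof.
  intros Hr. apply W_ext with (fun q => -(1) * (- (cx p q + cy p q - cz p q)) + uc p);
    [intros; unfold uc, cz, cy, cx; ring|].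
  apply W_plus; [lra| |apply W_const; auto].
  eapply W_le; [|apply W_scal; [auto|apply W_uc; auto]]. rewrite Cmod_opp, Cmod_1. lra.
Qed.

Lemma pow_inv_le x n m : (1 <= x)%R -> (m <= n)%nat -> ((/ x) ^ n <= (/ x) ^ m)%R.
Proof.
  intros Hx Hnm. replace n with (m + (n - m))%nat by lia. rewrite pow_add.
  assert (0 < / x <= 1)%R.
  { split; [apply Rinv_0_lt_compat; lra|]. rewrite <- Rinv_1. apply Rinv_le_contravar; lra. }
  assert (0 <= (/ x) ^ m)%R by (apply pow_le; lra).
  assert ((/ x) ^ (n - m) <= 1)%R by (rewrite <- (pow1 (n - m)); apply pow_incr; lra).
  rewrite <- (Rmult_1_r ((/ x) ^ m)) at 2. apply Rmult_le_compat_l; auto.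
Qed.

(** An omitted order (n, m) has n + m >= K, so its factor x_i^(-n) (x_i + x_j)^(-m) is at most
    x_i^(-K): the remainder is bounded like a term with a raised by K. The constant is uniform in i
    and j because the orders are summed with the weights (1/2)^(n+m) coming from [dsig]. *)
Lemma Rem_W L K p r : NoDup L ->
  (forall e, ~ In e L -> (K <= fst e + snd e)%nat) -> (0 < r)%R ->
  exists c, (0 <= c)%R /\ forall i j, Wat p r
    (c * rt (Re (ua p) - 2 * r + INR K) (Re (ub p) - 2 * r) (Re (uc p) - 3 * r) (i, j)) (Rem L i j).
Proof.
  intros HL HK Hr.
  set (A := (2 * r + Cmod (ua p))%R). set (D := (3 * r + Cmod (uc p))%R).
  assert (HA : (0 < A)%R) by (unfold A; pose proof (Cmod_ge_0 (ua p)); lra).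
  assert (HD : (0 < D)%R) by (unfold D; pose proof (Cmod_ge_0 (uc p)); lra).
  destruct (rb_SumLe A (/ 2) HA ltac:(lra)) as [NA HNA].
  destruct (rb_SumLe D (/ 2) HD ltac:(lra)) as [ND HND].
  exists (2 * (NA * ND))%R. split.
  { apply SumLe_ge0 in HNA, HND. nra. }
  intros i j. pose proof (xx_ge1 i) as Hi. pose proof (xx_ge1 j) as Hj.
  rewrite rt_shift.
  set (R0 := rt (Re (ua p) - 2 * r) (Re (ub p) - 2 * r) (Re (uc p) - 3 * r) (i, j)).
  assert (HR0 : (0 < R0)%R) by apply rt_pos.
  assert (Hxi : (0 <= (/ xx i) ^ K)%R) by (apply pow_le; left; apply Rinv_0_lt_compat; lra).
  assert (Hnn : forall n, (0 <= rb A n * (/ 2) ^ n)%R)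
    by (intros; apply Rmult_le_pos; [left; apply rb_pos; auto|apply pow_le; lra]).
  assert (Hnn' : forall n, (0 <= rb D n * (/ 2) ^ n)%R)
    by (intros; apply Rmult_le_pos; [left; apply rb_pos; auto|apply pow_le; lra]).
  pose proof (SumLe_prod _ _ _ _ Hnn Hnn' HNA HND) as HP.
  apply (SumLe_scal _ _ (2 * ((/ xx i) ^ K * R0))) in HP; [|nra].
  apply (W_sum _ _ _ _ (fun e q => ind (fun e => ~ In e L) (fun e => gterm i j e q) e)
    (fun e : nat * nat => 2 * ((/ xx i) ^ K * R0) *
      (rb A (fst e) * (/ 2) ^ fst e * (rb D (snd e) * (/ 2) ^ snd e)))%R); auto.
  - intros [n m]. simpl fst; simpl snd.
    assert (Hge : (0 <= 2 * ((/ xx i) ^ K * R0) *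
      (rb A n * (/ 2) ^ n * (rb D m * (/ 2) ^ m)))%R).
    { specialize (Hnn n). specialize (Hnn' m).
      apply Rmult_le_pos; [apply Rmult_le_pos; [lra|apply Rmult_le_pos; lra]|apply Rmult_le_pos; auto]. }
    unfold ind. destruct excluded_middle_informative as [Hn|Hn].
    2:{ apply W_le with (Cmod 0); [rewrite Cmod_0; auto|]. apply W_const; auto. }
    specialize (HK _ Hn). simpl in HK.
    apply W_ext with (fun q => dsig (n + m) * RtoC ((/ xx i) ^ n * (/ (xx i + xx j)) ^ m) *
      ((bc (ua q) n * bc (uc q) m) * uterm i j q)).
    { intros q _. unfold gterm, cf. rewrite uterm_sh. simpl. ring. }
    eapply W_le; [|apply W_scal; [auto|apply W_mult; [auto|apply W_mult; [auto| |]|]];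
      [apply W_bc; [auto|apply W_ua'; auto]|apply W_bc; [auto|apply W_uc'; auto]|apply W_tt; auto]].
    fold A D R0. rewrite Cmod_mult, Cmod_R.
    assert (0 <= (/ xx i) ^ n)%R by (apply pow_le; left; apply Rinv_0_lt_compat; lra).
    assert (0 <= (/ (xx i + xx j)) ^ m)%R by (apply pow_le; left; apply Rinv_0_lt_compat; lra).
    rewrite Rabs_pos_eq by nra.
    assert (E1 : ((/ (xx i + xx j)) ^ m <= (/ xx i) ^ m)%R).
    { apply pow_incr. split; [left; apply Rinv_0_lt_compat; lra|apply Rinv_le_contravar; lra]. }
    assert (E2 : ((/ xx i) ^ n * (/ (xx i + xx j)) ^ m <= (/ xx i) ^ K)%R).
    { apply Rle_trans with ((/ xx i) ^ (n + m))%R; [|apply pow_inv_le; auto].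
      rewrite pow_add. apply Rmult_le_compat_l; auto. }
    pose proof (dsig_le (n + m)) as E3. rewrite pow_add in E3.
    replace (2 * ((/ xx i) ^ K * R0) * (rb A n * (/ 2) ^ n * (rb D m * (/ 2) ^ m)))%R with
      (2 * ((/ 2) ^ n * (/ 2) ^ m) * (/ xx i) ^ K * (rb A n * rb D m * R0))%R by ring.
    apply Rmult_le_compat_r.
    { pose proof (rb_pos A n HA). pose proof (rb_pos D m HD).
      apply Rmult_le_pos; [apply Rmult_le_pos; lra|lra]. }
    apply Rmult_le_compat; auto; [apply Cmod_ge_0|nra].
  - eapply SumLe_le; [| |apply HP]; [intros; cbv beta; right; ring|right; ring].
  - intros q Hq. apply HS_remove; auto. apply gd_HS.
Qed.

Lemma Re_minus z w : Re (z - w) = (Re z - Re w)%R.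
Proof. destruct z, w; reflexivity. Qed.

Lemma Re_plus z w : Re (z + w) = (Re z + Re w)%R.
Proof. destruct z, w; reflexivity. Qed.

Lemma Re_opp z : Re (- z) = (- Re z)%R.
Proof. destruct z; reflexivity. Qed.

Lemma Re_ua p : Re (ua p) = (Re (cc p) - Re (cb p) + 1)%R.
Proof. unfold ua. rewrite Re_plus, Re_minus. reflexivity. Qed.

Lemma Re_ub p : Re (ub p) = (Re (cc p) - Re (ca p) + 1)%R.
Proof. unfold ub. rewrite Re_plus, Re_minus. reflexivity. Qed.

Lemma Re_uc p : Re (uc p) = (Re (ca p) + Re (cb p) - Re (cc p))%R.
Proof. unfold uc. rewrite Re_minus, Re_plus. reflexivity. Qed.

(** Raising a by K raises A_0 and F but not B_0, hence the asymmetric domain. The divisor 10 in r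
    leaves room for a total loss of at most 7 r in the exponents. *)
Lemma Rem_sum L K p : NoDup L ->
  (forall e, ~ In e L -> (K <= fst e + snd e)%nat) ->
  (- INR K < Re (ca p))%R -> (0 < Re (cb p))%R -> (- INR K < Re (cc p))%R ->
  exists r (N : nat * nat -> R) M, (0 < r)%R /\
    (forall i j, Wat p r (N (i, j)) (Rem L i j)) /\ SumLe N M.
Proof.
  intros HL HK Ha Hb Hc.
  set (r := (Rmin (Re (ca p) + INR K) (Rmin (Re (cb p)) (Re (cc p) + INR K)) / 10)%R).
  assert (Hm : (0 < Rmin (Re (ca p) + INR K) (Rmin (Re (cb p)) (Re (cc p) + INR K)))%R)
    by (repeat apply Rmin_pos; lra).
  pose proof (Rmin_l (Re (ca p) + INR K) (Rmin (Re (cb p)) (Re (cc p) + INR K))).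
  pose proof (Rmin_r (Re (ca p) + INR K) (Rmin (Re (cb p)) (Re (cc p) + INR K))).
  pose proof (Rmin_l (Re (cb p)) (Re (cc p) + INR K)).
  pose proof (Rmin_r (Re (cb p)) (Re (cc p) + INR K)).
  assert (Hr : (0 < r)%R) by (unfold r; lra).
  destruct (Rem_W L K p r HL HK Hr) as [c [Hc0 HW]].
  destruct (rt_SumLe (Re (ua p) - 2 * r + INR K) (Re (ub p) - 2 * r) (Re (uc p) - 3 * r))
    as [M HM]; try (rewrite ?Re_ua, ?Re_ub, ?Re_uc; unfold r; lra).
  exists r, (fun e => c * rt (Re (ua p) - 2 * r + INR K) (Re (ub p) - 2 * r) (Re (uc p) - 3 * r) e)%R,
    (c * M)%R.
  split; auto. split; auto. apply SumLe_scal; auto.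
Qed.

Definition RemTot (L : list (nat * nat)) (u : C3) : C :=
  tsum (fun p : nat * nat => Rem L (fst p) (snd p) u).

Lemma RemTot_analytic L K p : NoDup L ->
  (forall e, ~ In e L -> (K <= fst e + snd e)%nat) ->
  (- INR K < Re (ca p))%R -> (0 < Re (cb p))%R -> (- INR K < Re (cc p))%R ->
  analytic p (RemTot L).
Proof.
  intros HL HK Ha Hb Hc.
  destruct (Rem_sum L K p HL HK Ha Hb Hc) as [r [N [M [Hr [HW HM]]]]].
  exists r, M. split; auto.
  apply (W_sum _ _ _ _ (fun e : nat * nat => Rem L (fst e) (snd e)) N); auto.
  - intros [i j]. apply HW.
  - intros q Hq. apply HS_tsum with M. eapply SumLe_le; [| |apply HM]; [|lra].
    intros [i j]. apply (W_bound _ _ _ _ _ _ q (HW i j) Hq).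
Qed.

Lemma RemTot_HS L K p : NoDup L ->
  (forall e, ~ In e L -> (K <= fst e + snd e)%nat) ->
  (- INR K < Re (ca p))%R -> (0 < Re (cb p))%R -> (- INR K < Re (cc p))%R ->
  exists M, SumLe (fun e : nat * nat => Cmod (Rem L (fst e) (snd e) p)) M /\
    HS (fun e : nat * nat => Rem L (fst e) (snd e) p) (RemTot L p).
Proof.
  intros HL HK Ha Hb Hc.
  destruct (Rem_sum L K p HL HK Ha Hb Hc) as [r [N [M [Hr [HW HM]]]]].
  assert (HS1 : SumLe (fun e : nat * nat => Cmod (Rem L (fst e) (snd e) p)) M).
  { eapply SumLe_le; [| |apply HM]; [|lra].
    intros [i j]. apply (W_bound _ _ _ _ _ _ p (HW i j)). apply box_refl; lra. }
  exists M. split; auto. apply HS_tsum with M; auto.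
Qed.

(** What the sum over i leaves at its lower end 1/2; the upper end tends to zero by [half_limit]. *)
Definition bterm (j : nat) (u : C3) : C :=
  - (rc (xx j) (- ub u) * (rc (/ 2) (- ua u) * rc (xx j + / 2) (- uc u))).

Definition bdry (u : C3) : C := tsum (fun j => bterm j u).

Lemma Rpower_between x y z : (1 <= y <= x)%R -> (Rpower (x + y) z <= exp (Rabs z * ln 2) * Rpower x z)%R.
Proof.
  intros H. unfold Rpower. rewrite <- exp_plus.
  assert (z * ln (x + y) <= Rabs z * ln 2 + z * ln x)%R as He.
  { pose proof (ln_sum_bounds x y H).
    assert (z * (ln (x + y) - ln x) <= Rabs z * ln 2)%R; [|lra].
    apply Rle_trans with (Rabs z * (ln (x + y) - ln x))%R.
    - apply Rmult_le_compat_r; [lra|apply Rle_abs].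
    - apply Rmult_le_compat_l; [apply Rabs_pos|lra]. }
  destruct He as [He| ->]; [left; apply exp_increasing; auto|lra].
Qed.

Lemma Rpower_half x z : (1 <= x)%R -> (Rpower (x + / 2) z <= exp (Rabs z * ln 2) * Rpower x z)%R.
Proof.
  intros H. unfold Rpower. rewrite <- exp_plus.
  assert (z * ln (x + / 2) <= Rabs z * ln 2 + z * ln x)%R as He.
  { assert (ln x <= ln (x + / 2) <= ln x + ln 2)%R.
    { split; [apply ln_le; lra|]. rewrite <- ln_mult by lra. apply ln_le; lra. }
    assert (z * (ln (x + / 2) - ln x) <= Rabs z * ln 2)%R; [|lra].
    apply Rle_trans with (Rabs z * (ln (x + / 2) - ln x))%R.
    - apply Rmult_le_compat_r; [lra|apply Rle_abs].
    - apply Rmult_le_compat_l; [apply Rabs_pos|lra]. }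
  destruct He as [He| ->]; [left; apply exp_increasing; auto|lra].
Qed.

(** A single sum over j with total exponent b + c = B_0 + 1, so only B_0 restricts its
    convergence. *)
Lemma bdry_analytic p : (0 < Re (cb p))%R -> analytic p bdry.
Proof.
  intros Hb. set (r := (Re (cb p) / 10)%R). assert (Hr : (0 < r)%R) by (unfold r; lra).
  (* The base 1/2 lies below 1, outside the scope of [W_rc1]; its power is bounded by a constant
     through [W_rc]. *)
  set (c0 := (Rpower (/ 2) (Re (- ua p)) * exp (2 * r * Rabs (ln (/ 2))))%R).
  assert (Hc0 : (0 < c0)%R) by (apply Rmult_lt_0_compat; apply exp_pos).
  set (y := (Re (ub p) - 2 * r)%R). set (z := (Re (uc p) - 3 * r)%R).
  set (d := (y + z - 1)%R).
  assert (Hd : (0 < d)%R) by (unfold d, y, z; rewrite Re_ub, Re_uc; unfold r; lra).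
  set (c1 := (c0 * exp (Rabs (- z) * ln 2))%R).
  assert (Hc1 : (0 < c1)%R) by (apply Rmult_lt_0_compat; [auto|apply exp_pos]).
  assert (HWj : forall j, Wat p r (c1 * Rpower (INR (S j)) (- (1 + d))) (bterm j)).
  { intros j. pose proof (xx_ge1 j) as Hj.
    apply W_ext with (fun q => -(1) * (rc (xx j) (- ub q) * (rc (/ 2) (- ua q) * rc (xx j + / 2) (- uc q))));
      [intros; unfold bterm; ring|].
    eapply W_le; [|apply W_scal; [auto|apply W_mult; [auto|apply W_rc_ub; auto|
      apply W_mult; [auto| |apply W_rc_uc; auto; lra]]]].
    2:{ apply W_ext with (fun q => rc (/ 2) (- ua p + - (cz p q - cy p q))).
        - intros q _. f_equal. unfold ua, cz, cy. ring.
        - apply W_rc; auto. apply W_ua; auto. }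
    fold c0 y z. rewrite Cmod_opp, Cmod_1, Rmult_1_l.
    pose proof (Rpower_half (xx j) (- z) Hj).
    pose proof (Rpower_pos (xx j) (- y)).
    replace (c1 * Rpower (INR (S j)) (- (1 + d)))%R with
      (Rpower (xx j) (- y) * (c0 * (exp (Rabs (- z) * ln 2) * Rpower (xx j) (- z))))%R.
    - apply Rmult_le_compat_l; [lra|]. apply Rmult_le_compat_l; [lra|auto].
    - replace (- (1 + d))%R with (- y + - z)%R by (unfold d; ring).
      rewrite Rpower_plus. unfold c1, xx. ring. }
  pose proof (SumLe_scal _ _ c1 ltac:(lra) (zeta_SumLe d Hd)) as HS1.
  exists r, (c1 * (1 + / d))%R. split; auto.
  apply (W_sum _ _ _ _ bterm _ _ _ Hr HWj HS1).
  intros q Hq. apply (HS_tsum _ (c1 * (1 + / d))).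
  eapply SumLe_le; [| |apply HS1]; [|lra].
  intros j. apply (W_bound _ _ _ _ _ _ q (HWj j) Hq).
Qed.

Lemma half_telescope N j u :
  csum (seq 0 N) (fun i => half i j u (/ 2) - half i j u (- / 2)) =
  (rc (INR N + / 2) (- ua u) * rc (INR N + xx j + / 2) (- uc u)) -
  rc (/ 2) (- ua u) * rc (xx j + / 2) (- uc u).
Proof.
  induction N.
  - simpl. rewrite !Rplus_0_l. ring.
  - rewrite seq_S, csum_app, IHN, Nat.add_0_l. simpl csum.
    unfold half. set (y := xx j). change (xx N) with (INR (S N)).
    replace (INR (S N) + - / 2)%R with (INR N + / 2)%R by (rewrite S_INR; field).
    replace (INR (S N) + y + - / 2)%R with (INR N + y + / 2)%R by (rewrite S_INR; field).
    ring.
Qed.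

(** The size is about N^(-Re (a + c)) with a + c = A_0 + 1, hence at most a constant times 1 / N. *)
Lemma half_limit j u : (0 < Re (ca u))%R ->
  forall e, (0 < e)%R -> exists n0, forall N, (n0 <= N)%nat ->
   (Cmod (rc (INR N + / 2) (- ua u) * rc (INR N + xx j + / 2) (- uc u)) < e)%R.
Proof.
  intros Ha e He. pose proof (xx_ge1 j) as Hj.
  set (z := Re (- uc u)). set (c := exp (Rabs z * ln 2)).
  assert (Hc : (0 < c)%R) by apply exp_pos.
  destruct (archimed_cor1 (e / (2 * c))) as [n1 [Hn1 Hn1']]; [apply Rdiv_lt_0_compat; lra|].
  exists (S (max n1 (S j))). intros N HN.
  assert (HN1 : (INR n1 <= INR N)%R) by (apply le_INR; lia).
  assert (HN2 : (xx j <= INR N)%R) by (unfold xx; apply le_INR; lia).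
  assert (Hn1p : (0 < INR n1)%R) by (apply lt_0_INR; auto).
  set (X := (INR N + / 2)%R).
  assert (HX : (1 <= xx j <= X)%R) by (unfold X; lra).
  replace (INR N + xx j + / 2)%R with (X + xx j)%R by (unfold X; ring).
  rewrite Cmod_mult, !Cmod_rc. fold z.
  pose proof (Rpower_between X (xx j) z HX) as HB. fold c in HB.
  assert (HP : (Rpower X (Re (- ua u)) * Rpower X z <= / X)%R).
  { rewrite <- Rpower_plus. rewrite <- (Rpower_1 X) at 2 by lra.
    rewrite <- Rpower_Ropp. apply Rle_Rpower; [lra|].
    unfold z. rewrite !Re_opp, Re_ua, Re_uc. lra. }
  assert (HXn : (/ X <= / INR n1)%R) by (apply Rinv_le_contravar; unfold X; lra).
  assert (0 < Rpower X (Re (- ua u)))%R by apply Rpower_pos.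
  apply Rle_lt_trans with (c * / INR n1)%R.
  - apply Rle_trans with (c * (Rpower X (Re (- ua u)) * Rpower X z))%R; [|apply Rmult_le_compat_l; lra].
    apply Rle_trans with (Rpower X (Re (- ua u)) * (c * Rpower X z))%R; [|right; ring].
    apply Rmult_le_compat_l; lra.
  - apply Rmult_lt_compat_l with (r := c) in Hn1; auto.
    replace (c * (e / (2 * c)))%R with (e / 2)%R in Hn1 by (field; lra). lra.
Qed.

Lemma C_lim_eps (f : nat -> C) (s : C) :
  (forall e, (0 < e)%R -> exists n0, forall n, (n0 <= n)%nat -> (Cmod (f n - s) < e)%R) ->
  filterlim f eventually (locally s).
Proof.
  intros H. apply filterlim_locally. intros eps.
  destruct (H eps (cond_pos eps)) as [n0 Hn0]. exists n0. intros n Hn.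
  apply C_NormedModule_mixin_compat1. apply Hn0; auto.
Qed.

Lemma gd_total u : (0 < Re (ca u))%R -> (0 < Re (cb u))%R -> (0 < Re (cc u))%R ->
  HS (fun e : nat * nat => gd (fst e) (snd e) u) (bdry u).
Proof.
  intros Ha Hb Hc.
  (* With the empty list the remainder is [gd] itself, so its summability is the case K = 0. *)
  destruct (RemTot_HS nil 0 u (NoDup_nil _) ltac:(intros; lia)) as [M [HM _]];
    try (simpl; lra).
  assert (HM' : SumLe (fun e : nat * nat => Cmod (gd (fst e) (snd e) u)) M).
  { eapply SumLe_le; [| |apply HM]; [|lra]. intros e. right. f_equal. unfold Rem. simpl. ring. }
  destruct (SumLe_HS _ _ HM') as [s Hs].
  apply HS_swap in Hs. simpl in Hs.
  apply SumLe_swap in HM'. simpl in HM'.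
  assert (Hrow : forall j, HS (fun i => gd i j u) (bterm j u)).
  { intros j.
    assert (HMj : SumLe (fun i => Cmod (gd i j u)) M).
    { apply (SumLe_inj (fun i => (j, i)) (fun e : nat * nat => Cmod (gd (snd e) (fst e) u))); auto.
      congruence. }
    destruct (SumLe_HS _ _ HMj) as [t Ht].
    replace (bterm j u) with t; auto.
    apply (C_lim_unique (fun n => csum (cube1 n) (fun i => gd i j u)));
      [apply HS_cube; auto; apply cube1_cube|].
    apply C_lim_eps. intros e He.
    set (b := rc (xx j) (- ub u)).
    destruct (half_limit j u Ha (e / (Cmod b + 1))) as [n0 Hn0].
    { apply Rdiv_lt_0_compat; auto. pose proof (Cmod_ge_0 b); lra. }
    exists n0. intros n Hn. specialize (Hn0 (S n) ltac:(lia)).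
    assert (E : csum (cube1 n) (fun i => gd i j u) - bterm j u =
      b * (rc (INR (S n) + / 2) (- ua u) * rc (INR (S n) + xx j + / 2) (- uc u))).
    { unfold gd. rewrite csum_scal. unfold cube1. rewrite half_telescope.
      unfold bterm. fold b. ring. }
    rewrite E, Cmod_mult.
    match goal with |- (_ * ?h < _)%R => set (h0 := h) in * end.
    assert (0 <= h0)%R by apply Cmod_ge_0. pose proof (Cmod_ge_0 b).
    apply Rle_lt_trans with ((Cmod b + 1) * h0)%R; [nra|].
    apply Rmult_lt_compat_l with (r := (Cmod b + 1)%R) in Hn0; [|lra].
    replace ((Cmod b + 1) * (e / (Cmod b + 1)))%R with e in Hn0 by (field; lra). auto. }
  apply (HS_pair (fun e : nat * nat => gd (snd e) (fst e) u) (fun j => bterm j u) s M HM' Hrow) in Hs as Hb'.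
  unfold bdry. rewrite (tsum_HS _ _ Hb').
  apply (HS_swap (fun e : nat * nat => gd (snd e) (fst e) u)) in Hs.
  eapply HS_ext; [|apply Hs]. intros; reflexivity.
Qed.

(** * The two relations for T *)

Definition Tu (T : C3 -> C) (u : C3) : C := T (toABC u).

Definition natpole (z : C) : Prop := exists n : nat, z = - RtoC (INR n).

Definition nonpolar (u : C3) : Prop := ~ natpole (ca u) /\ ~ natpole (cb u) /\ cc u <> 0.

Lemma form_toABC H u : form H (toABC u) =
  match H with
  | HA l => ca u + RtoC (INR l) | HB m => cb u + RtoC (INR m) | HF => cc u
  end.
Proof.
  destruct H; unfold form, toABC; unfold ca at 1, cb at 1, cc at 1; simpl;
    unfold ca, cb, cc; simpl; ring.
Qed.

Lemma natpole_int z : natpole z -> exists n : Z, z = RtoC (IZR n).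
Proof.
  intros [n ->]. exists (- Z.of_nat n)%Z. rewrite opp_IZR, <- INR_IZR_INZ, RtoC_opp. auto.
Qed.

Lemma good_nonpolar u : good u -> nonpolar u.
Proof.
  intros H. assert (Hz : forall z, (z = ca u \/ z = cb u \/ z = cc u) -> forall n, z <> RtoC (IZR n)).
  { intros z Hz n. destruct (H n) as [? [? ?]]. destruct Hz as [->|[->| ->]]; auto. }
  assert (Hn : forall z, (z = ca u \/ z = cb u \/ z = cc u) -> ~ natpole z).
  { intros z H1 H2. apply natpole_int in H2 as [n H2]. apply (Hz z H1 n H2). }
  split; [apply Hn; auto|split; [apply Hn; auto|]].
  apply (Hz (cc u) ltac:(auto) 0%Z).
Qed.

Lemma Re_pos_not_natpole z : (0 < Re z)%R -> ~ natpole z.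
Proof.
  intros H [n ->]. rewrite Re_opp, re_RtoC in H. pose proof (pos_INR n). lra.
Qed.

Lemma Tu_analytic T u : is_meromorphic_continuation T -> nonpolar u -> analytic u (Tu T).
Proof.
  intros [_ [HT _]] [Ha [Hb Hc]].
  destruct (holomorphic_W T (toABC u)) as [r [N [Hr HW]]].
  { apply HT. intros H. rewrite form_toABC. destruct H; auto.
    - intros H0. apply Ha. exists l.
      replace (ca u) with (ca u + RtoC (INR l) - RtoC (INR l)) by ring. rewrite H0; ring.
    - intros H0. apply Hb. exists m.
      replace (cb u) with (cb u + RtoC (INR m) - RtoC (INR m)) by ring. rewrite H0; ring. }
  (* The linear map [toABC] enlarges boxes at most threefold. *)
  exists (r / 3)%R, N. split; [lra|].
  assert (Hr3 : (0 < r / 3)%R) by lra.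
  apply (W_subst (fun q => - (- (cz u q - cy u q))) (fun q => - (- (cz u q - cx u q)))
    (fun q => - (- (cx u q + cy u q - cz u q))) _ _ _ r); auto.
  - apply W_ext with (fun q => -(1) * - (cz u q - cy u q)); [intros; ring|].
    eapply W_le; [|apply W_scal; [auto|apply W_ua; auto]]. rewrite Cmod_opp, Cmod_1. lra.
  - apply W_ext with (fun q => -(1) * - (cz u q - cx u q)); [intros; ring|].
    eapply W_le; [|apply W_scal; [auto|apply W_ub; auto]]. rewrite Cmod_opp, Cmod_1. lra.
  - apply W_ext with (fun q => -(1) * - (cx u q + cy u q - cz u q)); [intros; ring|].
    eapply W_le; [|apply W_scal; [auto|apply W_uc; auto]]. rewrite Cmod_opp, Cmod_1. lra.
  - apply (W_comp toABC (cx (toABC u)) (cy (toABC u)) (cz (toABC u))); auto;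
      intros q; unfold cx, cy, cz, toABC; unfold ca, cb, cc; simpl; ring.
Qed.

Lemma Cmod_tt i j u : Cmod (uterm i j u) = rt (Re (ua u)) (Re (ub u)) (Re (uc u)) (i, j).
Proof. rewrite rt_xx. unfold uterm. rewrite !Cmod_mult, !Cmod_rc, !Re_opp. auto. Qed.

Lemma Tu_HS T u : is_meromorphic_continuation T ->
  (0 < Re (ca u))%R -> (0 < Re (cb u))%R -> (0 < Re (cc u))%R ->
  exists M, SumLe (fun e : nat * nat => Cmod (uterm (fst e) (snd e) u)) M /\
    HS (fun e : nat * nat => uterm (fst e) (snd e) u) (Tu T u).
Proof.
  intros [_ [_ HT]] Ha Hb Hc.
  destruct (rt_SumLe (Re (ua u)) (Re (ub u)) (Re (uc u))) as [M HM];
    try (rewrite ?Re_ua, ?Re_ub, ?Re_uc; lra).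
  assert (HS1 : SumLe (fun e : nat * nat => Cmod (uterm (fst e) (snd e) u)) M).
  { eapply SumLe_le; [| |apply HM]; [|lra]. intros [i j]. apply Req_le, Cmod_tt. }
  exists M. split; auto.
  destruct (SumLe_HS _ _ HS1) as [s Hs].
  replace (Tu T u) with s; auto. symmetry. apply HT.
  apply HS_has_sum2 with M.
  - eapply SumLe_le; [| |apply HS1]; [|lra]. intros e. rewrite uterm_tornheim. lra.
  - eapply HS_ext; [|apply Hs]. intros e. rewrite uterm_tornheim. auto.
Qed.

Definition e1 : C3 := ivec 1 0 0.

Definition e2 : C3 := ivec 0 1 0.

(** The translations e2 and e1 lower a, respectively b, by one and raise c by one; the two terms are
    x_i / (x_i + x_j) and x_j / (x_i + x_j) times the original. *)
Lemma uterm_rel1 i j u : uterm i j (add3 u e2) + uterm i j (add3 u e1) = uterm i j u.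
Proof.
  pose proof (xx_ge1 i). pose proof (xx_ge1 j). unfold uterm.
  assert (E : forall w, - (uc u + 1) = w -> rc (xx i + xx j) w =
    rc (xx i + xx j) (- uc u) * / RtoC (xx i + xx j)).
  { intros w <-. replace (- (uc u + 1)) with (- uc u + -(1)) by ring.
    rewrite rc_plus, rc_m1 by lra. auto. }
  assert (Ep : forall x z w, (0 < x)%R -> z + 1 = w -> rc x w = rc x z * RtoC x).
  { intros x z w Hx <-. rewrite rc_plus. f_equal. rewrite rc_real, Rpower_1; auto. }
  rewrite (E (- uc (add3 u e2))), (E (- uc (add3 u e1))).
  - rewrite (Ep (xx i) (- ua u) (- ua (add3 u e2))), (Ep (xx j) (- ub u) (- ub (add3 u e1))); try lra.
    + replace (ub (add3 u e2)) with (ub u)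
        by (unfold ub, e2, ivec; rewrite cc_add3, ca_add3, cc_vec, ca_vec; ring).
      replace (ua (add3 u e1)) with (ua u)
        by (unfold ua, e1, ivec; rewrite cc_add3, cb_add3, cc_vec, cb_vec; ring).
      rewrite RtoC_plus. field. rewrite <- RtoC_plus. intros H1. apply RtoC_inj in H1. lra.
    + unfold ub, e1, ivec. rewrite cc_add3, ca_add3, cc_vec, ca_vec. ring.
    + unfold ua, e2, ivec. rewrite cc_add3, cb_add3, cc_vec, cb_vec. ring.
  - unfold uc, e1, ivec. rewrite ca_add3, cb_add3, cc_add3, ca_vec, cb_vec, cc_vec. ring.
  - unfold uc, e2, ivec. rewrite ca_add3, cb_add3, cc_add3, ca_vec, cb_vec, cc_vec. ring.
Qed.

Lemma Re_shift u x y z : Re (ca (add3 u (ivec x y z))) = (Re (ca u) + IZR x)%R /\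
  Re (cb (add3 u (ivec x y z))) = (Re (cb u) + IZR y)%R /\
  Re (cc (add3 u (ivec x y z))) = (Re (cc u) + IZR z)%R.
Proof. unfold ivec. rewrite ca_add3, cb_add3, cc_add3, !Re_plus. auto. Qed.

Lemma Tu_hol_shift T q x y z : is_meromorphic_continuation T -> good q ->
  hol q (fun u => Tu T (add3 u (ivec x y z))).
Proof.
  intros HT Hq. apply hol_shift, analytic_hol, Tu_analytic; auto.
  apply good_nonpolar, good_shift; auto.
Qed.

Lemma hol_opp p f : hol p f -> hol p (fun q => - f q).
Proof.
  intros H. apply hol_ext_good with (fun q => -(1) * f q); [intros; ring|].
  apply hol_mult; auto. apply analytic_hol, analytic_const.
Qed.

Lemma hol_minus p f g : hol p f -> hol p g -> hol p (fun q => f q - g q).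
Proof. intros. apply hol_plus; auto. apply hol_opp; auto. Qed.

(* 1/(mn) = (1/m + 1/n) / (m + n). *)
Lemma rel1 T u : is_meromorphic_continuation T -> good u ->
  Tu T u = Tu T (add3 u e2) + Tu T (add3 u e1).
Proof.
  intros HT Hu. apply Ceq_minus.
  (* The region only has to contain u, so its bounds are taken just below the real parts of u. *)
  apply (identity (fun u => Tu T u - (Tu T (add3 u e2) + Tu T (add3 u e1)))
    (Re (ca u) - 1) (Re (cb u) - 1) (Re (cc u) - 1) 0); auto; try lra.
  - intros q _ _ _ Hq. apply hol_minus; [|apply hol_plus; apply Tu_hol_shift; auto].
    apply analytic_hol, Tu_analytic; auto. apply good_nonpolar; auto.
  - intros q Ha Hb Hc Hq.
    destruct (Tu_HS T q HT) as [_ [_ H0]]; auto.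
    destruct (Re_shift q 0 1 0) as [A1 [A2 A3]].
    destruct (Re_shift q 1 0 0) as [B1 [B2 B3]].
    destruct (Tu_HS T (add3 q e2) HT) as [_ [_ H2]]; try (unfold e2; lra).
    destruct (Tu_HS T (add3 q e1) HT) as [_ [_ H1]]; try (unfold e1; lra).
    rewrite (HS_unique _ _ _ H0 (HS_ext _ _ _ (fun e => uterm_rel1 (fst e) (snd e) q)
      (HS_plus _ _ _ _ H2 H1))). ring.
Qed.

Lemma uterm_swap i j u : uterm j i (swap u) = uterm i j u.
Proof.
  unfold uterm. replace (ua (swap u)) with (ub u) by (unfold ua, ub, swap, ca, cb, cc; simpl; ring).
  replace (ub (swap u)) with (ua u) by (unfold ua, ub, swap, ca, cb, cc; simpl; ring).
  replace (uc (swap u)) with (uc u) by (unfold uc, swap, ca, cb, cc; simpl; ring).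
  rewrite (Rplus_comm (xx j)). ring.
Qed.

Lemma Tu_swap T u : is_meromorphic_continuation T -> good u -> Tu T (swap u) = Tu T u.
Proof.
  intros HT Hu. apply Ceq_minus.
  apply (identity (fun u => Tu T (swap u) - Tu T u)
    (Re (ca u) - 1) (Re (cb u) - 1) (Re (cc u) - 1) 0); auto; try lra.
  - intros q _ _ _ Hq. apply hol_minus.
    + apply hol_swap, analytic_hol, Tu_analytic; auto. apply good_nonpolar, good_swap; auto.
    + apply analytic_hol, Tu_analytic; auto. apply good_nonpolar; auto.
  - intros q Ha Hb Hc Hq.
    destruct (Tu_HS T q HT) as [_ [_ H0]]; auto.
    destruct (Tu_HS T (swap q) HT) as [_ [_ H1]]; auto.
    apply HS_swap in H1. simpl in H1.
    rewrite (HS_unique _ _ _ H1 (HS_ext _ _ _ (fun e => eq_sym (uterm_swap (fst e) (snd e) q)) H0)).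
    ring.
Qed.

Definition Rf (L : list (nat * nat)) (u : C3) : C := bdry u - RemTot L u.

Definition far (L : list (nat * nat)) (K : nat) : Prop :=
  NoDup L /\ forall e, ~ In e L -> (K <= fst e + snd e)%nat.

Lemma Rf_analytic L K p : far L K ->
  (- INR K < Re (ca p))%R -> (0 < Re (cb p))%R -> (- INR K < Re (cc p))%R ->
  analytic p (Rf L).
Proof.
  intros [HL HK] Ha Hb Hc. apply analytic_minus; [apply bdry_analytic; auto|].
  apply RemTot_analytic with K; auto.
Qed.

Definition Tsum (T : C3 -> C) (L : list (nat * nat)) (u : C3) : C :=
  csum L (fun e => dsig (fst e + snd e) * cf u e * Tu T (add3 u (sh e))).

Lemma analytic_ua p : analytic p ua.
Proof. exists 1%R. eexists. split; [lra|]. apply W_ua'; lra. Qed.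

Lemma analytic_cf p e : analytic p (fun u => cf u e).
Proof.
  apply analytic_mult; exists 1%R; eexists; (split; [lra|]).
  - apply W_bc; [lra|apply W_ua'; lra].
  - apply W_bc; [lra|apply W_uc'; lra].
Qed.

(** Where everything converges, summing the orders in L over all (i, j) gives the telescoped total
    minus the remainder. The right side is analytic on a domain that grows with K, and the identity
    theorem carries the relation there. *)
Lemma relE T L K u : is_meromorphic_continuation T -> far L K -> good u ->
  (- INR K < Re (ca u))%R -> (0 < Re (cb u))%R -> (- INR K < Re (cc u))%R ->
  Tsum T L u = Rf L u.
Proof.
  intros HT HL Hu Ha Hb Hc. apply Ceq_minus.
  apply (identity (fun u => Tsum T L u - Rf L u) (- INR K) 0 (- INR K) 0); auto.
  - intros q Ha' Hb' Hc' Hq. apply hol_minus.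
    + apply hol_csum. intros e _. apply hol_mult.
      * apply analytic_hol, analytic_mult; [apply analytic_const|apply analytic_cf].
      * apply Tu_hol_shift; auto.
    + apply analytic_hol, Rf_analytic with K; auto.
  - intros q Ha' Hb' Hc' Hq.
    pose proof (pos_INR K) as HK0. destruct HL as [HL HK].
    destruct (RemTot_HS L K q HL HK) as [_ [_ HR]]; try lra.
    pose proof (HS_minus _ _ _ _ (gd_total q Ha' Hb' Hc') HR) as HD.
    assert (HS1 : HS (fun p : nat * nat => csum L (fun e => gterm (fst p) (snd p) e q)) (Tsum T L q)).
    { apply HS_csum. intros e _. unfold gterm.
      destruct (Re_shift q (Z.of_nat (fst e + snd e)) (Z.of_nat (snd e)) (Z.of_nat (fst e + snd e)))
        as [A1 [A2 A3]].
      rewrite <- !INR_IZR_INZ in A1, A2, A3.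
      pose proof (pos_INR (fst e + snd e)). pose proof (pos_INR (snd e)).
      destruct (Tu_HS T (add3 q (sh e)) HT) as [_ [_ H2]];
        try (unfold sh; lra).
      apply HS_scal; auto. }
    assert (E : Tsum T L q = Rf L q); [|rewrite E; ring].
    apply (HS_unique _ _ _ HS1). eapply HS_ext; [|apply HD].
    intros e. cbv beta. unfold Rem. ring.
Qed.

(** * Pole structure of T *)

(** The orders of degree at most one, which are evaluated explicitly; [LH K] holds those of degree
    from 2 to K - 1. *)
Definition L2 : list (nat * nat) := ((0, 0) :: (1, 0) :: (0, 1) :: nil)%nat.

Lemma far_L2 : far L2 2.
Proof.
  split.
  - repeat constructor; simpl; intuition congruence.
  - intros [i j] H. simpl in *.
    destruct i as [|[|i]], j as [|[|j]]; simpl in *; try lia; exfalso; apply H; auto.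
Qed.

Definition LH (K : nat) : list (nat * nat) :=
  filter (fun e => andb (2 <=? fst e + snd e)%nat (fst e + snd e <? K)%nat) (list_prod (seq 0 K) (seq 0 K)).

Definition LK (K : nat) : list (nat * nat) := L2 ++ LH K.

Lemma in_LH K e : In e (LH K) <-> (2 <= fst e + snd e < K)%nat.
Proof.
  unfold LH. rewrite filter_In, Bool.andb_true_iff, Nat.leb_le, Nat.ltb_lt.
  split; [tauto|]. intros H. split; auto. destruct e as [i j]. simpl in *.
  apply in_prod; apply in_seq; lia.
Qed.

Lemma NoDup_list_prod {I J} (L : list I) (K : list J) : NoDup L -> NoDup K -> NoDup (list_prod L K).
Proof.
  intros HL HK. induction L as [|i L IH]; simpl; [constructor|].
  inversion HL; subst. apply NoDup_app; auto.
  - apply NoDup_map_inj; auto. intros; congruence.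
  - intros [i' j] H5 H6. apply in_map_iff in H5 as [j' [H5 _]].
    apply in_prod_iff in H6 as [H6 _]. congruence.
Qed.

Lemma far_LK K : (2 <= K)%nat -> far (LK K) K.
Proof.
  intros HK. split.
  - apply NoDup_app; [apply far_L2|apply NoDup_filter, NoDup_list_prod; apply seq_NoDup|].
    intros e H1 H2. apply in_LH in H2. simpl in H1.
    destruct H1 as [<-|[<-|[<-|[]]]]; simpl in H2; lia.
  - intros e H. destruct (Nat.le_gt_cases K (fst e + snd e)) as [|Hlt]; auto. exfalso.
    apply H, in_or_app.
    destruct (in_dec (fun x y : nat * nat => eqd x y) e L2) as [|Hn]; auto.
    right. apply in_LH. split; auto. apply far_L2; auto.
Qed.

Lemma dsig_0 : dsig 0 = 0.
Proof. unfold dsig; simpl. rewrite Rminus_diag_eq; auto. Qed.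

Lemma dsig_1 : dsig 1 = -(1).
Proof. unfold dsig; simpl. rewrite <- RtoC_opp. f_equal. field. Qed.

Lemma bc_0 a : bc a 0 = 1.
Proof. unfold bc; simpl. field. Qed.

Lemma bc_1 a : bc a 1 = a.
Proof. unfold bc; simpl. field. Qed.

Ltac c3 := apply C3_eq; unfold e1, e2, sh, ivec, swap in *; simpl;
  unfold ca, cb, cc, add3, vec; simpl; unfold ca, cb, cc; simpl.

Lemma Tsum_L2 T u : Tsum T L2 u =
  - (ua u * Tu T (add3 u (ivec 1 0 1)) + uc u * Tu T (add3 u (ivec 1 1 1))).
Proof.
  transitivity (dsig 0 * cf u (0, 0)%nat * Tu T (add3 u (sh (0, 0)%nat)) +
    (dsig 1 * (bc (ua u) 1 * bc (uc u) 0) * Tu T (add3 u (ivec 1 0 1)) +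
    (dsig 1 * (bc (ua u) 0 * bc (uc u) 1) * Tu T (add3 u (ivec 1 1 1)) + 0))); [reflexivity|].
  rewrite dsig_0, dsig_1, !bc_1, !bc_0. ring.
Qed.

(** Lowers a by one, so that the (1,0)-term of [relE] falls on T at u itself. *)
Definition w1 : C3 := ivec (-1) 0 (-1).

(* [relE] for K = 2, added to its image under the symmetry and [rel1], leaves cc u * T only. *)
Lemma fstep T u : is_meromorphic_continuation T -> good u ->
  (0 < Re (ca u))%R -> (0 < Re (cb u))%R -> (-1 < Re (cc u))%R ->
  cc u * Tu T u = - (Rf L2 (add3 u w1) + Rf L2 (add3 (swap u) w1)).
Proof.
  intros HT Hu Ha Hb Hc.
  assert (H1 : Tsum T L2 (add3 u w1) = Rf L2 (add3 u w1)).
  { destruct (Re_shift u (-1) 0 (-1)) as [A1 [A2 A3]].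
    apply relE with 2%nat; auto; [apply far_L2|apply good_shift; auto| | |];
      unfold w1; simpl INR; lra. }
  assert (H2 : Tsum T L2 (add3 (swap u) w1) = Rf L2 (add3 (swap u) w1)).
  { destruct (Re_shift (swap u) (-1) 0 (-1)) as [A1 [A2 A3]].
    change (ca (swap u)) with (cb u) in *. change (cb (swap u)) with (ca u) in *.
    change (cc (swap u)) with (cc u) in *.
    apply relE with 2%nat; auto; [apply far_L2|apply good_shift, good_swap; auto| | |];
      unfold w1; simpl INR; lra. }
  rewrite <- H1, <- H2, !Tsum_L2.
  replace (add3 (add3 u w1) (ivec 1 0 1)) with u by (unfold w1; c3; ring).
  replace (add3 (add3 u w1) (ivec 1 1 1)) with (add3 u e2) by (unfold w1; c3; ring).
  replace (add3 (add3 (swap u) w1) (ivec 1 0 1)) with (swap u) by (unfold w1; c3; ring).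
  replace (add3 (add3 (swap u) w1) (ivec 1 1 1)) with (swap (add3 u e1)) by (unfold w1; c3; ring).
  rewrite !Tu_swap by (try apply good_shift; auto).
  pose proof (rel1 T u HT Hu) as HR.
  assert (E : Tu T (add3 u e1) = Tu T u - Tu T (add3 u e2)) by (rewrite HR; ring).
  rewrite E. unfold w1, ivec. unfold ua, uc, swap, add3, vec, ca, cb, cc; simpl. ring.
Qed.

Lemma box_Re p r q : box p r q -> (Rabs (Re (ca q) - Re (ca p)) <= r)%R /\
  (Rabs (Re (cb q) - Re (cb p)) <= r)%R /\ (Rabs (Re (cc q) - Re (cc p)) <= r)%R.
Proof.
  intros [H1 [H2 H3]]. unfold cx, cy, cz in *.
  rewrite <- !Re_minus. repeat split; (eapply Rle_trans; [apply Re_le_mod|auto]).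
Qed.

Lemma holv_near p f g v x y z : holv p f v ->
  (x < Re (ca p))%R -> (y < Re (cb p))%R -> (z < Re (cc p))%R ->
  (forall q, good q -> (x < Re (ca q))%R -> (y < Re (cb q))%R -> (z < Re (cc q))%R -> f q = g q) ->
  holv p g v.
Proof.
  intros Hf Hx Hy Hz H. apply (holv_ext p f); auto.
  destruct (radius3 (Re (ca p) - x) (Re (cb p) - y) (Re (cc p) - z)) as [r [Hr [R1 [R2 R3]]]]; try lra.
  exists (r / 2)%R. split; [lra|]. intros q Hq Hg.
  destruct (box_Re p _ q Hq) as [B1 [B2 B3]].
  apply Rabs_le_between in B1, B2, B3. apply H; auto; lra.
Qed.

Lemma hol_near p f g x y z : hol p f ->
  (x < Re (ca p))%R -> (y < Re (cb p))%R -> (z < Re (cc p))%R ->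
  (forall q, good q -> (x < Re (ca q))%R -> (y < Re (cb q))%R -> (z < Re (cc q))%R -> f q = g q) ->
  hol p g.
Proof. intros [v Hv] Hx Hy Hz H. exists v. eapply holv_near; eauto. Qed.

Lemma analytic_cx p q : analytic q (cx p).
Proof. apply analytic_minus; [apply analytic_ca|apply analytic_const]. Qed.

Lemma analytic_cy p q : analytic q (cy p).
Proof. apply analytic_minus; [apply analytic_cb|apply analytic_const]. Qed.

Lemma analytic_cz p q : analytic q (cz p).
Proof. apply analytic_minus; [apply analytic_cc|apply analytic_const]. Qed.

(** With positive real parts of A_0 and B_0 the only polar hyperplane that can meet p is F = 0, and
    there [fstep] applies. *)
Lemma hol_F T p : is_meromorphic_continuation T ->
  (0 < Re (ca p))%R -> (0 < Re (cb p))%R -> hol p (fun u => cz p u * Tu T u).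
Proof.
  intros HT Ha Hb. destruct (classic (cc p = 0)) as [H0|H0].
  - apply (hol_near p (fun u => - (Rf L2 (add3 u w1) + Rf L2 (add3 (swap u) w1))) _ 0 0 (-1)); auto.
    + apply hol_opp, hol_plus.
      * apply hol_shift, analytic_hol, Rf_analytic with 2%nat; [apply far_L2| | |];
        destruct (Re_shift p (-1) 0 (-1)) as [A1 [A2 A3]]; rewrite ?A1, ?A2, ?A3, ?H0; simpl INR;
        rewrite ?re_RtoC; lra.
      * apply (hol_swap p (fun u => Rf L2 (add3 u w1))).
        apply hol_shift, analytic_hol, Rf_analytic with 2%nat; [apply far_L2| | |];
        destruct (Re_shift (swap p) (-1) 0 (-1)) as [A1 [A2 A3]]; rewrite ?A1, ?A2, ?A3;
        change (ca (swap p)) with (cb p); change (cb (swap p)) with (ca p);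
        change (cc (swap p)) with (cc p); rewrite ?H0; simpl INR; rewrite ?re_RtoC; lra.
    + rewrite H0, re_RtoC. lra.
    + intros q Hq Ha' Hb' Hc'. rewrite <- (fstep T q); auto. unfold cz. rewrite H0. ring.
  - apply hol_mult; [apply analytic_hol, analytic_cz|].
    apply (analytic_hol p (Tu T)), Tu_analytic; auto.
    split; [|split]; auto; apply Re_pos_not_natpole; auto.
Qed.

(** Lowers c by one, so that the (0,1)-term of [relE] falls on T at u itself. *)
Definition w2 : C3 := ivec (-1) (-1) (-1).

(** Lowering B_0 by one followed by the translation e1: the second point that [rel1] produces in
    [astep]. *)
Definition v0 : C3 := ivec 1 (-1) 0.

(** Orders of degree at least 2 raise A_0 and F by at least one and lower B_0 by at most one; this
    drives the descent. *)
Definition vsh (e : nat * nat) : C3 :=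
  ivec (Z.of_nat (fst e + snd e) - 1) (Z.of_nat (snd e) - 1) (Z.of_nat (fst e + snd e) - 1).

Lemma add3_sh_w2 u e : add3 (add3 u w2) (sh e) = add3 u (vsh e).
Proof.
  unfold w2, vsh, sh, ivec. rewrite !minus_IZR.
  apply C3_eq; rewrite ?ca_add3, ?cb_add3, ?cc_add3, ?ca_vec, ?cb_vec, ?cc_vec, ?RtoC_minus; ring.
Qed.

(* [relE] at u + w2; its (1,0)-term is the value at u - (0,1,0), expanded by [rel1]. *)
Lemma astep T K u : is_meromorphic_continuation T -> (2 <= K)%nat -> good u ->
  (1 - INR K < Re (ca u))%R -> (1 < Re (cb u))%R -> (1 - INR K < Re (cc u))%R ->
  ca u * Tu T u = - ua u * Tu T (add3 u v0) +
    csum (LH K) (fun e => dsig (fst e + snd e) * cf (add3 u w2) e * Tu T (add3 u (vsh e))) -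
    Rf (LK K) (add3 u w2).
Proof.
  intros HT HK Hu Ha Hb Hc.
  assert (H1 : Tsum T (LK K) (add3 u w2) = Rf (LK K) (add3 u w2)).
  { destruct (Re_shift u (-1) (-1) (-1)) as [A1 [A2 A3]].
    apply relE with K; auto; [apply far_LK; auto|apply good_shift; auto| | |];
      unfold w2; lra. }
  rewrite <- H1. unfold Tsum at 1, LK. rewrite csum_app.
  change (csum L2 _) with (Tsum T L2 (add3 u w2)). rewrite Tsum_L2.
  rewrite (csum_ext (LH K) (fun e => dsig (fst e + snd e) * cf (add3 u w2) e *
    Tu T (add3 (add3 u w2) (sh e))) (fun e => dsig (fst e + snd e) * cf (add3 u w2) e * Tu T (add3 u (vsh e))))
    by (intros; rewrite add3_sh_w2; auto).
  set (Sg := csum (LH K) _).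
  replace (add3 (add3 u w2) (ivec 1 1 1)) with u by (unfold w2; c3; ring).
  set (v := add3 u (ivec 0 (-1) 0)).
  replace (add3 (add3 u w2) (ivec 1 0 1)) with v by (unfold v, w2; c3; ring).
  rewrite (rel1 T v HT) by (apply good_shift; auto).
  replace (add3 v e2) with u by (unfold v; c3; ring).
  replace (add3 v e1) with (add3 u v0) by (unfold v, v0; c3; ring).
  unfold w2, ivec. unfold ua, uc, add3, vec, ca, cb, cc; simpl. ring.
Qed.

Lemma hol_ext_all p f g : (forall q, f q = g q) -> hol p f -> hol p g.
Proof. intros H. apply hol_ext_good; auto. Qed.

Lemma hol_scal_analytic p f g : analytic p f -> hol p g -> hol p (fun q => f q * g q).
Proof. intros. apply hol_mult; auto. apply analytic_hol; auto. Qed.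

(* [m] clears the poles of all the terms on the right of [astep]. *)
Lemma astep_holv T p m w we : is_meromorphic_continuation T -> (1 < Re (cb p))%R ->
  (forall q, analytic q m) ->
  holv p (fun u => m u * Tu T (add3 u v0)) w ->
  (forall e, (2 <= fst e + snd e)%nat -> holv p (fun u => m u * Tu T (add3 u (vsh e))) (we e)) ->
  exists K R, holv p (fun u => m u * (ca u * Tu T u))
    (- ua p * w + csum (LH K) (fun e => dsig (fst e + snd e) * cf (add3 p w2) e * we e) + m p * R).
Proof.
  intros HT Hb Hm H0 He.
  (* K is taken so large that p + w2 lies where the remainder of order K is analytic; the 2 added
     below gives [2 <= K]. *)
  destruct (INR_archimed 1 (Rmax (2 - Re (ca p)) (2 - Re (cc p)))) as [K0 HK0]; [lra|].
  pose proof (Rmax_l (2 - Re (ca p)) (2 - Re (cc p))).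
  pose proof (Rmax_r (2 - Re (ca p)) (2 - Re (cc p))).
  set (K := (K0 + 2)%nat).
  assert (HK : (INR K = INR K0 + 2)%R) by (unfold K; rewrite plus_INR; simpl; lra).
  exists K, (- Rf (LK K) (add3 p w2)).
  apply (holv_near p (fun u => (- ua u * (m u * Tu T (add3 u v0)) +
    csum (LH K) (fun e => dsig (fst e + snd e) * cf (add3 u w2) e * (m u * Tu T (add3 u (vsh e)))) +
    m u * - Rf (LK K) (add3 u w2))) _ _ (1 - INR K) 1 (1 - INR K)); auto; try lra.
  - apply holv_plus; [apply holv_plus|].
    + apply holv_mult; auto. apply (analytic_holv p (fun u => - ua u)), analytic_opp, analytic_ua.
    + apply holv_csum. intros e HIn. apply in_LH in HIn.
      apply (holv_mult p (fun u => dsig (fst e + snd e) * cf (add3 u w2) e)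
        (fun u => m u * Tu T (add3 u (vsh e)))); [|apply He; lia].
      apply (analytic_holv p (fun u => dsig (fst e + snd e) * cf (add3 u w2) e)).
      apply analytic_mult; [apply analytic_const|].
      apply (analytic_shift p (fun u => cf u e)), analytic_cf.
    + apply holv_mult; [apply analytic_holv; auto|].
      apply (analytic_holv p (fun u => - Rf (LK K) (add3 u w2))), analytic_opp.
      apply (analytic_shift p (Rf (LK K))).
      destruct (Re_shift p (-1) (-1) (-1)) as [A1 [A2 A3]].
      apply Rf_analytic with K; [apply far_LK; unfold K; lia| | |];
      unfold w2; rewrite ?A1, ?A2, ?A3; lra.
  - intros q Hq Ha' Hb' Hc'. rewrite (astep T K q); auto; [|unfold K; lia].
    assert (E : forall L, csum L (fun e => dsig (fst e + snd e) * cf (add3 q w2) e *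
       (m q * Tu T (add3 q (vsh e)))) = m q * csum L (fun e => dsig (fst e + snd e) *
       cf (add3 q w2) e * Tu T (add3 q (vsh e)))).
    { intros L. rewrite <- csum_scal. apply csum_ext. intros. ring. }
    rewrite E. ring.
Qed.

(** Only the existence of extended values matters here; [epsilon] names one for every higher
    term. *)
Lemma astep_hol T p m : is_meromorphic_continuation T -> (1 < Re (cb p))%R ->
  (forall q, analytic q m) ->
  hol p (fun u => m u * Tu T (add3 u v0)) ->
  (forall e, (2 <= fst e + snd e)%nat -> hol p (fun u => m u * Tu T (add3 u (vsh e)))) ->
  hol p (fun u => m u * (ca u * Tu T u)).
Proof.
  intros HT Hb Hm [w H0] He.
  destruct (astep_holv T p m w (fun e => epsilon (inhabits (RtoC 0))
    (holv p (fun u => m u * Tu T (add3 u (vsh e))))) HT Hb Hm H0) as [K [R H]].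
  - intros e H2. apply epsilon_spec, He; auto.
  - eexists; apply H.
Qed.

(** Isolates the term at v0: the remainder is killed by m p = 0, the higher terms by their value
    0. *)
Lemma astep_holv0 T p m w : is_meromorphic_continuation T -> (1 < Re (cb p))%R ->
  (forall q, analytic q m) -> m p = 0 ->
  holv p (fun u => m u * Tu T (add3 u v0)) w ->
  (forall e, (2 <= fst e + snd e)%nat -> holv p (fun u => m u * Tu T (add3 u (vsh e))) 0) ->
  holv p (fun u => m u * (ca u * Tu T u)) (- ua p * w).
Proof.
  intros HT Hb Hm Hm0 H0 He.
  destruct (astep_holv T p m w (fun _ => 0) HT Hb Hm H0 He) as [K [R H]].
  rewrite Hm0 in H. replace (- ua p * w) with (- ua p * w + csum (LH K)
    (fun e => dsig (fst e + snd e) * cf (add3 p w2) e * 0) + 0 * R); auto.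
  rewrite (csum_ext (LH K) _ (fun _ => 0 * 0)) by (intros; ring). rewrite csum_scal. ring.
Qed.

Lemma cx_shift p u v : cx (add3 p v) (add3 u v) = cx p u.
Proof. unfold cx. rewrite !ca_add3. ring. Qed.

Lemma cy_shift p u v : cy (add3 p v) (add3 u v) = cy p u.
Proof. unfold cy. rewrite !cb_add3. ring. Qed.

Lemma cz_shift p u v : cz (add3 p v) (add3 u v) = cz p u.
Proof. unfold cz. rewrite !cc_add3. ring. Qed.

(** Each use of [astep] gains at least one in Re A_0 and costs at most one in Re B_0, hence the
    requirement Re B_0 > M + 1. *)
Lemma hol_A T : is_meromorphic_continuation T -> forall (M : nat) p,
  (- INR M < Re (ca p))%R -> (INR M + 1 < Re (cb p))%R ->
  hol p (fun u => cx p u * cz p u * Tu T u).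
Proof.
  intros HT. induction M as [|M IH]; intros p Ha Hb.
  - simpl in *.
    apply hol_ext_all with (fun u => cx p u * (cz p u * Tu T u)); [intros; ring|].
    apply hol_scal_analytic; [apply analytic_cx|]. apply hol_F; auto; lra.
  - rewrite S_INR in *. pose proof (pos_INR M) as HM.
    destruct (Re_shift p 1 (-1) 0) as [A1 [A2 A3]].
    assert (Hv : forall e, (2 <= fst e + snd e)%nat ->
      (Re (ca p) + 1 <= Re (ca (add3 p (vsh e))))%R /\ (Re (cb p) - 1 <= Re (cb (add3 p (vsh e))))%R).
    { intros e He. unfold vsh.
      destruct (Re_shift p (Z.of_nat (fst e + snd e) - 1) (Z.of_nat (snd e) - 1)
        (Z.of_nat (fst e + snd e) - 1)) as [B1 [B2 _]].
      rewrite B1, B2, !minus_IZR, <- !INR_IZR_INZ.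
      apply le_INR in He. simpl in He. pose proof (pos_INR (snd e)). lra. }
    (* If A_0 vanishes at p it is the coordinate X itself, and all shifted points already have Re
       A_0 > 0. Otherwise A_0 is invertible and X is carried through the induction. *)
    destruct (classic (ca p = 0)) as [H0|H0].
    + apply hol_ext_all with (fun u => cz p u * (ca u * Tu T u)).
      { intros q. unfold cx. rewrite H0. ring. }
      rewrite H0, re_RtoC in *.
      apply astep_hol; auto; [lra|intros; apply analytic_cz| |].
      * apply hol_ext_all with (fun u => cz (add3 p v0) (add3 u v0) * Tu T (add3 u v0)).
        { intros; rewrite cz_shift; auto. }
        apply (hol_shift p (fun u => cz (add3 p v0) u * Tu T u)).
        apply hol_F; auto; fold v0 in *; lra.
      * intros e He. destruct (Hv e He).
        apply hol_ext_all with (fun u => cz (add3 p (vsh e)) (add3 u (vsh e)) * Tu T (add3 u (vsh e))).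
        { intros; rewrite cz_shift; auto. }
        apply (hol_shift p (fun u => cz (add3 p (vsh e)) u * Tu T u)).
        apply hol_F; auto; fold (vsh e); lra.
    + apply hol_near with (fun u => / ca u * ((cx p u * cz p u) * (ca u * Tu T u)))
        (Re (ca p) - 1)%R (Re (cb p) - 1)%R (Re (cc p) - 1)%R; try lra.
      2:{ intros q Hq _ _ _. field. destruct (Hq 0%Z); auto. }
      apply hol_scal_analytic; [apply analytic_inv_ca; auto|].
      apply astep_hol; auto; [lra|intros; apply analytic_mult; [apply analytic_cx|apply analytic_cz]| |].
      * apply hol_ext_all with (fun u => cx (add3 p v0) (add3 u v0) * cz (add3 p v0) (add3 u v0) * Tu T (add3 u v0)).
        { intros; rewrite cx_shift, cz_shift; auto. }
        apply (hol_shift p (fun u => cx (add3 p v0) u * cz (add3 p v0) u * Tu T u)).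
        apply IH; fold v0 in *; lra.
      * intros e He. destruct (Hv e He).
        apply hol_ext_all with (fun u => cx (add3 p (vsh e)) (add3 u (vsh e)) *
          cz (add3 p (vsh e)) (add3 u (vsh e)) * Tu T (add3 u (vsh e))).
        { intros; rewrite cx_shift, cz_shift; auto. }
        apply (hol_shift p (fun u => cx (add3 p (vsh e)) u * cz (add3 p (vsh e)) u * Tu T u)).
        apply IH; fold (vsh e); lra.
Qed.

(* T = g1 / (X Z) + g2 / (Y Z) near p. *)
Definition two_term (T : C3 -> C) (p : C3) : Prop :=
  exists g1 g2, hol p g1 /\ hol p g2 /\ forall u, good u ->
    cx p u * cy p u * cz p u * Tu T u = cy p u * g1 u + cx p u * g2 u.

(** A use of [rel1] raises Re A_0 + Re B_0 by one and preserves the centred coordinates, so the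
    numerators simply add. Once the sum exceeds 4 M + 4, one of the two real parts exceeds M + 1,
    and [hol_A] applies to p or to its mirror image. *)
Lemma two_term_all T : is_meromorphic_continuation T -> forall (M n : nat) p,
  (- INR M < Re (ca p))%R -> (- INR M < Re (cb p))%R ->
  (4 * INR M + 4 - INR n < Re (ca p) + Re (cb p))%R -> two_term T p.
Proof.
  intros HT M n. pose proof (pos_INR M) as HM.
  induction n as [|n IH]; intros p Ha Hb Hs.
  - simpl INR in Hs. destruct (Rlt_or_le (INR M + 1) (Re (cb p))) as [H|H].
    + exists (fun u => cx p u * cz p u * Tu T u), (fun _ => 0). split; [|split].
      * apply hol_A with M; auto.
      * apply analytic_hol, analytic_const.
      * intros; ring.
    + exists (fun _ => 0), (fun u => cx (swap p) (swap u) * cz (swap p) (swap u) * Tu T (swap u)).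
      split; [|split].
      * apply analytic_hol, analytic_const.
      * apply (hol_swap p (fun u => cx (swap p) u * cz (swap p) u * Tu T u)).
        apply hol_A with M; auto; change (ca (swap p)) with (cb p); change (cb (swap p)) with (ca p); lra.
      * intros u Hu. rewrite Tu_swap by auto.
        change (cx (swap p) (swap u)) with (cy p u). change (cz (swap p) (swap u)) with (cz p u). ring.
  - rewrite S_INR in Hs.
    destruct (Re_shift p 0 1 0) as [A1 [A2 A3]]. destruct (Re_shift p 1 0 0) as [B1 [B2 B3]].
    destruct (IH (add3 p e2)) as [g1 [g2 [G1 [G2 G]]]]; try (unfold e2; lra).
    destruct (IH (add3 p e1)) as [h1 [h2 [H1 [H2 H]]]]; try (unfold e1; lra).
    exists (fun u => g1 (add3 u e2) + h1 (add3 u e1)), (fun u => g2 (add3 u e2) + h2 (add3 u e1)).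
    split; [|split].
    + apply hol_plus; apply hol_shift; auto.
    + apply hol_plus; apply hol_shift; auto.
    + intros u Hu. rewrite (rel1 T u HT Hu).
      specialize (G (add3 u e2) (good_shift _ _ _ _ Hu)).
      specialize (H (add3 u e1) (good_shift _ _ _ _ Hu)).
      rewrite cx_shift, cy_shift, cz_shift in G, H.
      rewrite Cmult_plus_distr_l, G, H. ring.
Qed.

Lemma two_term_any T p : is_meromorphic_continuation T -> two_term T p.
Proof.
  intros HT.
  destruct (INR_archimed 1 (Rmax (- Re (ca p)) (- Re (cb p)))) as [M HM]; [lra|].
  pose proof (Rmax_l (- Re (ca p)) (- Re (cb p))).
  pose proof (Rmax_r (- Re (ca p)) (- Re (cb p))).
  destruct (INR_archimed 1 (4 * INR M + 4 - (Re (ca p) + Re (cb p)))) as [n Hn]; [lra|].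
  apply (two_term_all T HT M n); lra.
Qed.

(* Removing a spurious factor: if Z f is analytic and f is analytic at the
   nearby points of Z = 0 whose other coordinates are not integers, then the
   part of Z f that does not depend on Z vanishes. *)
Lemma div_z p f : hol p (fun u => cz p u * f u) -> (forall q, good q -> analytic q f) ->
  (forall q, good q -> hol (ca q, cb q, cc p) f) -> hol p f.
Proof.
  intros [v Hv] Hga Hz.
  destruct (holv_germ _ _ _ Hv) as [r0 [S [Hr0 [[r1 [N [Hr1 HS]]] [_ HG]]]]].
  destruct (radius2 r0 r1 Hr0 Hr1) as [r [Hr [R0 R1]]].
  apply (Wat_shrink p r1 r) in HS; [|lra].
  destruct (W_split _ _ _ _ _ _ Hr HS) as [g [S1 [_ [HS1 Hsp]]]].
  assert (Hg0 : forall q, box p r q -> good q -> g (cx p q) (cy p q) = 0).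
  { intros q [B1 [B2 B3]] Hgq. set (q0 := (ca q, cb q, cc p) : C3).
    assert (Z0 : cz p q0 = 0) by (unfold cz, q0, cc; simpl; ring).
    assert (Hq0 : box p r q0) by (unfold box, inbox; rewrite Z0, Cmod_0; repeat split; auto; lra).
    destruct (HG q0) as [_ H1]; [apply (box_le p r0 r); auto|].
    destruct (Hz q Hgq) as [w Hw].
    assert (H2 : holv q0 (fun u => cz p u * f u) (cz p q0 * w))
      by (apply holv_mult; auto; apply analytic_holv, analytic_cz).
    pose proof (holv_unique _ _ _ _ H1 H2) as E.
    rewrite (Hsp q0 Hq0), Z0 in E.
    change (cx p q0) with (cx p q) in E. change (cy p q0) with (cy p q) in E.
    rewrite <- (Cplus_0_r (g _ _)), <- (Cmult_0_l (S1 q0)), E. ring. }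
  exists (S1 p), (r / 2)%R, (N / r)%R, S1. split; [lra|].
  split; [apply (Wat_shrink p r); auto; lra|]. split; auto.
  assert (Hne : forall q, box p r q -> good q -> cz p q <> 0 -> f q = S1 q).
  { intros q Hq Hgq Hn.
    assert (E : cz p q * f q = S q).
    { destruct (HG q) as [H1 H2]; [apply (box_le p r0 r); auto|].
      apply (holv_unique q (fun u => cz p u * f u)); auto.
      apply (analytic_holv q (fun u => cz p u * f u)), analytic_mult; [apply analytic_cz|auto]. }
    rewrite (Hsp q Hq), (Hg0 q Hq Hgq) in E.
    replace (f q) with (/ cz p q * (cz p q * f q)) by (field; auto). rewrite E. field; auto. }
  intros q Hq Hgq.
  destruct (classic (cz p q = 0)) as [H0|H0];
    [|apply Hne; auto; apply (box_le p r (r / 2)); auto; lra].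
  destruct Hq as [B1 [B2 B3]].
  destruct (Wat_recenter p r (N / r) S1 q HS1) as [r' [Hr' [HS1' _]]]; try lra.
  apply (analytic_eq_dir q 0 0 1); [apply Hga; auto|exists r', (N / r)%R; auto|].
  destruct (C_not_int (cc q)) as [d [Hd Hdn]].
  destruct (radius2 d r Hd Hr) as [t [Ht [T1 T2]]].
  exists t. split; auto. intros e He.
  rewrite !Rmult_0_r, Rmult_1_r.
  assert (Ze : cz p (add3 q (vec 0 0 e)) = RtoC e).
  { unfold cz in *. rewrite cc_add3, cc_vec.
    replace (cc q + RtoC e - cc p) with ((cc q - cc p) + RtoC e) by ring. rewrite H0; ring. }
  apply Hne.
  - unfold box, inbox. rewrite Ze. unfold cx, cy in *.
    rewrite ca_add3, cb_add3, ca_vec, cb_vec, !Cplus_0_r, Cmod_R, Rabs_pos_eq; repeat split; lra.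
  - intros n. rewrite ca_add3, cb_add3, cc_add3, ca_vec, cb_vec, cc_vec, !Cplus_0_r.
    destruct (Hgq n) as [? [? ?]]. repeat split; auto. apply Hdn; lra.
  - rewrite Ze. intros H5. apply RtoC_inj in H5. lra.
Qed.

Lemma div_perm s p f : transposition s ->
  hol p (fun u => cz (s p) (s u) * f u) -> (forall q, good q -> analytic q f) ->
  (forall q, good q -> hol (s (ca (s q), cb (s q), cc (s p))) f) -> hol p f.
Proof.
  intros Hs H Hga Hy.
  apply hol_ext_all with (fun u => f (s (s u))); [intros; rewrite transposition_inv; auto|].
  apply (hol_perm s p (fun u => f (s u))); auto. apply div_z.
  - apply hol_ext_all with (fun u => cz (s p) (s (s u)) * f (s u));
      [intros; rewrite transposition_inv; auto|].
    apply (hol_perm s (s p) (fun u => cz (s p) (s u) * f u)); auto.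
    rewrite transposition_inv; auto.
  - intros q Hq. apply analytic_perm; auto. apply Hga, good_perm; auto.
  - intros q Hq. apply hol_perm; auto. specialize (Hy (s q) (good_perm s q Hs Hq)).
    rewrite transposition_inv in Hy; auto.
Qed.

Lemma div_y p f : hol p (fun u => cy p u * f u) -> (forall q, good q -> analytic q f) ->
  (forall q, good q -> hol (ca q, cb p, cc q) f) -> hol p f.
Proof. apply (div_perm sw23). right; left; auto. Qed.

Lemma div_x p f : hol p (fun u => cx p u * f u) -> (forall q, good q -> analytic q f) ->
  (forall q, good q -> hol (ca p, cb q, cc q) f) -> hol p f.
Proof. apply (div_perm sw13). right; right; auto. Qed.

(** * The residue along F *)

Lemma Rpower_to_0 e d : (0 < e)%R -> (0 < d)%R ->
  exists n0, forall x, (INR n0 <= x)%R -> (Rpower x (- e) < d)%R.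
Proof.
  intros He Hd. destruct (INR_archimed 1 (exp (- ln d / e))) as [n0 Hn0]; [lra|].
  exists n0. intros x Hx.
  pose proof (exp_pos (- ln d / e)).
  assert (Hl : (- ln d / e < ln x)%R).
  { rewrite <- (ln_exp (- ln d / e)). apply ln_increasing; lra. }
  unfold Rpower. rewrite <- (exp_ln d) by auto. apply exp_increasing.
  apply Rmult_lt_compat_l with (r := e) in Hl; auto.
  replace (e * (- ln d / e))%R with (- ln d)%R in Hl by (field; lra). lra.
Qed.

(** The simple pole of the zeta function at 1 with residue 1, in the form of an inequality. *)
Lemma HS_zeta_bound d Z : (0 < d)%R ->
  HS (fun n => RtoC (Rpower (INR (S n)) (- (1 + d)))) Z -> (Cmod (RtoC d * Z - 1) <= d)%R.
Proof.
  intros Hd HZ. apply Rle_plus_epsilon. intros e He.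
  destruct (HZ (e / (2 * d))%R) as [L0 HL0]; [apply Rdiv_lt_0_compat; lra|].
  destruct (cube_incl cube1 L0 cube1_cube) as [n1 Hn1].
  destruct (Rpower_to_0 d (e / 2) Hd ltac:(lra)) as [n2 Hn2].
  set (n := max n1 n2).
  specialize (HL0 (cube1 n) (proj1 cube1_cube n) (Hn1 n ltac:(lia))).
  specialize (Hn2 (INR (S (S n))) ltac:(apply le_INR; lia)).
  pose proof (zeta_bounds d (S n) Hd) as [HB1 HB2].
  destruct (Nat.eq_dec (S n) 0) as [|_]; [lia|].
  rewrite csum_RtoC in HL0. unfold cube1 in HL0.
  set (s := rsum (seq 0 (S n)) (fun n => Rpower (INR (S n)) (- (1 + d)))) in *.
  pose proof (Rpower_pos (INR (S n)) (- d)). pose proof (Rpower_pos (INR (S (S n))) (- d)).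
  replace (RtoC d * Z - 1) with (RtoC (d * s - 1) - RtoC d * (RtoC s - Z))
    by (rewrite RtoC_minus, RtoC_mult; ring).
  unfold Cminus at 1. eapply Rle_trans; [apply Cmod_triangle|].
  rewrite Cmod_opp, Cmod_mult, !Cmod_R, (Rabs_pos_eq d) by lra.
  assert (Rabs (d * s - 1) <= d + e / 2)%R by (apply Rabs_le; lra).
  apply Rmult_lt_compat_l with (r := d) in HL0; auto.
  replace (d * (e / (2 * d)))%R with (e / 2)%R in HL0 by (field; lra). lra.
Qed.

(* (k-1)^-b - k^-b - b k^-(1+b) = O(k^-(b+2)). *)
Definition er (b : C) (k : R) : C := rc (k - 1) (- b) - rc k (- b) - b * rc k (- (1 + b)).

(** Up to the factor k^(-b) this is the binomial series of (1 - 1/k)^(-b) without its first two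
    terms, which is O(k^(-2)) for k >= 2. *)
Lemma er_bound b : exists c, (0 <= c)%R /\ forall k, (2 <= k)%R ->
  (Cmod (er b k) <= c * Rpower k (- (Re b + 2)))%R.
Proof.
  set (A := (Cmod b + 1)%R).
  assert (HA : (0 < A)%R) by (unfold A; pose proof (Cmod_ge_0 b); lra).
  destruct (rb_SumLe A (/ 2) HA ltac:(lra)) as [N HN].
  (* The 4 comes from (1/k)^n <= k^(-2) (1/2)^(n-2) for n >= 2. *)
  exists (4 * N)%R. split; [apply SumLe_ge0 in HN; lra|]. intros k Hk.
  assert (Hk0 : (0 < / k <= / 2)%R).
  { split; [apply Rinv_0_lt_compat; lra|apply Rinv_le_contravar; lra]. }
  assert (E1 : (- -1 / k)%R = (/ k)%R) by (field; lra).
  pose proof (rc_binom b k (-1) ltac:(lra)) as HB. rewrite E1 in HB.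
  rewrite Rabs_pos_eq in HB by lra. specialize (HB ltac:(lra)).
  assert (Hnd : NoDup (0 :: 1 :: nil)%nat)
    by (repeat constructor; simpl; intuition congruence).
  pose proof (HS_remove (0 :: 1 :: nil)%nat _ _ Hnd HB) as HR.
  simpl csum in HR. rewrite bc_0, bc_1, Rmult_1_r in HR.
  assert (E2 : er b k = rc k (- b) * (rc (k + -1) (- b) * rc k b - (1 * 1 + (b * RtoC (/ k) + 0)))).
  { unfold er. replace (k + -1)%R with (k - 1)%R by ring.
    replace (- (1 + b)) with (- b + -(1)) by ring. rewrite rc_plus, rc_m1, <- RtoC_inv by lra.
    transitivity (rc (k - 1) (- b) * (rc k (- b) * rc k b) - rc k (- b) - b * (rc k (- b) * RtoC (/ k))).
    - rewrite <- rc_plus. replace (- b + b) with (RtoC 0) by ring. rewrite rc_0. ring.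
    - ring. }
  rewrite E2, Cmod_mult, Cmod_rc.
  replace (- (Re b + 2))%R with (- Re b + - INR 2)%R by (simpl; ring).
  rewrite Rpower_plus, (Rpower_Ropp k (INR 2)), Rpower_pow, <- pow_inv, Re_opp by lra.
  replace (4 * N * (Rpower k (- Re b) * (/ k) ^ 2))%R with
    (Rpower k (- Re b) * (4 * (/ k) ^ 2 * N))%R by ring.
  apply Rmult_le_compat_l; [left; apply Rpower_pos|].
  apply (HS_bound _ _ _ HR).
  assert (Hk2 : (0 <= (/ k) ^ 2)%R) by (apply pow_le; lra).
  apply (SumLe_scal _ _ (4 * (/ k) ^ 2)) in HN; [|lra].
  eapply SumLe_le; [| |apply HN]; [|lra]. intros n. unfold ind.
  assert (Hrb : (0 <= rb A n)%R) by (left; apply rb_pos; auto).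
  destruct excluded_middle_informative as [Hn|Hn].
  - destruct n as [|[|n]]; try (exfalso; apply Hn; simpl; auto; fail).
    rewrite Cmod_mult, Cmod_R, Rabs_pos_eq by (apply pow_le; lra).
    pose proof (Cmod_bc b A (S (S n)) ltac:(unfold A; lra)).
    apply Rle_trans with (rb A (S (S n)) * ((/ k) ^ 2 * (/ 2) ^ n))%R.
    + apply Rmult_le_compat; auto; [apply Cmod_ge_0|apply pow_le; lra|].
      replace ((/ k) ^ S (S n))%R with ((/ k) ^ 2 * (/ k) ^ n)%R by (simpl; ring).
      apply Rmult_le_compat_l; auto. apply pow_incr; lra.
    + right. simpl. field. lra.
  - rewrite Cmod_0. apply Rmult_le_pos; [lra|]. apply Rmult_le_pos; auto. apply pow_le; lra.
Qed.

(* For b = 0 (exponent of n) the sum over n telescopes up to an error term,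
   and what remains is the zeta series. *)
Lemma T_b0_bound T b : is_meromorphic_continuation T -> (0 < Re b)%R ->
  exists c, forall e, (0 < e < 1)%R ->
    (Cmod (RtoC e * (b * Tu T (1 + RtoC e, b, RtoC e)) - 1)%C <= e * c)%R.
Proof.
  intros HT Hb. destruct (er_bound b) as [c0 [Hc0 Her]].
  (* The error is compared with exponents free of e, so one bound serves for all e > 0. *)
  destruct (rt_SumLe (1 - Re b) 0 (Re b + 2)) as [M HM]; try lra.
  exists (1 + c0 * M)%R. intros e He.
  set (u := (1 + RtoC e, b, RtoC e) : C3).
  assert (Ua : ua u = 1 + RtoC e - b) by (unfold ua, u, ca, cb, cc; simpl; ring).
  assert (Ub : ub u = 0) by (unfold ub, u, ca, cb, cc; simpl; ring).
  assert (Uc : uc u = 1 + b) by (unfold uc, u, ca, cb, cc; simpl; ring).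
  destruct (Tu_HS T u HT) as [M1 [HM1 HT1]];
    try (unfold u, ca, cb, cc; simpl; lra).
  assert (Htt : forall i j, uterm i j u = rc (xx i) (- (1 + RtoC e - b)) * rc (xx i + xx j) (- (1 + b))).
  { intros. unfold uterm. rewrite Ua, Ub, Uc. replace (- 0) with (RtoC 0) by ring. rewrite rc_0. ring. }
  set (E := fun p : nat * nat => rc (xx (fst p)) (- (1 + RtoC e - b)) * er b (xx (fst p) + xx (snd p))).
  assert (HE : SumLe (fun p => Cmod (E p)) (c0 * M)).
  { apply (SumLe_scal _ _ c0 Hc0) in HM.
    eapply SumLe_le; [| |apply HM]; [|lra].
    intros [i j]. unfold E; simpl fst; simpl snd.
    pose proof (xx_ge1 i). pose proof (xx_ge1 j).
    rewrite Cmod_mult, Cmod_rc, rt_xx.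
    replace (- 0)%R with 0%R by ring. rewrite Rpower_O, Rmult_1_r by lra.
    specialize (Her (xx i + xx j)%R ltac:(lra)).
    assert (Rpower (xx i) (Re (- (1 + RtoC e - b))) <= Rpower (xx i) (- (1 - Re b)))%R.
    { apply Rle_Rpower; auto. rewrite Re_opp, Re_minus, Re_plus, !re_RtoC. lra. }
    apply Rle_trans with (Rpower (xx i) (- (1 - Re b)) * (c0 * Rpower (xx i + xx j) (- (Re b + 2))))%R;
      [|right; ring].
    apply Rmult_le_compat; auto; [left; apply Rpower_pos|apply Cmod_ge_0]. }
  destruct (SumLe_HS _ _ HE) as [Es HEs].
  assert (HEb := HS_bound _ _ _ HEs HE).
  set (D := fun p : nat * nat => rc (xx (fst p)) (- (1 + RtoC e - b)) *
    (rc (xx (fst p) + xx (snd p) - 1) (- b) - rc (xx (fst p) + xx (snd p)) (- b))).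
  assert (HDE : forall p, b * uterm (fst p) (snd p) u + E p = D p).
  { intros p. rewrite Htt. unfold E, D, er. ring. }
  assert (HD : HS D (b * Tu T u + Es)).
  { eapply HS_ext; [apply HDE|]. apply HS_plus; auto. apply HS_scal; auto. }
  assert (HDs : SumLe (fun p => Cmod (D p)) (Cmod b * M1 + c0 * M)).
  { eapply SumLe_le; [| |apply (SumLe_plus _ _ _ _ (SumLe_scal _ _ (Cmod b) (Cmod_ge_0 b) HM1) HE)]; [|lra].
    intros p. cbv beta. rewrite <- HDE, <- Cmod_mult. apply Cmod_triangle. }
  assert (Hrow : forall i, HS (fun j => D (i, j)) (RtoC (Rpower (INR (S i)) (- (1 + e))))).
  { intros i. pose proof (xx_ge1 i) as Hi.
    assert (HDi : SumLe (fun j => Cmod (D (i, j))) (Cmod b * M1 + c0 * M)).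
    { apply (SumLe_inj (fun j => (i, j)) (fun p => Cmod (D p))); auto. congruence. }
    destruct (SumLe_HS _ _ HDi) as [t Ht].
    replace (RtoC (Rpower (INR (S i)) (- (1 + e)))) with t; auto.
    apply (C_lim_unique (fun n => csum (cube1 n) (fun j => D (i, j))));
      [apply HS_cube; auto; apply cube1_cube|].
    set (a := rc (xx i) (- (1 + RtoC e - b))).
    assert (Etel : forall n, csum (seq 0 n) (fun j => D (i, j)) =
      a * (rc (xx i) (- b) - rc (xx i + INR n) (- b))).
    { induction n.
      - simpl. rewrite Rplus_0_r. ring.
      - rewrite seq_S, csum_app, IHn, Nat.add_0_l. unfold D. simpl csum. fold a.
        replace (xx i + xx n - 1)%R with (xx i + INR n)%R by (unfold xx; rewrite (S_INR n); ring).
        change (xx n) with (INR (S n)). ring. }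
    assert (Ea : RtoC (Rpower (INR (S i)) (- (1 + e))) = a * rc (xx i) (- b)).
    { unfold a. rewrite <- rc_plus. replace (- (1 + RtoC e - b) + - b) with (RtoC (- (1 + e))).
      - rewrite rc_real. reflexivity.
      - rewrite RtoC_opp, RtoC_plus. ring. }
    rewrite Ea. apply C_lim_eps. intros d Hd.
    assert (Ha : (0 < Cmod a + 1)%R) by (pose proof (Cmod_ge_0 a); lra).
    destruct (Rpower_to_0 (Re b) (d / (Cmod a + 1)) Hb) as [n0 Hn0]; [apply Rdiv_lt_0_compat; auto|].
    exists n0. intros n Hn. unfold cube1. rewrite Etel.
    replace (a * (rc (xx i) (- b) - rc (xx i + INR (S n)) (- b)) - a * rc (xx i) (- b)) with
      (- (a * rc (xx i + INR (S n)) (- b))) by ring.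
    rewrite Cmod_opp, Cmod_mult, Cmod_rc, Re_opp.
    specialize (Hn0 (xx i + INR (S n))%R ltac:(assert (INR n0 <= INR (S n))%R by (apply le_INR; lia); lra)).
    pose proof (Rpower_pos (xx i + INR (S n)) (- Re b)). pose proof (Cmod_ge_0 a).
    apply Rle_lt_trans with ((Cmod a + 1) * Rpower (xx i + INR (S n)) (- Re b))%R; [nra|].
    apply Rmult_lt_compat_l with (r := (Cmod a + 1)%R) in Hn0; [|lra].
    replace ((Cmod a + 1) * (d / (Cmod a + 1)))%R with d in Hn0 by (field; lra). auto. }
  (* Summing over the rows leaves b T + Es = zeta(1 + e). *)
  apply (HS_pair D _ _ _ HDs Hrow) in HD.
  apply HS_zeta_bound in HD; [|lra].
  replace (RtoC e * (b * Tu T u) - 1) with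
    ((RtoC e * (b * Tu T u + Es) - 1) - RtoC e * Es) by ring.
  unfold Cminus at 1. eapply Rle_trans; [apply Cmod_triangle|].
  rewrite Cmod_opp, Cmod_mult, Cmod_R, (Rabs_pos_eq e) by lra.
  rewrite Rmult_plus_distr_l, Rmult_1_r. apply Rplus_le_compat; auto.
  apply Rmult_le_compat_l; lra.
Qed.

(** F T extends analytically to (1, b, 0), so its value there is the limit along (1 + t, b, t),
    which [T_b0_bound] evaluates. *)
Lemma holv_F1 T b : is_meromorphic_continuation T -> (0 < Re b)%R ->
  holv (RtoC 1, b, RtoC 0) (fun u => cz (RtoC 1, b, RtoC 0) u * Tu T u) (/ b).
Proof.
  intros HT Hb. set (p := (RtoC 1, b, RtoC 0) : C3).
  assert (Hb0 : b <> 0) by (intros ->; rewrite re_RtoC in Hb; lra).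
  destruct (hol_F T p HT) as [v Hv]; try (unfold p, ca, cb; simpl; lra).
  replace (/ b) with v; auto.
  destruct (holv_germ _ _ _ Hv) as [r0 [S [Hr0 [[r1 [N [Hr1 HS]]] [HSv HG]]]]].
  destruct (radius2 r0 r1 Hr0 Hr1) as [r [Hr [R0 R1]]].
  apply (Wat_shrink p r1 r) in HS; [|lra].
  destruct (T_b0_bound T b HT Hb) as [c Hc].
  assert (E : b * v - 1 = 0).
  { apply Cmod_eq_0. apply small_zero with (Cmod b * (2 * (N / r)) + Rabs c)%R; [apply Cmod_ge_0|].
    intros d Hd. destruct (radius3 d (/ 2) r) as [t [Ht [Ht1 [Ht2 Ht3]]]]; try lra.
    set (q := (1 + RtoC t, b, RtoC t) : C3).
    assert (Qx : cx p q = RtoC t) by (unfold cx, p, q, ca; simpl; ring).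
    assert (Qy : cy p q = 0) by (unfold cy, p, q, cb; simpl; ring).
    assert (Qz : cz p q = RtoC t) by (unfold cz, p, q, cc; simpl; ring).
    assert (Hbq : box p r q).
    { unfold box, inbox. rewrite Qx, Qy, Qz, Cmod_0, Cmod_R, Rabs_pos_eq; lra. }
    assert (ES : S q = RtoC t * Tu T q).
    { rewrite <- Qz. apply (holv_unique q (fun u => cz p u * Tu T u)).
      - apply HG, (box_le p r0 r); auto.
      - apply holv_mult; apply analytic_holv; [apply analytic_cz|].
        apply (Tu_analytic T q HT). split; [|split]; [apply Re_pos_not_natpole|apply Re_pos_not_natpole|];
          unfold q, ca, cb, cc; simpl; try lra.
        intros H0. apply RtoC_inj in H0. lra. }
    specialize (Hc t ltac:(lra)). fold q in Hc.
    pose proof (Wat_lip p r N S q Hr HS Hbq) as HL.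
    rewrite Qx, Qy, Qz, Cmod_0, !Cmod_R, (Rabs_pos_eq t) in HL by lra.
    rewrite <- HSv.
    replace (b * S p - 1) with (- (b * (S q - S p)) + (RtoC t * (b * Tu T q) - 1)) by (rewrite ES; ring).
    eapply Rle_trans; [apply Cmod_triangle|]. rewrite Cmod_opp, Cmod_mult.
    assert (HN : (0 <= N / r)%R).
    { apply Rmult_le_pos; [apply W_ge0 in HS; auto|left; apply Rinv_0_lt_compat; auto]. }
    pose proof (Cmod_ge_0 b). pose proof (Rle_abs c). pose proof (Rabs_pos c).
    rewrite Rmult_plus_distr_l. apply Rplus_le_compat.
    - replace (d * (Cmod b * (2 * (N / r))))%R with (Cmod b * (d * (2 * (N / r))))%R by ring.
      apply Rmult_le_compat_l; auto. eapply Rle_trans; [apply HL|].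
      replace ((t + 0 + t) * (N / r))%R with (t * (2 * (N / r)))%R by ring.
      apply Rmult_le_compat_r; lra.
    - eapply Rle_trans; [apply Hc|].
      apply Rle_trans with (t * Rabs c)%R; [apply Rmult_le_compat_l; lra|].
      apply Rmult_le_compat_r; lra. }
  replace v with (/ b * (b * v)) by (field; auto).
  replace (b * v) with (RtoC 1); [ring|].
  replace (b * v) with (b * v - 1 + 1) by ring. rewrite E. ring.
Qed.

(** * Values of the mixed coefficients *)

Lemma hol_XYZ T p : is_meromorphic_continuation T ->
  hol p (fun u => cx p u * cy p u * cz p u * Tu T u).
Proof.
  intros HT. destruct (two_term_any T p HT) as [g1 [g2 [H1 [H2 H]]]].
  apply hol_ext_good with (fun u => cy p u * g1 u + cx p u * g2 u).
  - intros; symmetry; auto.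
  - apply hol_plus; apply hol_scal_analytic; auto; [apply analytic_cy|apply analytic_cx].
Qed.

Lemma good_T T q : is_meromorphic_continuation T -> good q -> analytic q (Tu T).
Proof. intros. apply Tu_analytic; auto. apply good_nonpolar; auto. Qed.

Ltac analytic_tac := repeat first
  [ apply analytic_cx | apply analytic_cy | apply analytic_cz | apply good_T; assumption
  | apply analytic_mult ].

(** The factor Y is spurious: since B_0 is not polar at p, T is analytic at the points of Y = 0
    whose other coordinates are not integers, and [div_y] removes it. *)
Lemma hol_XZ T p : is_meromorphic_continuation T -> ~ natpole (cb p) ->
  hol p (fun u => cx p u * cz p u * Tu T u).
Proof.
  intros HT Hb. apply div_y.
  - apply hol_ext_all with (2 := hol_XYZ T p HT). intros; ring.
  - intros q Hq. analytic_tac.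
  - intros q Hq. destruct (good_nonpolar q Hq) as [? [? ?]].
    apply analytic_hol. analytic_tac. apply Tu_analytic; auto. split; auto.
Qed.

Lemma hol_XY T p : is_meromorphic_continuation T -> cc p <> 0 ->
  hol p (fun u => cx p u * cy p u * Tu T u).
Proof.
  intros HT Hb. apply div_z.
  - apply hol_ext_all with (2 := hol_XYZ T p HT). intros; ring.
  - intros q Hq. analytic_tac.
  - intros q Hq. destruct (good_nonpolar q Hq) as [? [? ?]].
    apply analytic_hol. analytic_tac. apply Tu_analytic; auto. split; auto.
Qed.

(** Off F = 0 the product X T is already analytic, and the extra factor Z vanishes at p. In the
    recursions such shifted points contribute nothing. *)
Lemma holv_XZ_offF T p : is_meromorphic_continuation T -> ~ natpole (cb p) -> cc p <> 0 ->
  holv p (fun u => cx p u * cz p u * Tu T u) 0.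
Proof.
  intros HT Hb Hc.
  assert (H : hol p (fun u => cx p u * Tu T u)).
  { apply div_z.
    - apply hol_ext_all with (2 := hol_XZ T p HT Hb). intros; ring.
    - intros q Hq. analytic_tac.
    - intros q Hq. destruct (good_nonpolar q Hq) as [? [? ?]].
      apply analytic_hol. analytic_tac. apply Tu_analytic; auto. split; auto. }
  destruct H as [v Hv].
  apply holv_ext_good with (fun u => cz p u * (cx p u * Tu T u)); [intros; ring|].
  replace (RtoC 0) with (cz p p * v) by (unfold cz; ring).
  apply holv_mult; auto. apply analytic_holv, analytic_cz.
Qed.

Lemma holv_XZ_offA T p : is_meromorphic_continuation T -> ~ natpole (ca p) -> ~ natpole (cb p) ->
  holv p (fun u => cx p u * cz p u * Tu T u) 0.
Proof.
  intros HT Ha Hb.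
  assert (H : hol p (fun u => cz p u * Tu T u)).
  { apply div_x.
    - apply hol_ext_all with (2 := hol_XZ T p HT Hb). intros; ring.
    - intros q Hq. analytic_tac.
    - intros q Hq. destruct (good_nonpolar q Hq) as [? [? ?]].
      apply analytic_hol. analytic_tac. apply Tu_analytic; auto. split; auto. }
  destruct H as [v Hv].
  apply holv_ext_good with (fun u => cx p u * (cz p u * Tu T u)); [intros; ring|].
  replace (RtoC 0) with (cx p p * v) by (unfold cx; ring).
  apply holv_mult; auto. apply analytic_holv, analytic_cx.
Qed.

Lemma holv_Z_offF T p : is_meromorphic_continuation T -> nonpolar p ->
  holv p (fun u => cz p u * Tu T u) 0.
Proof.
  intros HT Hp. replace (RtoC 0) with (cz p p * Tu T p) by (unfold cz; ring).
  apply holv_mult; apply analytic_holv; [apply analytic_cz|].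
  apply (Tu_analytic T p HT Hp).
Qed.

(** The generalised binomial coefficient of - c over l. *)
Definition val (l : nat) (c : C) : C := (-1) ^ l * (Cpochhammer c l / RtoC (INR (fact l))).

Lemma val_0 c : val 0 c = 1.
Proof. unfold val; simpl. field. Qed.

Lemma val_S l c : val (S l) c = - (c + RtoC (INR l)) / RtoC (INR (S l)) * val l c.
Proof.
  unfold val. simpl Cpochhammer. rewrite fact_simpl, mult_INR, RtoC_mult.
  pose proof (fact_nz l). pose proof (INR_S_nz l). simpl Cpow. field. auto.
Qed.

Lemma poch_left c l : Cpochhammer c (S l) = c * Cpochhammer (c + 1) l.
Proof.
  induction l; [simpl; ring|].
  change (Cpochhammer c (S (S l))) with (Cpochhammer c (S l) * (c + RtoC (INR (S l)))).
  rewrite IHl. simpl Cpochhammer. rewrite S_INR, RtoC_plus. ring.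
Qed.

(** Pascal's rule with upper entry - c; it mirrors the two terms of [rel1]. *)
Lemma val_pascal l c : val (S l) c = val (S l) (c + 1) + val l (c + 1).
Proof.
  unfold val. rewrite poch_left. simpl (Cpochhammer (c + 1) (S l)).
  rewrite fact_simpl, mult_INR, RtoC_mult.
  pose proof (fact_nz l). pose proof (INR_S_nz l) as HS1. rewrite S_INR, RtoC_plus in *.
  simpl Cpow. field. auto.
Qed.

Lemma vsh_coords p e : (2 <= fst e + snd e)%nat ->
  (Re (ca p) + 1 <= Re (ca (add3 p (vsh e))))%R /\
  (Re (cb p) - 1 <= Re (cb (add3 p (vsh e))))%R /\
  (Re (cc p) + 1 <= Re (cc (add3 p (vsh e))))%R.
Proof.
  intros He. unfold vsh.
  destruct (Re_shift p (Z.of_nat (fst e + snd e) - 1) (Z.of_nat (snd e) - 1)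
    (Z.of_nat (fst e + snd e) - 1)) as [B1 [B2 B3]].
  rewrite B1, B2, B3, !minus_IZR, <- !INR_IZR_INZ.
  apply le_INR in He. simpl in He. pose proof (pos_INR (snd e)). lra.
Qed.

Lemma Re_ne_0 z : (0 < Re z)%R -> z <> 0.
Proof. intros H ->. rewrite re_RtoC in H. lra. Qed.

(** The step from l to l + 1 divides by A_0 = - (l + 1) and multiplies by - a = c + l, which is the
    recursion [val_S]. The higher terms sit at Re F >= 1 and contribute nothing. *)
Lemma A_value_far T (HT : is_meromorphic_continuation T) l : forall p,
  ca p = - RtoC (INR l) -> cc p = 0 -> (INR l + 1 < Re (cb p))%R ->
  holv p (fun u => cx p u * cz p u * Tu T u) (val l (cb p - RtoC (INR l))).
Proof.
  induction l as [|l IH]; intros p Ha Hc Hb.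
  - simpl in *.
    assert (Ha0 : ca p = 0) by (rewrite Ha; ring).
    apply holv_ext_good with (fun u => cz p u * (ca u * Tu T u)).
    { intros q _. unfold cx. rewrite Ha0. ring. }
    assert (Hn : cb p - 1 <> 0).
    { apply Re_ne_0. rewrite Re_minus, re_RtoC. lra. }
    (* On A_0 = F = 0 one has - a = B_0 - 1, which cancels the residue 1 / (B_0 - 1) that [holv_F1]
       gives at p + v0. *)
    replace (val 0 (cb p - 0)) with (- ua p * / (cb p - 1)).
    2:{ rewrite val_0. unfold ua. rewrite Hc. field. auto. }
    apply astep_holv0; auto; [lra|intros; apply analytic_cz|unfold cz; ring| |].
    + assert (E : add3 p v0 = (RtoC 1, cb p - 1, RtoC 0)).
      { apply C3_eq; rewrite ?ca_add3, ?cb_add3, ?cc_add3; unfold v0, ivec;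
          rewrite ?ca_vec, ?cb_vec, ?cc_vec, ?Ha0, ?Hc; unfold ca, cb, cc; simpl; ring. }
      apply holv_ext_good with (fun u => cz (add3 p v0) (add3 u v0) * Tu T (add3 u v0)).
      { intros; rewrite cz_shift; auto. }
      apply (holv_shift p (fun u => cz (add3 p v0) u * Tu T u)). fold v0. rewrite E.
      apply holv_F1; auto. rewrite Re_minus, re_RtoC. lra.
    + intros e He. destruct (vsh_coords p e He) as [B1 [B2 B3]].
      rewrite Ha0, re_RtoC in B1. rewrite Hc, re_RtoC in B3.
      apply holv_ext_good with (fun u => cz (add3 p (vsh e)) (add3 u (vsh e)) * Tu T (add3 u (vsh e))).
      { intros; rewrite cz_shift; auto. }
      apply (holv_shift p (fun u => cz (add3 p (vsh e)) u * Tu T u)). fold (vsh e).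
      apply holv_Z_offF; auto. split; [|split];
        [apply Re_pos_not_natpole|apply Re_pos_not_natpole|apply Re_ne_0]; lra.
  - pose proof (INR_S_nz l) as HSl.
    rewrite S_INR in Ha, Hb. pose proof (pos_INR l) as Hl.
    assert (Ha0 : ca p <> 0).
    { rewrite Ha. intros H0. apply HSl. rewrite S_INR.
      replace (RtoC (INR l + 1)) with (- - RtoC (INR l + 1)) by ring. rewrite H0. ring. }
    apply holv_ext_good with (fun u => / ca u * ((cx p u * cz p u) * (ca u * Tu T u))).
    { intros q Hq. field. destruct (Hq 0%Z); auto. }
    set (c := cb p - RtoC (INR (S l))).
    replace (val (S l) c) with (/ ca p * (- ua p * val l c)).
    2:{ rewrite val_S, Ha. rewrite <- S_INR. unfold ua, c. rewrite Hc, S_INR, RtoC_plus.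
        rewrite S_INR, RtoC_plus in HSl. field. exact HSl. }
    apply holv_mult.
    { apply (analytic_holv p (fun u => / ca u)), analytic_inv_ca; auto. }
    apply astep_holv0; auto; [lra| |unfold cz; ring| |].
    { intros; apply analytic_mult; [apply analytic_cx|apply analytic_cz]. }
    + apply holv_ext_good with (fun u => cx (add3 p v0) (add3 u v0) * cz (add3 p v0) (add3 u v0) * Tu T (add3 u v0)).
      { intros; rewrite cx_shift, cz_shift; auto. }
      apply (holv_shift p (fun u => cx (add3 p v0) u * cz (add3 p v0) u * Tu T u)). fold v0.
      replace c with (cb (add3 p v0) - RtoC (INR l)).
      2:{ unfold c, v0, ivec. rewrite cb_add3, cb_vec, S_INR, RtoC_plus. ring. }
      destruct (Re_shift p 1 (-1) 0) as [A1 [A2 A3]].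
      apply IH; unfold v0, ivec; rewrite ?ca_add3, ?cb_add3, ?cc_add3, ?ca_vec, ?cc_vec, ?cb_vec.
      * rewrite Ha, RtoC_plus. ring.
      * rewrite Hc. ring.
      * rewrite Re_plus, re_RtoC. lra.
    + intros e He. destruct (vsh_coords p e He) as [B1 [B2 B3]].
      rewrite Hc, re_RtoC in B3.
      apply holv_ext_good with (fun u => cx (add3 p (vsh e)) (add3 u (vsh e)) *
        cz (add3 p (vsh e)) (add3 u (vsh e)) * Tu T (add3 u (vsh e))).
      { intros; rewrite cx_shift, cz_shift; auto. }
      apply (holv_shift p (fun u => cx (add3 p (vsh e)) u * cz (add3 p (vsh e)) u * Tu T u)).
      fold (vsh e). apply holv_XZ_offF; auto; [apply Re_pos_not_natpole|apply Re_ne_0]; lra.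
Qed.

Lemma natpole_pred z : natpole (z + 1) -> natpole z.
Proof.
  intros [n H]. exists (S n). rewrite S_INR, RtoC_plus.
  replace z with (z + 1 - 1) by ring. rewrite H. ring.
Qed.

(** Descent in Re B_0: [rel1] involves the point with B_0 raised by one and the point with A_0
    raised by one. The latter lies on A_(l-1) = 0, or off the A-family if l = 0. *)
Lemma A_value_aux T (HT : is_meromorphic_continuation T) (n : nat) : forall l p,
  ca p = - RtoC (INR l) -> cc p = 0 -> ~ natpole (cb p) -> (INR l + 1 - INR n < Re (cb p))%R ->
  holv p (fun u => cx p u * cz p u * Tu T u) (val l (cb p - RtoC (INR l))).
Proof.
  induction n as [|n IH]; intros l p Ha Hc Hb Hn.
  - apply A_value_far; auto. simpl in Hn. lra.
  - rewrite S_INR in Hn.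
    apply holv_ext_good with (fun u => cx (add3 p e2) (add3 u e2) * cz (add3 p e2) (add3 u e2) * Tu T (add3 u e2) +
      cx (add3 p e1) (add3 u e1) * cz (add3 p e1) (add3 u e1) * Tu T (add3 u e1)).
    { intros q Hq. rewrite !cx_shift, !cz_shift, (rel1 T q HT Hq). ring. }
    assert (Hcb1 : cb (add3 p e1) = cb p) by (unfold e1, ivec; rewrite cb_add3, cb_vec; ring).
    assert (Hcb2 : cb (add3 p e2) = cb p + 1) by (unfold e2, ivec; rewrite cb_add3, cb_vec; ring).
    assert (Hca1 : ca (add3 p e1) = ca p + 1) by (unfold e1, ivec; rewrite ca_add3, ca_vec; ring).
    assert (Hca2 : ca (add3 p e2) = ca p) by (unfold e2, ivec; rewrite ca_add3, ca_vec; ring).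
    assert (Hcc1 : cc (add3 p e1) = 0) by (unfold e1, ivec; rewrite cc_add3, cc_vec, Hc; ring).
    assert (Hcc2 : cc (add3 p e2) = 0) by (unfold e2, ivec; rewrite cc_add3, cc_vec, Hc; ring).
    assert (H2 : holv (add3 p e2) (fun u => cx (add3 p e2) u * cz (add3 p e2) u * Tu T u)
      (val l (cb p + 1 - RtoC (INR l)))).
    { rewrite <- Hcb2. apply IH; auto; [rewrite Hca2; auto| |];
        rewrite Hcb2; [intros H; apply Hb, natpole_pred; auto|rewrite Re_plus, re_RtoC; lra]. }
    assert (H1 : holv (add3 p e1) (fun u => cx (add3 p e1) u * cz (add3 p e1) u * Tu T u)
      (match l with O => 0 | S l' => val l' (cb p - RtoC (INR l')) end)).
    { destruct l as [|l].
      - apply holv_XZ_offA; auto.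
        + rewrite Hca1, Ha. apply Re_pos_not_natpole.
          rewrite Re_plus, Re_opp, !re_RtoC. simpl; lra.
        + rewrite Hcb1; auto.
      - rewrite <- Hcb1. apply IH; auto.
        + rewrite Hca1, Ha, S_INR, RtoC_plus. ring.
        + rewrite Hcb1; auto.
        + rewrite Hcb1. rewrite S_INR in Hn. lra. }
    replace (val l (cb p - RtoC (INR l))) with (val l (cb p + 1 - RtoC (INR l)) +
      match l with O => RtoC 0 | S l' => val l' (cb p - RtoC (INR l')) end).
    2:{ destruct l as [|l]; [rewrite !val_0; ring|].
        rewrite (val_pascal l (cb p - RtoC (INR (S l)))).
        f_equal; f_equal; rewrite ?S_INR, ?RtoC_plus; ring. }
    apply holv_plus.
    + apply (holv_shift p (fun u => cx (add3 p e2) u * cz (add3 p e2) u * Tu T u)). auto.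
    + apply (holv_shift p (fun u => cx (add3 p e1) u * cz (add3 p e1) u * Tu T u)). auto.
Qed.

Lemma A_value T p l : is_meromorphic_continuation T ->
  ca p = - RtoC (INR l) -> cc p = 0 -> ~ natpole (cb p) ->
  holv p (fun u => cx p u * cz p u * Tu T u) (val l (uc p)).
Proof.
  intros HT Ha Hc Hb.
  replace (uc p) with (cb p - RtoC (INR l)) by (unfold uc; rewrite Ha, Hc; ring).
  destruct (INR_archimed 1 (INR l + 1 - Re (cb p))) as [n Hn]; [lra|].
  apply (A_value_aux T HT n); auto. lra.
Qed.

Lemma B_value T p m : is_meromorphic_continuation T ->
  cb p = - RtoC (INR m) -> cc p = 0 -> ~ natpole (ca p) ->
  holv p (fun u => cy p u * cz p u * Tu T u) (val m (uc p)).
Proof.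
  intros HT Hb Hc Ha.
  replace (uc p) with (uc (swap p)) by (unfold uc, swap, ca, cb, cc; simpl; ring).
  apply holv_ext_good with (fun u => cx (swap p) (swap u) * cz (swap p) (swap u) * Tu T (swap u)).
  { intros q Hq. rewrite Tu_swap by auto. reflexivity. }
  apply (holv_perm swap p (fun u => cx (swap p) u * cz (swap p) u * Tu T u)); [left; auto|].
  apply A_value; auto.
Qed.

(* With XYZ T = Y g1 + X g2, the function XY T = (Y g1 + X g2)/Z vanishes on X = Y = 0. *)
Lemma AB_value T p : is_meromorphic_continuation T -> cc p <> 0 ->
  holv p (fun u => cx p u * cy p u * Tu T u) 0.
Proof.
  intros HT Hc. destruct (hol_XY T p HT Hc) as [v Hv].
  replace (RtoC 0) with v; auto.
  destruct (two_term_any T p HT) as [g1 [g2 [[w1' H1] [[w2' H2] HG]]]].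
  destruct (holv_germ _ _ _ Hv) as [r [S [Hr [HS [<- H]]]]].
  destruct (holv_germ _ _ _ H1) as [r1 [S1 [Hr1 [_ [_ G1]]]]].
  destruct (holv_germ _ _ _ H2) as [r2 [S2 [Hr2 [_ [_ G2]]]]].
  apply (analytic_eq_dir p 0 0 1 S (fun _ => 0)); auto; [apply analytic_const|].
  destruct (radius3 r r1 r2) as [d [Hd [D1 [D2 D3]]]]; auto.
  exists d. split; auto. intros e He. rewrite !Rmult_0_r, Rmult_1_r.
  set (q := add3 p (vec 0 0 e)).
  assert (Qx : cx p q = 0) by (unfold cx, q; rewrite ca_add3, ca_vec; ring).
  assert (Qy : cy p q = 0) by (unfold cy, q; rewrite cb_add3, cb_vec; ring).
  assert (Qz : cz p q = RtoC e) by (unfold cz, q; rewrite cc_add3, cc_vec; ring).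
  assert (Hb : box p d q).
  { apply box_vec; rewrite ?Rabs_R0, ?Rabs_pos_eq; lra. }
  assert (E : cz p q * S q = cy p q * S1 q + cx p q * S2 q).
  { apply (holv_unique q (fun u => cz p u * (cx p u * cy p u * Tu T u))).
    - apply holv_mult; [apply analytic_holv, analytic_cz|]. apply H, (box_le p r d); auto.
    - apply holv_ext_good with (fun u => cy p u * g1 u + cx p u * g2 u).
      + intros u Hu. rewrite <- HG by auto. ring.
      + apply holv_plus; apply holv_mult; try (apply analytic_holv; apply analytic_cy);
          try (apply analytic_holv; apply analytic_cx);
          [apply G1, (box_le p r1 d)|apply G2, (box_le p r2 d)]; auto. }
  rewrite Qx, Qy, Qz in E.
  assert (He0 : RtoC e <> 0) by (intros HC0; apply RtoC_inj in HC0; lra).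
  replace (S q) with (/ RtoC e * (RtoC e * S q)) by (field; auto). rewrite E. ring.
Qed.

(** * Expansion in two transverse forms *)

Definition ofABC (p : C3) : C3 := (ca p + cc p - 1, cb p + cc p - 1, ca p + cb p + cc p - 2).

Lemma toABC_of p : toABC (ofABC p) = p.
Proof. apply C3_eq; unfold toABC, ofABC, ca, cb, cc; simpl; ring. Qed.

Lemma uc_of p : uc (ofABC p) = cc p.
Proof. unfold uc, ofABC, ca, cb, cc; simpl; ring. Qed.

Lemma Tu_of T p : Tu T (ofABC p) = T p.
Proof. unfold Tu. rewrite toABC_of. auto. Qed.

Lemma form_of H q : form H q = match H with
  | HA l => ca (ofABC q) + RtoC (INR l)
  | HB m => cb (ofABC q) + RtoC (INR m)
  | HF => cc (ofABC q) end.
Proof. rewrite <- (toABC_of q) at 1. apply form_toABC. Qed.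

Lemma int_isolated z : exists d, (0 < d)%R /\
  forall k : Z, (Cmod (RtoC (IZR k) - z) < d)%R -> RtoC (IZR k) = z.
Proof.
  destruct (Req_dec (Im z) 0) as [H0|H0].
  - set (n := (up (Re z) - 1)%Z).
    pose proof (archimed (Re z)) as [H1 H2].
    assert (Hn : (IZR n <= Re z < IZR n + 1)%R) by (unfold n; rewrite minus_IZR; lra).
    assert (Hk : forall k d, (Cmod (RtoC (IZR k) - z) < d)%R -> (Rabs (IZR k - Re z) < d)%R).
    { intros k d Hk. eapply Rle_lt_trans; [|apply Hk].
      replace (IZR k - Re z)%R with (Re (RtoC (IZR k) - z)) by (rewrite Re_minus; auto).
      apply Re_le_mod. }
    destruct (Req_dec (Re z) (IZR n)) as [Hz|Hz].
    + exists 1%R. split; [lra|]. intros k Hk'. apply Hk in Hk'. rewrite Hz in Hk'.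
      apply Rabs_def2 in Hk'.
      assert (k < n + 1)%Z by (apply lt_IZR; rewrite plus_IZR; lra).
      assert (n - 1 < k)%Z by (apply lt_IZR; rewrite minus_IZR; lra).
      replace k with n by lia. destruct z as [x y]. simpl in *. unfold RtoC. f_equal; auto.
    + exists (Rmin (Re z - IZR n) (IZR n + 1 - Re z)). split; [apply Rmin_pos; lra|].
      intros k Hk'. exfalso. apply Hk, Rabs_def2 in Hk'.
      pose proof (Rmin_l (Re z - IZR n) (IZR n + 1 - Re z)).
      pose proof (Rmin_r (Re z - IZR n) (IZR n + 1 - Re z)).
      assert (k < n + 1)%Z by (apply lt_IZR; rewrite plus_IZR; lra).
      assert (n < k)%Z by (apply lt_IZR; lra). lia.
  - exists (Rabs (Im z)). split; [apply Rabs_pos_lt; auto|]. intros k Hk. exfalso.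
    pose proof (Im_le_mod (RtoC (IZR k) - z)) as H.
    replace (Im (RtoC (IZR k) - z)) with (- Im z)%R in H by (destruct z; simpl; ring).
    rewrite Rabs_Ropp in H. lra.
Qed.

Lemma polar_isolated u : exists d, (0 < d)%R /\ forall q, box u d q ->
  (natpole (ca q) -> ca q = ca u) /\ (natpole (cb q) -> cb q = cb u) /\
  (cc q = 0 -> cc q = cc u).
Proof.
  destruct (int_isolated (ca u)) as [d1 [Hd1 D1]].
  destruct (int_isolated (cb u)) as [d2 [Hd2 D2]].
  destruct (int_isolated (cc u)) as [d3 [Hd3 D3]].
  destruct (radius3 d1 d2 d3) as [d [Hd [E1 [E2 E3]]]]; auto.
  exists (d / 2)%R. split; [lra|].
  intros q [B1 [B2 B3]]. unfold cx, cy, cz in *. split; [|split].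
  - intros Hn. apply natpole_int in Hn as [n Hn]. rewrite Hn in *. apply D1. lra.
  - intros Hn. apply natpole_int in Hn as [n Hn]. rewrite Hn in *. apply D2. lra.
  - intros Hn. rewrite Hn in *. apply (D3 0%Z). lra.
Qed.

Lemma W_comb {Q} (x y z f : Q -> C) (s1 s2 s3 : C) r : (0 < r)%R ->
  (Cmod s1 <= 1)%R -> (Cmod s2 <= 1)%R -> (Cmod s3 <= 1)%R ->
  (forall q, f q = s1 * x q + s2 * y q + s3 * z q) -> W x y z r (3 * r) f.
Proof.
  intros Hr H1 H2 H3 Hf. apply W_ext with (fun q => s1 * x q + s2 * y q + s3 * z q);
    [intros; auto|].
  eapply W_le; [|apply W_plus; [lra|apply W_plus; [lra| |]|]; apply W_scal; auto;
    [apply W_x|apply W_y|apply W_z]; auto].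
  nra.
Qed.

Lemma Cpow_Z_pred (z : C) n : z <> 0 -> Cpow_Z z (Z.of_nat n - 1) = z ^ n / z.
Proof.
  intros Hz. destruct n as [|n].
  - simpl. field. auto.
  - replace (Z.of_nat (S n) - 1)%Z with (Z.of_nat n) by lia.
    assert (E : Cpow_Z z (Z.of_nat n) = z ^ n).
    { unfold Cpow_Z. destruct (Z.of_nat n) eqn:E; [| |lia].
      - assert (n = O) by lia. subst. reflexivity.
      - rewrite <- E, Nat2Z.id. reflexivity. }
    rewrite E. simpl. field. auto.
Qed.

Lemma HS_is_pseries (k : nat -> C) z s : HS (fun l => k l * z ^ l) s ->
  is_pseries (K := C_AbsRing) (V := C_NormedModule) k z s.
Proof.
  intros H. unfold is_pseries, is_series.
  apply (HS_cube cube1 _ _ cube1_cube) in H.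
  eapply filterlim_ext_C; [|apply H]. intros n. unfold cube1.
  rewrite <- (seq_sum_n_C n (fun l => k l * z ^ l)). apply sum_n_ext. intros l.
  assert (E : pow_n (K := C_AbsRing) z l = z ^ l).
  { induction l; [reflexivity|]. simpl. rewrite IHl. reflexivity. }
  rewrite E. apply Cmult_comm.
Qed.

(** Dividing the power series of X Y T in the coordinates X, Y, c by X Y lowers both indices by one.
    Hence N = 1, and the coefficient of index (-1, -1) at p is the constant term S p. *)
Lemma mixed_of_W T H K p r r' N S v : (0 < r)%R -> (0 < r')%R ->
  form H p = 0 -> form K p = 0 ->
  W (form H) (form K) (fun q => cc q - cc p) r N S -> S p = v ->
  (forall q, polydisc p r' q -> inbox (form H) (form K) (fun q => cc q - cc p) r q) ->
  (forall q, polydisc p r' q -> form H q <> 0 -> form K q <> 0 ->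
     S q = form H q * form K q * T q) ->
  mixed_coefficient T H K p v.
Proof.
  intros Hr Hr' HH HK [k [H1 H2]] Hv Hbox HS0.
  set (r0 := Rmin r r').
  assert (Hr0 : (0 < r0)%R) by (apply Rmin_pos; auto).
  assert (Hr0r : (r0 <= r)%R) by apply Rmin_l.
  assert (Hr0r' : (r0 <= r')%R) by apply Rmin_r.
  set (kc := fun (i j : nat) (z : C) => tsum (fun l => k (i, j, l) * (z - cc p) ^ l)).
  set (kk := fun (i j : Z) (z : C) =>
    if Z_lt_dec i (-1) then RtoC 0 else if Z_lt_dec j (-1) then RtoC 0 else
      kc (Z.to_nat (i + 1)) (Z.to_nat (j + 1)) z).
  assert (Hp : forall n, (0 < r ^ n)%R) by (intros; apply pow_lt; auto).
  assert (Hkc : forall i j z, (Cmod (z - cc p) <= r)%R ->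
    HS (fun l => k (i, j, l) * (z - cc p) ^ l) (kc i j z)).
  { intros i j z Hz. apply HS_tsum with (/ r ^ (i + j) * N)%R.
    pose proof (SumLe_inj (fun l : nat => (i, j, l)) _ _ ltac:(congruence) H1) as H3.
    apply (SumLe_scal _ _ (/ r ^ (i + j))) in H3; [|left; apply Rinv_0_lt_compat; auto].
    eapply SumLe_le; [| |apply H3]; [|lra]. intros l. cbv beta.
    unfold deg; simpl fst; simpl snd. rewrite Cmod_mult, Cmod_pow, (pow_add r (i + j) l).
    replace (/ r ^ (i + j) * (Cmod (k (i, j, l)) * (r ^ (i + j) * r ^ l)))%R with
      (Cmod (k (i, j, l)) * r ^ l)%R by (field; specialize (Hp (i + j)%nat); lra).
    apply Rmult_le_compat_l; [apply Cmod_ge_0|]. apply pow_incr. split; [apply Cmod_ge_0|auto]. }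
  exists kk. split.
  - exists 1%nat, r0. split; auto. split; [|split].
    + intros i j z Hij. unfold kk. simpl Z.of_nat in Hij.
      destruct (Z_lt_dec i (-1)); auto. destruct (Z_lt_dec j (-1)); auto. lia.
    + intros i j. unfold kk.
      destruct (Z_lt_dec i (-1)).
      { exists (fun _ => 0). intros z _. apply HS_is_pseries.
        eapply HS_ext; [|apply HS_0]. intros; simpl; ring. }
      destruct (Z_lt_dec j (-1)).
      { exists (fun _ => 0). intros z _. apply HS_is_pseries.
        eapply HS_ext; [|apply HS_0]. intros; simpl; ring. }
      exists (fun l => k (Z.to_nat (i + 1), Z.to_nat (j + 1), l)). intros z Hz.
      apply HS_is_pseries. apply Hkc. lra.
    + intros q Hq HXn HYn.
      assert (Hq' : polydisc p r' q) by (unfold polydisc in *; destruct Hq as [? [? ?]]; repeat split; lra).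
      pose proof (Hbox q Hq') as Hin. pose proof (H2 q Hin) as Hs.
      set (X := form H q) in *. set (Y := form K q) in *.
      pose proof (term_SumLe _ _ _ r N k (fun e => e) q H1 Hin) as Hsum.
      assert (Hrow : forall ij : nat * nat, HS (fun l => k (ij, l) * mon X Y (cc q - cc p) (ij, l))
        (kc (fst ij) (snd ij) (cc q) * X ^ fst ij * Y ^ snd ij)).
      { intros [i j]. simpl fst; simpl snd.
        pose proof (Hkc i j (cc q) (proj2 (proj2 Hin))) as Hl.
        apply (HS_scal _ _ (X ^ i * Y ^ j)) in Hl.
        replace (kc i j (cc q) * X ^ i * Y ^ j) with (X ^ i * Y ^ j * kc i j (cc q)) by ring.
        eapply HS_ext; [|apply Hl]. intros l. unfold mon; simpl. ring. }
      assert (Hs2 : HS (fun ij : nat * nat => kc (fst ij) (snd ij) (cc q) * X ^ fst ij * Y ^ snd ij) (S q)).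
      { apply (HS_pair (fun e : E3 => k e * mon X Y (cc q - cc p) e) _ _ N Hsum Hrow). auto. }
      pose proof (SumLe_fst (fun e : E3 => k e * mon X Y (cc q - cc p) e) _ N Hsum Hrow) as Hsum2.
      assert (Ht : forall i j : nat, kk (Z.of_nat i - Z.of_nat 1)%Z (Z.of_nat j - Z.of_nat 1)%Z (cc q) *
        Cpow_Z X (Z.of_nat i - Z.of_nat 1) * Cpow_Z Y (Z.of_nat j - Z.of_nat 1) =
        / (X * Y) * (kc i j (cc q) * X ^ i * Y ^ j)).
      { intros i j. change (Z.of_nat 1) with 1%Z. rewrite !Cpow_Z_pred by auto.
        unfold kk. destruct (Z_lt_dec (Z.of_nat i - 1) (-1)); [lia|].
        destruct (Z_lt_dec (Z.of_nat j - 1) (-1)); [lia|].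
        replace (Z.to_nat (Z.of_nat i - 1 + 1)) with i by lia.
        replace (Z.to_nat (Z.of_nat j - 1 + 1)) with j by lia. field. auto. }
      apply (HS_scal _ _ (/ (X * Y))) in Hs2.
      apply (SumLe_scal _ _ (Cmod (/ (X * Y))) (Cmod_ge_0 _)) in Hsum2.
      apply HS_has_sum2 with (Cmod (/ (X * Y)) * N)%R.
      * eapply SumLe_le; [| |apply Hsum2]; [|lra]. intros ij. cbv beta zeta.
        rewrite Ht, Cmod_mult. lra.
      * replace (T q) with (/ (X * Y) * S q).
        2:{ rewrite (HS0 q Hq' HXn HYn). fold X Y. field. auto. }
        eapply HS_ext; [|apply Hs2]. intros ij. cbv beta zeta. rewrite Ht. auto.
  - unfold kk. destruct (Z_lt_dec (-1) (-1)); [lia|]. simpl Z.to_nat.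
    rewrite <- Hv.
    assert (Hin : inbox (form H) (form K) (fun q => cc q - cc p) r p).
    { apply Hbox. unfold polydisc. repeat split; match goal with |- (Cmod (?a - ?a) < _)%R =>
        replace (a - a) with (RtoC 0) by ring end; rewrite Cmod_0; auto. }
    assert (Z0 : cc p - cc p = 0) by ring.
    unfold kc. rewrite Z0.
    transitivity (k (0, 0, 0)%nat).
    + apply tsum_HS. eapply HS_ext; [|apply (HS_single O (k (0, 0, 0)%nat))].
      intros [|l]; unfold ind; destruct excluded_middle_informative; try congruence; simpl; ring.
    + pose proof (H2 p Hin) as Hs. cbv beta in Hs. rewrite HH, HK, Z0 in Hs.
      apply (HS_unique (fun e => k e * mon 0 0 0 e)); auto.
      eapply HS_ext; [|apply (HS_single (0, 0, 0)%nat (k (0, 0, 0)%nat))].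
      intros [[[|i] [|j]] [|l]]; unfold ind, mon; simpl;
        destruct excluded_middle_informative; try congruence; ring.
Qed.

Lemma polydisc_box p e q : polydisc p e q -> box (ofABC p) (3 * e) (ofABC q).
Proof.
  intros [Q1 [Q2 Q3]]. unfold box, inbox.
  replace (cx (ofABC p) (ofABC q)) with ((ca q - ca p) + (cc q - cc p))
    by (unfold cx, ofABC, ca, cb, cc; simpl; ring).
  replace (cy (ofABC p) (ofABC q)) with ((cb q - cb p) + (cc q - cc p))
    by (unfold cy, ofABC, ca, cb, cc; simpl; ring).
  replace (cz (ofABC p) (ofABC q)) with ((ca q - ca p) + (cb q - cb p) + (cc q - cc p))
    by (unfold cz, ofABC, ca, cb, cc; simpl; ring).
  pose proof (Cmod_triangle (ca q - ca p) (cc q - cc p)).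
  pose proof (Cmod_triangle (cb q - cb p) (cc q - cc p)).
  pose proof (Cmod_triangle (ca q - ca p + (cb q - cb p)) (cc q - cc p)).
  pose proof (Cmod_triangle (ca q - ca p) (cb q - cb p)).
  pose proof (Cmod_ge_0 (ca q - ca p)). pose proof (Cmod_ge_0 (cb q - cb p)).
  repeat split; lra.
Qed.

(* [s] lists the coefficients of the coordinates cx, cy, cz in terms of X, Y and c. *)
Lemma mixed_general T H K p v (X Y : C3 -> C) (s : nat -> nat -> C) :
  is_meromorphic_continuation T ->
  form H p = 0 -> form K p = 0 ->
  (forall w, analytic w X) -> (forall w, analytic w Y) ->
  (forall e w, box (ofABC p) e w -> (Cmod (X w) <= e /\ Cmod (Y w) <= e)%R) ->
  (forall q, form H q = X (ofABC q)) -> (forall q, form K q = Y (ofABC q)) ->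
  (forall i j, (Cmod (s i j) <= 1)%R) ->
  (forall w, cx (ofABC p) w = s 0%nat 0%nat * X w + s 0%nat 1%nat * Y w + s 0%nat 2%nat * (uc w - cc p)) ->
  (forall w, cy (ofABC p) w = s 1%nat 0%nat * X w + s 1%nat 1%nat * Y w + s 1%nat 2%nat * (uc w - cc p)) ->
  (forall w, cz (ofABC p) w = s 2%nat 0%nat * X w + s 2%nat 1%nat * Y w + s 2%nat 2%nat * (uc w - cc p)) ->
  (exists d, (0 < d)%R /\ forall w, box (ofABC p) d w -> X w <> 0 -> Y w <> 0 -> nonpolar w) ->
  holv (ofABC p) (fun w => X w * Y w * Tu T w) v ->
  mixed_coefficient T H K p v.
Proof.
  intros HT HH HK HXa HYa HXY HX HY Hs Hx Hy Hz [d [Hd Hnp]] Hv.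
  set (u := ofABC p) in *.
  destruct (holv_germ _ _ _ Hv) as [r0 [S [Hr0 [[r1 [N [Hr1 HS]]] [HSv HG]]]]].
  destruct (radius3 r0 r1 d) as [r [Hr [R0 [R1 R2]]]]; auto.
  apply (Wat_shrink u r1 r) in HS; [|lra].
  (* The map [ofABC] enlarges a polydisc at most threefold, and on radius r / 3 in X, Y, c the
     centred coordinates have norm at most r; together this gives r / 9. *)
  assert (Hbox : forall q, polydisc p (r / 9) q -> box u (r / 3) (ofABC q)).
  { intros q Hq. apply (box_le u _ (3 * (r / 9))); [lra|]. apply polydisc_box; auto. }
  apply (mixed_of_W T H K p (r / 3) (r / 9) N (fun q => S (ofABC q))); auto; try lra.
  - apply (W_subst (fun q => cx u (ofABC q)) (fun q => cy u (ofABC q)) (fun q => cz u (ofABC q)) _ _ _ r);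
      [lra| | | |apply (W_comp ofABC (cx u) (cy u) (cz u)); auto].
    + apply W_le with (3 * (r / 3))%R; [lra|].
      apply (W_comb _ _ _ _ (s 0%nat 0%nat) (s 0%nat 1%nat) (s 0%nat 2%nat)); auto; [lra|].
      intros q. rewrite HX, HY, Hx, uc_of. auto.
    + apply W_le with (3 * (r / 3))%R; [lra|].
      apply (W_comb _ _ _ _ (s 1%nat 0%nat) (s 1%nat 1%nat) (s 1%nat 2%nat)); auto; [lra|].
      intros q. rewrite HX, HY, Hy, uc_of. auto.
    + apply W_le with (3 * (r / 3))%R; [lra|].
      apply (W_comb _ _ _ _ (s 2%nat 0%nat) (s 2%nat 1%nat) (s 2%nat 2%nat)); auto; [lra|].
      intros q. rewrite HX, HY, Hz, uc_of. auto.
  - intros q Hq. unfold inbox. rewrite HX, HY.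
    destruct (HXY _ _ (Hbox q Hq)). destruct Hq as [_ [_ Hq]]. repeat split; auto. lra.
  - intros q Hq HXn HYn. rewrite HX in *. rewrite HY in *. rewrite <- (Tu_of T q).
    assert (Hn : nonpolar (ofABC q)) by (apply Hnp; auto; apply (box_le u d (r / 3)); auto; lra).
    apply (holv_unique (ofABC q) (fun w => X w * Y w * Tu T w)).
    + apply HG, (box_le u r0 (r / 3)); auto; lra.
    + apply (analytic_holv (ofABC q) (fun w => X w * Y w * Tu T w)).
      apply analytic_mult; [apply analytic_mult; auto|apply (Tu_analytic T _ HT Hn)].
Qed.

Lemma form_HA0 l p : form (HA l) p = 0 -> ca (ofABC p) = - RtoC (INR l).
Proof.
  rewrite form_of. intros H.
  replace (ca (ofABC p)) with (ca (ofABC p) + RtoC (INR l) - RtoC (INR l)) by ring.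
  rewrite H. ring.
Qed.

Lemma form_HB0 m p : form (HB m) p = 0 -> cb (ofABC p) = - RtoC (INR m).
Proof.
  rewrite form_of. intros H.
  replace (cb (ofABC p)) with (cb (ofABC p) + RtoC (INR m) - RtoC (INR m)) by ring.
  rewrite H. ring.
Qed.

Lemma natpole_HA p : natpole (ca (ofABC p)) -> exists l, form (HA l) p = 0.
Proof. intros [l H]. exists l. rewrite form_of, H. ring. Qed.

Lemma natpole_HB p : natpole (cb (ofABC p)) -> exists m, form (HB m) p = 0.
Proof. intros [m H]. exists m. rewrite form_of, H. ring. Qed.

Definition tab (a b c d e f g h i : C) (x y : nat) : C :=
  match x, y with
  | 0, 0 => a | 0, 1 => b | 0, _ => c
  | 1, 0 => d | 1, 1 => e | 1, _ => f
  | _, 0 => g | _, 1 => h | _, _ => i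
  end%nat.

Lemma tab_le a b c d e f g h i x y :
  (Cmod a <= 1)%R -> (Cmod b <= 1)%R -> (Cmod c <= 1)%R -> (Cmod d <= 1)%R ->
  (Cmod e <= 1)%R -> (Cmod f <= 1)%R -> (Cmod g <= 1)%R -> (Cmod h <= 1)%R ->
  (Cmod i <= 1)%R -> (Cmod (tab a b c d e f g h i x y) <= 1)%R.
Proof. intros. destruct x as [|[|x]], y as [|[|y]]; auto. Qed.

Lemma Cmod_unit_le : (Cmod 0 <= 1)%R /\ (Cmod 1 <= 1)%R /\ (Cmod (-(1)) <= 1)%R.
Proof. rewrite Cmod_opp, Cmod_1, Cmod_0. lra. Qed.

Lemma cx_ne p w : ca w <> ca p <-> cx p w <> 0.
Proof.
  unfold cx. split; intros H H0; apply H; [|rewrite H0; ring].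
  replace (ca w) with (ca w - ca p + ca p) by ring. rewrite H0. ring.
Qed.

Lemma cy_ne p w : cb w <> cb p <-> cy p w <> 0.
Proof.
  unfold cy. split; intros H H0; apply H; [|rewrite H0; ring].
  replace (cb w) with (cb w - cb p + cb p) by ring. rewrite H0. ring.
Qed.

Lemma cz_ne p w : cc w <> cc p <-> cz p w <> 0.
Proof.
  unfold cz. split; intros H H0; apply H; [|rewrite H0; ring].
  replace (cc w) with (cc w - cc p + cc p) by ring. rewrite H0. ring.
Qed.

Lemma mixed_AB T l m p : is_meromorphic_continuation T -> generic_point (HA l) (HB m) p ->
  mixed_coefficient T (HA l) (HB m) p 0.
Proof.
  intros HT [Ha [Hb Hg]]. destruct Cmod_unit_le as [U0 [U1 U2]].
  pose proof (form_HA0 _ _ Ha) as Ea. pose proof (form_HB0 _ _ Hb) as Eb.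
  assert (Hc : cc (ofABC p) <> 0).
  { intros H0. destruct (Hg HF) as [H|H]; [rewrite form_of; auto|discriminate|discriminate]. }
  (* The last row of the table is F = A_0 + B_0 - c, up to centring; the tables in [mixed_AF] and
     [mixed_BF] solve the same relation for B_0 and A_0. *)
  apply (mixed_general T _ _ p 0 (cx (ofABC p)) (cy (ofABC p))
    (tab 1 0 0 0 1 0 1 1 (-(1)))); auto; try (intros; apply analytic_cx); try (intros; apply analytic_cy);
    try (intros e w [? [? ?]]; auto).
  - intros q. rewrite form_of. unfold cx. rewrite Ea. ring.
  - intros q. rewrite form_of. unfold cy. rewrite Eb. ring.
  - intros; apply tab_le; auto.
  - intros; simpl; ring.
  - intros; simpl; ring.
  - intros; simpl. rewrite <- (uc_of p). unfold cx, cy, cz, uc. ring.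
  - destruct (polar_isolated (ofABC p)) as [d [Hd D]]. exists d. split; auto.
    intros w Hw HX HY. apply cx_ne in HX. apply cy_ne in HY. destruct (D w Hw) as [D1 [D2 D3]].
    split; [|split]; auto. intros H0. apply Hc. rewrite <- D3; auto.
  - apply AB_value; auto.
Qed.

Lemma mixed_AF T l p : is_meromorphic_continuation T -> generic_point (HA l) HF p ->
  mixed_coefficient T (HA l) HF p (val l (cc p)).
Proof.
  intros HT [Ha [Hc Hg]]. destruct Cmod_unit_le as [U0 [U1 U2]].
  pose proof (form_HA0 _ _ Ha) as Ea. rewrite form_of in Hc.
  assert (Hb : ~ natpole (cb (ofABC p))).
  { intros H0. destruct (natpole_HB _ H0) as [m Hm].
    destruct (Hg (HB m) Hm) as [H|H]; discriminate. }
  apply (mixed_general T _ _ p _ (cx (ofABC p)) (cz (ofABC p))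
    (tab 1 0 0 (-(1)) 1 1 0 1 0)); auto; try (intros; apply analytic_cx); try (intros; apply analytic_cz);
    try (intros e w [? [? ?]]; auto).
  - intros q. rewrite form_of. unfold cx. rewrite Ea. ring.
  - intros q. rewrite form_of. unfold cz. rewrite Hc. ring.
  - intros; apply tab_le; auto.
  - intros; simpl; ring.
  - intros; simpl. rewrite <- (uc_of p). unfold cx, cy, cz, uc. ring.
  - intros; simpl; ring.
  - destruct (polar_isolated (ofABC p)) as [d [Hd D]]. exists d. split; auto.
    intros w Hw HX HY. apply cx_ne in HX. apply cz_ne in HY. destruct (D w Hw) as [D1 [D2 D3]].
    split; [|split]; intros H0; [apply HX; auto| |apply HY; rewrite (D3 H0); auto].
    apply Hb. rewrite <- D2; auto.
  - rewrite <- (uc_of p). apply A_value; auto.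
Qed.

Lemma mixed_BF T m p : is_meromorphic_continuation T -> generic_point (HB m) HF p ->
  mixed_coefficient T (HB m) HF p (val m (cc p)).
Proof.
  intros HT [Hb [Hc Hg]]. destruct Cmod_unit_le as [U0 [U1 U2]].
  pose proof (form_HB0 _ _ Hb) as Eb. rewrite form_of in Hc.
  assert (Ha : ~ natpole (ca (ofABC p))).
  { intros H0. destruct (natpole_HA _ H0) as [l Hl].
    destruct (Hg (HA l) Hl) as [H|H]; discriminate. }
  apply (mixed_general T _ _ p _ (cy (ofABC p)) (cz (ofABC p))
    (tab (-(1)) 1 1 1 0 0 0 1 0)); auto; try (intros; apply analytic_cy); try (intros; apply analytic_cz);
    try (intros e w [? [? ?]]; auto).
  - intros q. rewrite form_of. unfold cy. rewrite Eb. ring.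
  - intros q. rewrite form_of. unfold cz. rewrite Hc. ring.
  - intros; apply tab_le; auto.
  - intros; simpl. rewrite <- (uc_of p). unfold cx, cy, cz, uc. ring.
  - intros; simpl; ring.
  - intros; simpl; ring.
  - destruct (polar_isolated (ofABC p)) as [d [Hd D]]. exists d. split; auto.
    intros w Hw HX HY. apply cy_ne in HX. apply cz_ne in HY. destruct (D w Hw) as [D1 [D2 D3]].
    split; [|split]; intros H0; [|apply HX; auto|apply HY; rewrite (D3 H0); auto].
    apply Ha. rewrite <- D1; auto.
  - rewrite <- (uc_of p). apply B_value; auto.
Qed.

(** * The triple point *)

(** The sign turns the factors into (l + m) (l + m - 1) ... (m + 1). *)
Lemma poch_neg l m : (-1) ^ l * Cpochhammer (- RtoC (INR (l + m))) l =
  RtoC (INR (fact (l + m))) / RtoC (INR (fact m)).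
Proof.
  induction l as [|l IH].
  - simpl. field. apply fact_nz.
  - rewrite poch_left.
    replace (- RtoC (INR (S l + m)) + 1) with (- RtoC (INR (l + m)))
      by (change (S l + m)%nat with (S (l + m)); rewrite S_INR, RtoC_plus; ring).
    transitivity (RtoC (INR (S l + m)) * ((-1) ^ l * Cpochhammer (- RtoC (INR (l + m))) l)).
    { simpl Cpow. ring. }
    rewrite IH. change (S l + m)%nat with (S (l + m)).
    rewrite fact_simpl, mult_INR, RtoC_mult. field. apply fact_nz.
Qed.

Lemma val_binom l m : val l (- RtoC (INR (l + m))) = RtoC (Binomial.C (l + m) l).
Proof.
  unfold val, Binomial.C. replace (l + m - l)%nat with m by lia.
  pose proof (poch_neg l m) as H. pose proof (fact_nz l). pose proof (fact_nz m).
  transitivity (((-1) ^ l * Cpochhammer (- RtoC (INR (l + m))) l) / RtoC (INR (fact l))).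
  { field. auto. }
  rewrite H, RtoC_div, RtoC_mult.
  - field. auto.
  - apply Rmult_integral_contrapositive_currified; apply INR_fact_neq_0.
Qed.

Lemma binom_sym l m : Binomial.C (m + l) m = Binomial.C (l + m) l.
Proof.
  unfold Binomial.C. rewrite (Nat.add_comm m l).
  replace (l + m - m)%nat with l by lia. replace (l + m - l)%nat with m by lia.
  rewrite Rmult_comm. reflexivity.
Qed.

(* f = A(Y) + X B(X,Y) + Z C(Y,Z) + X Z D *)
Lemma Wat_split4 u r N f : (0 < r)%R -> Wat u r N f ->
  exists (A : C -> C) (B D : C -> C -> C) (E : C3 -> C),
    analytic u (fun q => A (cy u q)) /\ analytic u (fun q => B (cx u q) (cy u q)) /\
    analytic u (fun q => D (cy u q) (cz u q)) /\ analytic u E /\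
    forall q, box u r q -> f q = A (cy u q) + cx u q * B (cx u q) (cy u q) +
      cz u q * D (cy u q) (cz u q) + cx u q * cz u q * E q.
Proof.
  intros Hr Hf.
  destruct (W_split _ _ _ _ _ _ Hr Hf) as [g [f1 [Hg [Hf1 Hsp]]]].
  apply (W_perm _ _ _ (cy u) (cz u) (cx u)) in Hf1; auto.
  destruct (W_split _ _ _ _ _ _ Hr Hf1) as [D [E [HD [HE Hsp1]]]].
  apply (W_perm _ _ _ (cy u) (cz u) (cx u)) in Hg; auto.
  destruct (W_split _ _ _ _ _ _ Hr Hg) as [A2 [B2 [HA [HB Hsp2]]]].
  (* [W_split] returns B2 as a function of the whole point. Projecting to Z = 0, which leaves g
     unchanged, makes it a function of X and Y. *)
  set (pr := fun q : C3 => (ca q, cb q, cc u) : C3).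
  assert (Px : forall q, cx u (pr q) = cx u q) by reflexivity.
  assert (Py : forall q, cy u (pr q) = cy u q) by reflexivity.
  assert (Pz : forall q, cz u (pr q) = 0) by (intros; unfold cz, pr, cc; simpl; ring).
  assert (Hpr : forall N' h, W (cy u) (cz u) (cx u) r N' h ->
    W (cx u) (cy u) (cz u) r N' (fun q => h (pr q))).
  { intros N' h Hh.
    apply (W_subst (cy u) (fun _ => 0) (cx u) _ _ _ r); auto.
    - apply W_y; auto.
    - apply W_le with (Cmod 0); [rewrite Cmod_0; lra|apply W_const; auto].
    - apply W_x; auto.
    - apply (W_comp pr (cy u) (cz u) (cx u)); auto. }
  set (pt := fun x y : C => (ca u + x, cb u + y, cc u) : C3).
  assert (Hpt : forall q, pt (cx u q) (cy u q) = pr q).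
  { intros q. apply C3_eq; unfold pt, pr, cx, cy, ca, cb, cc; simpl; ring. }
  exists (fun y => A2 y 0), (fun x y => B2 (pt x y)), D, E. split; [|split; [|split; [|split]]].
  - exists r, N. split; auto.
    apply W_ext with (fun q => A2 (cy u (pr q)) (cz u (pr q))).
    + intros q _. rewrite Py, Pz. auto.
    + apply (Hpr N (fun q => A2 (cy u q) (cz u q))). auto.
  - exists r, (N / r)%R. split; auto.
    apply W_ext with (fun q => B2 (pr q)); [intros q _; rewrite Hpt; auto|].
    apply Hpr; auto.
  - exists r, (N / r)%R. split; auto.
    apply (W_perm (cy u) (cz u) (cx u)); auto.
  - exists r, (N / r / r)%R. split; auto.
    apply (W_perm (cy u) (cz u) (cx u)); auto.
  - intros q Hq. rewrite (Hsp q Hq).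
    assert (Hin : inbox (cy u) (cz u) (cx u) r q) by (destruct Hq as [? [? ?]]; repeat split; auto).
    assert (Hinp : inbox (cy u) (cz u) (cx u) r (pr q)).
    { unfold inbox. rewrite Px, Py, Pz, Cmod_0. destruct Hq as [? [? ?]]; repeat split; auto; lra. }
    rewrite (Hsp1 q Hin). pose proof (Hsp2 _ Hinp) as E2. cbv beta in E2.
    rewrite Px, Py, Pz in E2. rewrite E2, Hpt. ring.
Qed.

Lemma analytic_holomorphic f p : analytic (ofABC p) f -> holomorphic_at (fun q => f (ofABC q)) p.
Proof.
  intros [r [N [Hr Hf]]]. apply (W_holomorphic _ p (r / 3) N); [lra|].
  destruct Cmod_unit_le as [U0 [U1 _]].
  apply (W_subst (fun q => cx (ofABC p) (ofABC q)) (fun q => cy (ofABC p) (ofABC q))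
    (fun q => cz (ofABC p) (ofABC q)) _ _ _ r); [lra| | | |].
  - apply W_le with (3 * (r / 3))%R; [lra|]. apply (W_comb _ _ _ _ 1 0 1); auto; [lra|].
    intros q. unfold cx, cz, ofABC, ca, cb, cc; simpl. ring.
  - apply W_le with (3 * (r / 3))%R; [lra|]. apply (W_comb _ _ _ _ 0 1 1); auto; [lra|].
    intros q. unfold cx, cy, cz, ofABC, ca, cb, cc; simpl. ring.
  - apply W_le with (3 * (r / 3))%R; [lra|]. apply (W_comb _ _ _ _ 1 1 1); auto; [lra|].
    intros q. unfold cx, cy, cz, ofABC, ca, cb, cc; simpl. ring.
  - apply (W_comp ofABC (cx (ofABC p)) (cy (ofABC p)) (cz (ofABC p))); auto.
Qed.

Lemma analytic_val p l : analytic p (fun q => val l (uc q)).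
Proof.
  apply analytic_mult; [apply analytic_const|].
  exists 1%R. eexists. split; [lra|]. apply W_bc; [lra|apply W_uc'; lra].
Qed.

(* The coefficient of 1/(XZ) at the triple point is the limit along X = Z = 0 of its
   values at the generic points of A_l = F = 0. *)
Lemma two_term_value T u l r N1 N2 S1 S2 : is_meromorphic_continuation T -> (0 < r)%R ->
  ca u = - RtoC (INR l) -> (exists m : nat, cb u = - RtoC (INR m)) -> cc u = 0 ->
  Wat u r N1 S1 -> Wat u r N2 S2 ->
  (forall q, box u r q -> good q ->
     cx u q * cy u q * cz u q * Tu T q = cy u q * S1 q + cx u q * S2 q) ->
  S1 u = val l (uc u).
Proof.
  intros HT Hr Ha [m Hb] Hc H1 H2 H.
  (* Moving along Y alone stays on A_l = F = 0 and leaves the B-family at once. *)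
  apply (analytic_eq_dir u 0 1 0 S1 (fun q => val l (uc q)));
    [exists r, N1; auto|apply analytic_val|].
  destruct (C_not_int (cb u)) as [d [Hd Hdn]].
  exists (Rmin d r). split; [apply Rmin_pos; auto|]. intros e He.
  pose proof (Rmin_l d r). pose proof (Rmin_r d r).
  rewrite !Rmult_0_r, Rmult_1_r. set (q := add3 u (vec 0 e 0)).
  assert (Qa : ca q = ca u) by (unfold q; rewrite ca_add3, ca_vec; ring).
  assert (Qb : cb q = cb u + RtoC e) by (unfold q; rewrite cb_add3, cb_vec; ring).
  assert (Qc : cc q = cc u) by (unfold q; rewrite cc_add3, cc_vec; ring).
  assert (Qx : cx u q = 0) by (unfold cx; rewrite Qa; ring).
  assert (Qy : cy u q = RtoC e) by (unfold cy; rewrite Qb; ring).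
  assert (Qz : cz u q = 0) by (unfold cz; rewrite Qc; ring).
  assert (He0 : cy u q <> 0) by (rewrite Qy; intros HC0; apply RtoC_inj in HC0; lra).
  destruct (Wat_recenter u r N1 S1 q H1) as [r1 [Hr1 [H1' B1]]];
    try (rewrite ?Qx, ?Qy, ?Qz, ?Cmod_0, ?Cmod_R, ?Rabs_pos_eq; lra).
  destruct (Wat_recenter u r N2 S2 q H2) as [r2 [Hr2 [H2' B2]]];
    try (rewrite ?Qx, ?Qy, ?Qz, ?Cmod_0, ?Cmod_R, ?Rabs_pos_eq; lra).
  apply (holv_unique q (fun w => cx q w * cz q w * Tu T w)).
  (* Where Y is invertible, X Z T = S1 + X S2 / Y, and the second term vanishes on X = 0. *)
  - assert (Hh : holv q (fun w => S1 w + / cy u w * cx u w * S2 w) (S1 q)).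
    { replace (S1 q) with (S1 q + / cy u q * cx u q * S2 q) by (rewrite Qx; ring).
      apply holv_plus; [apply analytic_holv; exists r1, N1; auto|].
      apply (analytic_holv q (fun w => / cy u w * cx u w * S2 w)).
      apply analytic_mult; [apply analytic_mult|exists r2, N2; auto].
      - apply analytic_inv_cy; auto.
      - apply analytic_cx. }
    apply (holv_ext q _ _ _ Hh). exists r1. split; auto. intros w Hw Hg.
    assert (Hyw : cy u w <> 0).
    { apply cy_ne. rewrite Hb, INR_IZR_INZ, <- RtoC_opp, <- opp_IZR. apply (Hg (- Z.of_nat m)%Z). }
    pose proof (H w (B1 w Hw) Hg) as E.
    replace (cx q w) with (cx u w) by (unfold cx; rewrite Qa; auto).
    replace (cz q w) with (cz u w) by (unfold cz; rewrite Qc; auto).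
    transitivity (/ cy u w * (cy u w * S1 w + cx u w * S2 w)); [field; auto|].
    rewrite <- E. field. auto.
  - apply A_value; auto.
    + rewrite Qa; auto.
    + rewrite Qc; auto.
    + intros Hn. apply natpole_int in Hn as [n Hn]. rewrite Qb in Hn.
      apply (Hdn e ltac:(lra) n Hn).
Qed.

Lemma swap_swap q : swap (swap q) = q.
Proof. destruct q as [[? ?] ?]; reflexivity. Qed.

Lemma Wat_swap u r N f : (0 < r)%R -> Wat u r N f -> Wat (swap u) r N (fun q => f (swap q)).
Proof.
  intros Hr H. apply Wat_perm; [left; auto|auto|]. rewrite swap_swap. auto.
Qed.

Lemma analytic_swap u f : analytic (swap u) f -> analytic u (fun q => f (swap q)).
Proof. apply analytic_perm. left; auto. Qed.

Lemma triple_iff l m p :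
  (form (HA l) p = 0 /\ form (HB m) p = 0 /\ form HF p = 0) <-> p = triple_point l m.
Proof.
  split.
  - intros [H1 [H2 H3]]. apply form_HA0 in H1. apply form_HB0 in H2. rewrite form_of in H3.
    rewrite <- (toABC_of p).
    apply C3_eq; unfold toABC; rewrite H1, H2, H3; unfold triple_point, ca, cb, cc; simpl; ring.
  - intros ->. unfold triple_point, form, ca, cb, cc; simpl. repeat split; ring.
Qed.

(** Near the point T = S1 / (X Z) + S2 / (Y Z). Writing S1 = A(Y) + X B(X,Y) + Z D(Y,Z) + X Z E, and
    S2 likewise with X and Y exchanged, cancels denominators until each coefficient depends only on
    the coordinates missing below it. No term ever has X Y in its denominator. *)
Lemma triple_case T l m : is_meromorphic_continuation T ->
  exists h : bool -> bool -> bool -> C3 -> C,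
    triple_expansion T (HA l) (HB m) HF (triple_point l m) h /\
    h true false true (triple_point l m) = Binomial.C (l + m) l /\
    h false true true (triple_point l m) = Binomial.C (l + m) l /\
    not_occurring (h true true false) (triple_point l m) /\
    not_occurring (h true true true) (triple_point l m).
Proof.
  intros HT. set (p := triple_point l m). set (u := ofABC p).
  destruct (proj2 (triple_iff l m p) eq_refl) as [Fa [Fb Fc]].
  pose proof (form_HA0 _ _ Fa) as Ha. pose proof (form_HB0 _ _ Fb) as Hb.
  rewrite form_of in Fc. fold u in Ha, Hb, Fc.
  assert (Hu : uc u = - RtoC (INR (l + m))).
  { unfold uc. rewrite Ha, Hb, Fc, plus_INR, RtoC_plus. ring. }
  destruct (two_term_any T u HT) as [g1 [g2 [[v1 [r1 [N1 [S1 [Hr1 [HS1 [_ H1]]]]]]]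
    [[v2 [r2 [N2 [S2 [Hr2 [HS2 [_ H2]]]]]]] HG]]]].
  set (r := Rmin r1 r2).
  assert (Hr : (0 < r)%R) by (apply Rmin_pos; auto).
  assert (D1 : (r <= r1)%R) by apply Rmin_l. assert (D2 : (r <= r2)%R) by apply Rmin_r.
  apply (Wat_shrink u r1 r) in HS1; [|lra]. apply (Wat_shrink u r2 r) in HS2; [|lra].
  assert (HS : forall q, box u r q -> good q ->
     cx u q * cy u q * cz u q * Tu T q = cy u q * S1 q + cx u q * S2 q).
  { intros q Hq Hg. rewrite HG, H1, H2; auto; eapply box_le; eauto. }
  assert (V1 : S1 u = RtoC (Binomial.C (l + m) l)).
  { rewrite <- val_binom, <- Hu.
    apply (two_term_value T u l r N1 N2 S1 S2); auto. exists m; auto. }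
  (* The swapped point is the triple point for (m, l), and there S2 takes the part of S1. *)
  assert (V2 : S2 u = RtoC (Binomial.C (l + m) l)).
  { rewrite <- binom_sym, <- val_binom, Nat.add_comm, <- Hu.
    replace (uc u) with (uc (swap u)) by (unfold uc, swap, ca, cb, cc; simpl; ring).
    rewrite <- (swap_swap u) at 1.
    apply (two_term_value T (swap u) m r N2 N1 (fun q => S2 (swap q)) (fun q => S1 (swap q)));
      try (apply Wat_swap; auto); auto.
    - exists l; auto.
    - intros q Hq Hg.
      assert (Hq' : box u r (swap q)) by (destruct Hq as [? [? ?]]; unfold box, inbox in *; tauto).
      pose proof (HS (swap q) Hq' (good_swap _ Hg)) as E. rewrite Tu_swap in E by auto.
      change (cx u (swap q)) with (cy (swap u) q) in E.
      change (cy u (swap q)) with (cx (swap u) q) in E.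
      change (cz u (swap q)) with (cz (swap u) q) in E.
      transitivity (cy (swap u) q * cx (swap u) q * cz (swap u) q * Tu T q); [ring|].
      rewrite E. ring. }
  destruct (Wat_split4 u r N1 S1 Hr HS1) as [A [B [D [E [KA [KB [KD [KE Hsp]]]]]]]].
  destruct (Wat_split4 (swap u) r N2 (fun q => S2 (swap q)) Hr (Wat_swap _ _ _ _ Hr HS2))
    as [A' [B' [D' [E' [KA' [KB' [KD' [KE' Hsp']]]]]]]].
  assert (Hsp2 : forall q, box u r q -> S2 q = A' (cx u q) + cy u q * B' (cy u q) (cx u q) +
      cz u q * D' (cx u q) (cz u q) + cy u q * cz u q * E' (swap q)).
  { intros q Hq. rewrite <- (swap_swap q) at 1. apply (Hsp' (swap q)).
    destruct Hq as [? [? ?]]; unfold box, inbox in *; tauto. }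
  assert (Zx : cx u u = 0) by (unfold cx; ring).
  assert (Zy : cy u u = 0) by (unfold cy; ring).
  assert (Zz : cz u u = 0) by (unfold cz; ring).
  assert (A0 : A 0 = RtoC (Binomial.C (l + m) l)).
  { rewrite <- V1, (Hsp u) by (apply box_refl; lra). rewrite Zx, Zy, Zz. ring. }
  assert (A0' : A' 0 = RtoC (Binomial.C (l + m) l)).
  { rewrite <- V2, (Hsp2 u) by (apply box_refl; lra). rewrite Zx, Zy, Zz. ring. }
  (* The two splittings meet only in the coefficient of 1/Z and in the holomorphic part, where their
     contributions add. *)
  set (hh := fun (x y z : bool) (w : C3) =>
    match x, y, z with
    | true, false, true => A (cy u w)
    | false, true, true => A' (cx u w)
    | true, false, false => D (cy u w) (cz u w)
    | false, true, false => D' (cx u w) (cz u w)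
    | false, false, true => B (cx u w) (cy u w) + B' (cy u w) (cx u w)
    | false, false, false => E w + E' (swap w)
    | true, true, _ => RtoC 0
    end).
  assert (Fx : forall q, form (HA l) q = cx u (ofABC q)).
  { intros q. rewrite form_of. unfold cx. rewrite Ha. ring. }
  assert (Fy : forall q, form (HB m) q = cy u (ofABC q)).
  { intros q. rewrite form_of. unfold cy. rewrite Hb. ring. }
  assert (Fz : forall q, form HF q = cz u (ofABC q)).
  { intros q. rewrite form_of. unfold cz. rewrite Fc. ring. }
  exists (fun x y z q => hh x y z (ofABC q)). split; [|split; [|split; [|split]]].
  - destruct (polar_isolated u) as [d [Hd Hdn]].
    assert (Hm : (0 < Rmin r d)%R) by (apply Rmin_pos; auto).
    pose proof (Rmin_l r d). pose proof (Rmin_r r d).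
    split; [|exists (Rmin r d / 4)%R; split; [lra|split]].
    + intros x y z. apply (analytic_holomorphic (hh x y z) p). fold u.
      destruct x, y, z; unfold hh; auto; try apply analytic_const.
      * apply (analytic_swap u (fun q => A' (cy (swap u) q))); auto.
      * apply (analytic_swap u (fun q => D' (cy (swap u) q) (cz (swap u) q))); auto.
      * apply analytic_plus; auto.
        apply (analytic_swap u (fun q => B' (cx (swap u) q) (cy (swap u) q))); auto.
      * apply analytic_plus; auto. apply analytic_swap; auto.
    + intros x y z q q' _ _ Hx Hy Hz. rewrite !Fx in Hx. rewrite !Fy in Hy. rewrite !Fz in Hz.
      destruct x, y, z; unfold hh; auto;
        rewrite ?Hx, ?Hy, ?Hz by auto; auto.
      replace (ofABC q) with (ofABC q'); auto.
      assert (Ec : forall a b c : C, a - c = b - c -> b = a).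
      { intros a b c Hab. replace b with (b - c + c) by ring. rewrite <- Hab. ring. }
      apply C3_eq; [apply (Ec _ _ (ca u))|apply (Ec _ _ (cb u))|apply (Ec _ _ (cc u))]; auto.
    + intros q Hq Hx Hy Hz. cbv zeta. rewrite Fx in Hx. rewrite Fy in Hy. rewrite Fz in Hz.
      rewrite !Fx, !Fy, !Fz. unfold pole_factor, hh. rewrite <- (Tu_of T q).
      set (w := ofABC q) in *.
      assert (Hw : box u (3 * (Rmin r d / 4)) w) by (apply polydisc_box; auto).
      assert (Hwr : box u r w) by (eapply box_le; [|apply Hw]; lra).
      (* The identity is known at good points only; off the hyperplanes through u both sides are
         analytic, so it extends by density. *)
      assert (HE0 : cx u w * cy u w * cz u w * Tu T w = cy u w * S1 w + cx u w * S2 w).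
      { destruct Hw as [W1 [W2 W3]].
        destruct (Wat_recenter u r N1 S1 w HS1) as [ra [Hra [HSa Ba]]]; try lra.
        destruct (Wat_recenter u r N2 S2 w HS2) as [rb [Hrb [HSb Bb]]]; try lra.
        assert (Hn : nonpolar w).
        { destruct (Hdn w) as [P1 [P2 P3]]; [eapply box_le; [|split; [|split]; eassumption]; lra|].
          apply cx_ne in Hx. apply cy_ne in Hy. apply cz_ne in Hz. split; [|split]; auto. }
        apply (analytic_eq_at w (fun w => cx u w * cy u w * cz u w * Tu T w)
          (fun w => cy u w * S1 w + cx u w * S2 w)).
        - apply analytic_mult; [apply analytic_mult; [apply analytic_mult|]|];
            [apply analytic_cx|apply analytic_cy|apply analytic_cz|apply (Tu_analytic T w HT Hn)].
        - apply analytic_plus; apply analytic_mult;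
            [apply analytic_cy|exists ra, N1; auto|apply analytic_cx|exists rb, N2; auto].
        - exists ra. split; auto. }
      rewrite (Hsp w Hwr), (Hsp2 w Hwr) in HE0.
      transitivity (/ (cx u w * cy u w * cz u w) * (cx u w * cy u w * cz u w * Tu T w)).
      { field. auto. }
      rewrite HE0. field. auto.
  - unfold hh. fold u. rewrite Zy. auto.
  - unfold hh. fold u. rewrite Zx. auto.
  - exists 1%R. split; [lra|]. reflexivity.
  - exists 1%R. split; [lra|]. reflexivity.
Qed.

Theorem theorem6p4 (T : C3 -> C) (HT : is_meromorphic_continuation T) :
  (forall (l m : nat) (p : C3), generic_point (HA l) (HB m) p ->
     mixed_coefficient T (HA l) (HB m) p 0) /\
  (forall (l : nat) (p : C3), generic_point (HA l) HF p ->
     mixed_coefficient T (HA l) HF p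
       ((-1) ^ l * (Cpochhammer (cc p) l / INR (fact l)))) /\
  (forall (m : nat) (p : C3), generic_point (HB m) HF p ->
     mixed_coefficient T (HB m) HF p
       ((-1) ^ m * (Cpochhammer (cc p) m / INR (fact m)))) /\
  (forall l m : nat,
     (forall p : C3,
        (form (HA l) p = 0 /\ form (HB m) p = 0 /\ form HF p = 0) <->
        p = triple_point l m) /\
     exists h : bool -> bool -> bool -> C3 -> C,
       triple_expansion T (HA l) (HB m) HF (triple_point l m) h /\
       h true false true (triple_point l m) = Binomial.C (l + m) l /\
       h false true true (triple_point l m) = Binomial.C (l + m) l /\
       not_occurring (h true true false) (triple_point l m) /\
       not_occurring (h true true true) (triple_point l m)).
Proof.
  split; [|split; [|split]].
  - intros l m p Hp. apply mixed_AB; auto.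
  - intros l p Hp. apply mixed_AF; auto.
  - intros m p Hp. apply mixed_BF; auto.
  - intros l m. split; [apply triple_iff|]. apply triple_case; auto.
Qed.
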